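(* Let $n\ge1$ and $0<\alpha<\pi$. For every compact set $Q\subset\mathbb{T}$ with $\mathrm{mes}(Q)=2\alpha$, $$U_n(Q)\ge\sin^{2n}\frac\alpha2,$$ with equality if and only if $Q$ is one of the segments $I_k(2\alpha)=\left[-\alpha+\frac{k\pi}n,\alpha+\frac{k\pi}n\right]$, $k\in\mathbb{Z}$ (taken modulo $2\pi$). Consequently $U_n(2\alpha)=\sin^{2n}\frac\alpha2$.
   Context: $\mathbb{T}=[0,2\pi)$ with endpoints identified, with Lebesgue measure $\mathrm{mes}$. $\mathcal{F}_{n-1}$ is the set of real trigonometric polynomials of order at most $n-1$. For compact $Q\subset\mathbb{T}$, $U_n(Q)=\inf\{\max_{t\in Q}|\cos nt-f_{n-1}(t)|:f_{n-1}\in\mathcal{F}_{n-1}\}$, and $U_n(2\alpha)=\inf\{U_n(Q):Q\subset\mathbb{T}\text{ compact},\ \mathrm{mes}(Q)=2\alpha\}$. *)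

(* Defs.v *)
From Stdlib Require Import Reals Lra ClassicalEpsilon.
Open Scope R_scope.

(* Supremum / infimum of a set of reals (total functions via choice;
   meaningful when the set is nonempty and bounded). *)
Definition Rsup (E : R -> Prop) : R :=
  epsilon (inhabits 0) (fun M => is_lub E M).
Definition Rinf (E : R -> Prop) : R := - Rsup (fun y => E (- y)).

(* A subset of T = R/2piZ is represented by its 2pi-periodic preimage in R.
   Compact subsets of T correspond to closed 2pi-periodic subsets of R. *)
Definition periodic_set (Q : R -> Prop) : Prop :=
  forall x, Q x <-> Q (x + 2 * PI).
Definition compact_T (Q : R -> Prop) : Prop :=
  closed_set Q /\ periodic_set Q.

(* Lebesgue outer measure on R (equals Lebesgue measure on compact sets). *)
Definition lebesgue_outer (A : R -> Prop) : R :=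
  Rinf (fun s => exists (a b : nat -> R),
          (forall i, a i <= b i) /\
          (forall x, A x -> exists i, a i <= x <= b i) /\
          Un_cv (fun N => sum_f_R0 (fun i => b i - a i) N) s).

Definition mes_T (Q : R -> Prop) : R :=
  lebesgue_outer (fun x => Q x /\ 0 <= x < 2 * PI).

Definition trig_poly (m : nat) (a b : nat -> R) (t : R) : R :=
  sum_f_R0 (fun k => a k * cos (INR k * t) + b k * sin (INR k * t)) m.

Definition dev (n : nat) (Q : R -> Prop) (a b : nat -> R) : R :=
  Rsup (fun y => exists t, Q t /\ y = Rabs (cos (INR n * t) - trig_poly (n - 1) a b t)).

Definition U_Q (n : nat) (Q : R -> Prop) : R :=
  Rinf (fun M => exists a b : nat -> R, M = dev n Q a b).

Definition U_mes (n : nat) (m : R) : R :=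
  Rinf (fun u => exists Q, compact_T Q /\ mes_T Q = m /\ u = U_Q n Q).

Definition is_segment_I (n : nat) (alpha : R) (k : Z) (Q : R -> Prop) : Prop :=
  forall x, Q x <-> exists m : Z,
    - alpha + IZR k * PI / INR n + 2 * PI * IZR m <= x <=
      alpha + IZR k * PI / INR n + 2 * PI * IZR m.

(* Main.v *)
(** Call T admissible if T = cos nt - f with f of order at most n - 1; put
    L(T, M) = mes {|T| <= M}.  Everything reduces to sin^{2n}(L(T, M)/4) <= M.

    At a global maximum xi of |T| the product T'(t) cot((t - xi)/2) is again a
    trigonometric polynomial, with leading part - n cos nt.  Moving T along the
    field cot((t - xi)/2) therefore multiplies the normalised level M by
    1 + n eps + O(eps^2), while the set {|T| <= M} is stretched by the map
    x |-> x + eps tan(x/2) in the coordinate x = t - xi - PI; by the bathtub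
    principle its length grows by at least 2 eps tan(L/4), strictly more unless
    the set is an arc centred opposite to xi.  For theta < 1 the functional
    2n ln sin(L/4) - theta ln M thus strictly increases along the flow, so it has
    no maximiser with M < 1, and compactness gives the inequality.

    If equality holds, {|T| <= M} is an arc with centre c.  T takes the same value
    +-M at both ends, so either it alternates 2n + 1 times, or some G of order at
    most n - 1 has the sign of T at all the points of the arc where |T| = M and
    T - eta G contradicts the inequality.  Alternation forces T to be symmetric
    about c, that is sin nc = 0. *)

Require Import Defs.
From Stdlib Require Import Reals Ranalysis5 ZArith Lra Lia Classical ClassicalEpsilon.
From mathcomp Require all_ssreflect_compat ssralg ssrnum interval.
From mathcomp Require mathcomp_extra boolp classical_sets reals ereal topology
  normedtype sequences measure measurable_realfun lebesgue_measure Rstruct Rstruct_topology.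
Open Scope R_scope.

(** * Lebesgue outer measure *)

(** The measure of {|T| <= M} need not depend differentiably on T, so there is no variational
    formula to differentiate. What replaces it is a one-sided estimate of first order in eps,
    obtained from Lipschitz images under outer measure. With theta = 1 the first-order gain may
    vanish when the level set is an arc opposite to xi, so a maximiser could not be excluded; theta
    < 1 adds the positive term n (1 - theta). The same step with theta = 1 is kept for the case of
    equality.

    Compactness is the second obstacle, because admissible polynomials form an unbounded family. A
    positive value of the functional forces a definite measure of the level set; such a set contains
    2n - 1 separated points, and interpolation there bounds T on the whole circle.

    Sharpness comes from the Chebyshev polynomial of an arc, q^n T_n((cos t - p)/q) with p =
    cos^2(alpha/2) and q = sin^2(alpha/2), whose maximum on the arc is q^n. *)

Lemma Rsup_is_lub (E : R -> Prop) :
  (exists x, E x) -> bound E -> is_lub E (Rsup E).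
Proof.
intros HE HB. unfold Rsup. apply epsilon_spec.
destruct (completeness E HB HE) as [m Hm]. now exists m.
Qed.

(** [epsilon] returns a true least upper bound only for a nonempty bounded set, which is why a lower
    bound [l] has to be supplied although the conclusion does not mention it. *)
Lemma Rinf_lower (E : R -> Prop) (l x : R) :
  (forall y, E y -> l <= y) -> E x -> Rinf E <= x.
Proof.
intros Hl Hx. unfold Rinf.
destruct (Rsup_is_lub (fun y => E (- y))) as [H _].
- exists (- x). now rewrite Ropp_involutive.
- exists (- l). intros y Hy. specialize (Hl _ Hy). lra.
- assert (H1 := H (- x)). simpl in H1. rewrite Ropp_involutive in H1.
  specialize (H1 Hx). lra.
Qed.

Lemma Rinf_greatest (E : R -> Prop) (l : R) :
  (exists x, E x) -> (forall y, E y -> l <= y) -> l <= Rinf E.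
Proof.
intros [x Hx] Hl. unfold Rinf.
destruct (Rsup_is_lub (fun y => E (- y))) as [_ H].
- exists (- x). now rewrite Ropp_involutive.
- exists (- l). intros y Hy. specialize (Hl _ Hy). lra.
- assert (H1 : Rsup (fun y => E (- y)) <= - l).
  { apply H. intros y Hy. specialize (Hl _ Hy). lra. }
  lra.
Qed.

Definition segment_bounded (A : R -> Prop) : Prop :=
  exists a b, forall x, A x -> a <= x <= b.

Definition cover_sum (A : R -> Prop) (s : R) : Prop :=
  exists a b : nat -> R, (forall i, a i <= b i) /\
    (forall x, A x -> exists i, a i <= x <= b i) /\
    Un_cv (fun N => sum_f_R0 (fun i => b i - a i) N) s.

Lemma lebesgue_outer_cover A : lebesgue_outer A = Rinf (cover_sum A).
Proof. reflexivity. Qed.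

Lemma cover_sum_ge0 A s : cover_sum A s -> 0 <= s.
Proof.
intros (a & b & Hab & _ & Hs).
apply Rle_trans with (sum_f_R0 (fun i => b i - a i) 0).
- simpl. specialize (Hab 0%nat). lra.
- apply (growing_ineq (fun N => sum_f_R0 (fun i => b i - a i) N)); [|exact Hs].
  intros N. simpl. specialize (Hab (S N)). lra.
Qed.

(** * Comparison of [lebesgue_outer] with the Lebesgue measure of mathcomp *)

Section LebesgueMeasure.
Import all_ssreflect_compat ssralg ssrnum interval.
Import mathcomp_extra boolp classical_sets reals ereal topology
  normedtype sequences measure lebesgue_measure Rstruct Rstruct_topology.
Import Order.TTheory GRing.Theory Num.Theory numFieldNormedType.Exports.
Local Open Scope classical_set_scope.
Local Open Scope ring_scope.

Local Notation mu := (@lebesgue_measure R : set R -> \bar R).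

Let mu_le (A B : set R) : A `<=` B -> (mu A <= mu B)%E.
Proof. exact: (@le_mu_ext _ _ _ (wlength idfun)). Qed.

Let mu_itvcc (a b : R) : a <= b -> mu `[a, b]%classic = (b - a)%:E.
Proof.
move=> ab; rewrite lebesgue_measure_itv/= lte_fin; case: ltP => // ba.
by have -> : b = a; [apply/eqP; rewrite eq_le ba ab|rewrite subrr].
Qed.

Let mu_cover (A : set R) (s : R) : cover_sum A s -> (mu A <= s%:E)%E.
Proof.
move=> [a [b [ab [cov cvs]]]].
have {}ab i : a i <= b i by apply/RleP; exact: ab.
have sub : A `<=` \bigcup_i `[a i, b i]%classic.
  move=> x /cov [i [/RleP ax /RleP xb]]; exists i => //=.
  by rewrite in_itv/= ax xb.
apply: le_trans (mu_le _ _ sub) _.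
have := @mu_ext_sigma_subadditive _ _ R (wlength idfun)
  (fun X => measure_ge0 (wlength idfun) X) (fun i => `[a i, b i]%classic).
move=> /le_trans; apply.
rewrite (eq_eseriesr (g := fun i => (b i - a i)%:E)); last first.
  by move=> i _; exact: mu_itvcc.
apply: lime_le.
  by apply: is_cvg_nneseries => i _ _; rewrite lee_fin subr_ge0.
apply: nearW => n; rewrite sumEFin lee_fin; apply/RleP.
(* The empty partial sum has no counterpart among the [sum_f_R0], which start with one term. *)
case: n => [|n].
  rewrite big_nil; apply/cover_sum_ge0; exists a, b; split; last by split; [exact: cov|].
  by move=> i; apply/RleP.
rewrite -sum_f_R0E; apply: growing_ineq cvs n => N; apply/RleP.
by rewrite /= lerDl subr_ge0.
Qed.

Let mu_cover_ex (A : set R) (v e : R) : mu A = v%:E -> 0 < e ->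
  exists2 s, cover_sum A s & s <= v + e.
Proof.
move=> Av e0.
have : (mu A < (v + e)%:E)%E by rewrite Av lte_fin ltrDl.
move=> /ereal_inf_lt[_ [F [mF AF] <-] Fe].
have /choice[f fF] : forall i, exists p : R * R, F i = `]p.1, p.2]%classic :> set R.
  by move=> i; have [p _ pE] := mF i; exists p.
(* A half-open interval given with reversed endpoints is empty; the maximum turns it into a
   degenerate segment of the same length. *)
pose a i := (f i).1; pose b i := Num.max (f i).1 (f i).2.
have ab i : a i <= b i by rewrite /a /b le_max lexx.
have wF i : wlength idfun (F i) = (b i - a i)%:E.
  rewrite fF wlength_itv/= /b /a lte_fin; by case: ltP => _; rewrite ?subrr.
have le_s n : sum_f_R0 (fun i => b i - a i) n <= v + e.
  rewrite -lee_fin; apply: le_trans (ltW Fe).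
  rewrite sum_f_R0E -sumEFin.
  under eq_bigr do rewrite -wF.
  by apply: nneseries_lim_ge => i _ _; rewrite wF lee_fin subr_ge0.
have gr : Un_growing (fun n => sum_f_R0 (fun i => b i - a i) n).
  by move=> n; apply/RleP; rewrite /= lerDl subr_ge0.
have [l cvl] : { l | Un_cv (fun n => sum_f_R0 (fun i => b i - a i) n) l}.
  by apply: growing_cv => //; exists (v + e) => _ [n ->]; apply/RleP.
exists l.
  exists a, b; split; first by move=> i; apply/RleP.
  split => // x /AF[i _]; rewrite fF /= in_itv/= => /andP[ax xb].
  by exists i; split; apply/RleP; [exact: ltW|rewrite /b le_max xb orbT].
apply/RleP; apply: (Rle_cv_lim (Vn := fun=> v + e) _ cvl).
  by move=> n; apply/RleP.
move=> eps eps0; exists 0%N => n _.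
by rewrite /Rdist Rminus_diag Rabs_R0.
Qed.

(** The measure of mathcomp is a total function whose value on any set is the outer measure
    generated by half-open intervals, so measurability of [A] does not enter. Boundedness makes the
    value finite and the infimum meaningful. *)
Lemma lebesgue_outerE (A : R -> Prop) :
  segment_bounded A -> mu A = EFin (lebesgue_outer A).
Proof.
move=> [a [b Aab]].
have Afin : mu A \is a fin_num.
  rewrite ge0_fin_numE ?measure_ge0//.
  apply: (le_lt_trans (@mu_le A `[a, (Num.max a b)]%classic _)).
    move=> x /Aab[/RleP ax /RleP xb] /=.
    by rewrite in_itv/= ax le_max xb orbT.
  by rewrite mu_itvcc ?ltry// le_max lexx.
rewrite -(fineK Afin); congr EFin.
set v := fine (mu A).
have Av : mu A = v%:E by rewrite fineK.
have lb s : cover_sum A s -> v <= s.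
  by move=> /mu_cover; rewrite Av lee_fin.
have [s0 cs0 _] := mu_cover_ex _ _ _ Av ltr01.
apply/eqP; rewrite eq_le; apply/andP; split.
  apply/RleP; rewrite lebesgue_outer_cover; apply: Rinf_greatest; first by exists s0.
  by move=> s /lb /RleP.
apply/ler_addgt0Pr => e e0; have [s cs se] := mu_cover_ex _ _ _ Av e0.
apply: le_trans se; apply/RleP; rewrite lebesgue_outer_cover.
by apply: (@Rinf_lower _ v) => // y /lb /RleP.
Qed.

Lemma lebesgue_outer_mono (A B : R -> Prop) :
  segment_bounded B -> (forall x, A x -> B x) ->
  Rle (lebesgue_outer A) (lebesgue_outer B).
Proof.
move=> bB AB; apply/RleP; rewrite -lee_fin -!lebesgue_outerE//.
  exact: mu_le.
by move: bB => [a [b Bab]]; exists a, b => x /AB /Bab.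
Qed.

Lemma lebesgue_outer_sub (A B C : R -> Prop) :
  segment_bounded B -> segment_bounded C -> (forall x, A x -> B x \/ C x) ->
  Rle (lebesgue_outer A) (Rplus (lebesgue_outer B) (lebesgue_outer C)).
Proof.
move=> bB bC ABC.
have bBC : segment_bounded (B `|` C).
  move: bB bC => [a [b Bab]] [c [d Ccd]]; exists (Rmin a c), (Rmax b d).
  move=> x [/Bab[? ?]|/Ccd[? ?]]; split.
  - by apply: Rle_trans (Rmin_l _ _) _.
  - by apply: Rle_trans (Rmax_l _ _).
  - by apply: Rle_trans (Rmin_r _ _) _.
  - by apply: Rle_trans (Rmax_r _ _).
apply: Rle_trans (lebesgue_outer_mono _ _ bBC ABC) _.
apply/RleP; rewrite -lee_fin RplusE EFinD -!lebesgue_outerE//.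
exact: outer_measureU2.
Qed.

Lemma lebesgue_outer_itv (a b : R) :
  Rle a b -> lebesgue_outer (fun x => Rle a x /\ Rle x b) = Rminus b a.
Proof.
move=> /RleP ab; apply: EFin_inj; rewrite -lebesgue_outerE; last by exists a, b.
rewrite RminusE -mu_itvcc//; congr lebesgue_measure; apply/seteqP; split => x /=.
  by move=> [/RleP ax /RleP xb]; rewrite in_itv/= ax xb.
by rewrite in_itv/= => /andP[ax xb]; split; apply/RleP.
Qed.

Lemma closed_set_measurable (X : R -> Prop) :
  closed_set X -> measurable (X : set (measurableTypeR R)).
Proof.
move=> clX; rewrite -[X]setCK; apply: measurableC.
apply: measurable_realfun.open_measurable; rewrite openE => x Xx.
have [d dX] := clX x Xx.
apply/nbhs_ballP; exists (pos d); first by apply/RltP; exact: cond_pos.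
move=> y xy; apply: dX; rewrite /disc; apply/RltP.
by move: xy; rewrite /ball/= distrC.
Qed.

(** Caratheodory's criterion for the measurable set [X]; the set [A] that is cut may be
    arbitrary. *)
Lemma lebesgue_outer_split (X A : R -> Prop) :
  closed_set X -> segment_bounded A ->
  lebesgue_outer A = Rplus (lebesgue_outer (fun x => A x /\ X x))
                           (lebesgue_outer (fun x => A x /\ ~ X x)).
Proof.
move=> /closed_set_measurable mX bA.
have bAX P : segment_bounded (fun x => A x /\ P x).
  by move: bA => [a [b Aab]]; exists a, b => x [/Aab].
apply: EFin_inj; rewrite RplusE EFinD -!lebesgue_outerE//.
exact: (@sub_caratheodory _ _ R (wlength idfun) X mX A).
Qed.

Lemma lebesgue_outer_decr (F : nat -> R -> Prop) :
  (forall i, closed_set (F i)) -> segment_bounded (F O) ->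
  (forall i x, F i.+1 x -> F i x) ->
  Un_cv (fun i => lebesgue_outer (F i)) (lebesgue_outer (fun x => forall i, F i x)).
Proof.
move=> clF bF decF.
have decF' i j : (i <= j)%N -> F j `<=` F i.
  move=> /subnK <-; elim: (j - i)%N => // k ih x; rewrite addSn => /decF; exact: ih.
have bFi i : segment_bounded (F i).
  by move: bF => [a [b Fab]]; exists a, b => x /(decF' 0%N i (leq0n _)) /Fab.
have bFT : segment_bounded (fun x => forall i, F i x).
  by move: bF => [a [b Fab]]; exists a, b => x /(_ 0%N) /Fab.
have capE : \bigcap_i F i = (fun x => forall i, F i x).
  by apply/seteqP; split => x /= h i => [|_]; apply: h.
have := @nonincreasing_cvg_mu _ _ _ (@lebesgue_measure R) F.
rewrite [X in (X < _)%E](lebesgue_outerE (F 0%N))// ltry => /(_ isT).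
move=> /(_ (fun i => closed_set_measurable _ (clF i))).
have mI : measurable (\bigcap_i F i : set (measurableTypeR R)).
  by apply: bigcapT_measurable => i; exact: closed_set_measurable.
move=> /(_ mI) /= H.
have /H {H} : nonincreasing_seq (F : (set R)^nat).
  by move=> i j ij; apply/subsetPset; exact: decF'.
rewrite capE lebesgue_outerE//.
rewrite (_ : _ \o _ = (fun i => (lebesgue_outer (F i))%:E)); last first.
  by apply/funext => i /=; rewrite lebesgue_outerE.
move=> /fine_cvgP[_] /= cvF eps /RltP eps0.
have [N _ NH] := (@cvgrPdist_lt R R^o _ _ _ _ _).1 cvF eps eps0.
exists N => i /ssrnat.leP Ni; rewrite RdistE; apply/RltP.
by rewrite distrC; exact: NH.
Qed.

End LebesgueMeasure.

(** * Trigonometric polynomials *)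

(* Homogeneous forms of degree k in cos(t/2) and sin(t/2): for k = 2m these are the
   trigonometric polynomials of order m, and real zeros can be divided out one by one. *)
Fixpoint hform (k : nat) (f : R -> R) : Prop :=
  match k with
  | O => exists c, forall t, f t = c
  | S k => exists g h, hform k g /\ hform k h /\
      forall t, f t = cos (t / 2) * g t + sin (t / 2) * h t
  end.

Lemma hform_ext k f g : (forall t, f t = g t) -> hform k f -> hform k g.
Proof.
intros E. destruct k as [|k]; simpl.
- intros [c H]. exists c. intros t. now rewrite <- E.
- intros (u & v & Hu & Hv & H). exists u, v. repeat split; auto.
  intros t. now rewrite <- E.
Qed.

Lemma hform_lin k a b f g : hform k f -> hform k g ->
  hform k (fun t => a * f t + b * g t).
Proof.
revert f g. induction k as [|k IH]; simpl; intros f g.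
- intros [c Hc] [d Hd]. exists (a * c + b * d). intros t. now rewrite Hc, Hd.
- intros (f1 & f2 & H1 & H2 & E) (g1 & g2 & H3 & H4 & E').
  exists (fun t => a * f1 t + b * g1 t), (fun t => a * f2 t + b * g2 t).
  repeat split; auto. intros t. rewrite E, E'. ring.
Qed.

Lemma hform_scal k a f : hform k f -> hform k (fun t => a * f t).
Proof.
intros H. apply hform_ext with (fun t => a * f t + 0 * f t); [intros; ring|].
now apply hform_lin.
Qed.

Lemma hform_mul k a b f : hform k f ->
  hform (S k) (fun t => (a * cos (t / 2) + b * sin (t / 2)) * f t).
Proof.
intros H. exists (fun t => a * f t), (fun t => b * f t).
repeat split; try now apply hform_scal. intros t. ring.
Qed.

Lemma hform_cos k f : hform k f -> hform (S k) (fun t => cos (t / 2) * f t).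
Proof.
intros H. apply hform_ext with (fun t => (1 * cos (t / 2) + 0 * sin (t / 2)) * f t).
- intros; ring.
- now apply hform_mul.
Qed.

Lemma hform_sin k f : hform k f -> hform (S k) (fun t => sin (t / 2) * f t).
Proof.
intros H. apply hform_ext with (fun t => (0 * cos (t / 2) + 1 * sin (t / 2)) * f t).
- intros; ring.
- now apply hform_mul.
Qed.

Lemma cos_sin_sq x : cos x * cos x + sin x * sin x = 1.
Proof. generalize (sin2_cos2 x). unfold Rsqr. lra. Qed.

Lemma hform_lift k f : hform k f -> hform (S (S k)) f.
Proof.
intros H. exists (fun t => cos (t / 2) * f t), (fun t => sin (t / 2) * f t).
repeat split; [now apply hform_cos|now apply hform_sin|].
intros t. transitivity ((cos (t/2) * cos (t/2) + sin (t/2) * sin (t/2)) * f t).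
- rewrite cos_sin_sq. ring.
- ring.
Qed.

Lemma hform_shift k a f : hform k f -> hform k (fun t => f (t + a)).
Proof.
revert f. induction k as [|k IH]; intros f.
- intros [c H]. exists c. intros t. apply H.
- intros (g & h & Hg & Hh & E). apply IH in Hg. apply IH in Hh.
  apply hform_ext with (fun t =>
    1 * ((cos (a / 2) * cos (t / 2) + - sin (a / 2) * sin (t / 2)) * g (t + a)) +
    1 * ((sin (a / 2) * cos (t / 2) + cos (a / 2) * sin (t / 2)) * h (t + a))).
  + intros t. rewrite E.
    replace ((t + a) / 2) with (t / 2 + a / 2) by field.
    rewrite cos_plus, sin_plus. ring.
  + apply hform_lin; apply (hform_mul k _ _ (fun t => _ (t + a))); assumption.
Qed.

(** At 0 only the cosine branch survives, so that branch vanishes there as well and by induction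
    contains the factor [sin (t / 2)], which the sine branch carries already. *)
Lemma hform_root0 k f : hform (S k) f -> f 0 = 0 ->
  exists g, hform k g /\ forall t, f t = sin (t / 2) * g t.
Proof.
revert f. induction k as [|k IH]; intros f (g & h & Hg & Hh & E) H0.
- destruct Hg as [c Hc]. exists h. split; [exact Hh|]. intros t.
  rewrite E in H0. replace (0 / 2) with 0 in H0 by field.
  rewrite cos_0, sin_0, Hc in H0. rewrite E, Hc. nra.
- rewrite E in H0. replace (0 / 2) with 0 in H0 by field.
  rewrite cos_0, sin_0 in H0.
  destruct (IH g Hg) as (u & Hu & Eu); [lra|].
  exists (fun t => 1 * (cos (t / 2) * u t) + 1 * h t). split.
  + apply hform_lin; [now apply hform_cos|exact Hh].
  + intros t. rewrite E, Eu. ring.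
Qed.

Lemma hform_root k f y : hform (S k) f -> f y = 0 ->
  exists g, hform k g /\ forall t, f t = sin ((t - y) / 2) * g t.
Proof.
intros Hf Hy. apply (hform_shift _ y) in Hf.
destruct (hform_root0 _ _ Hf) as (g & Hg & E); [now rewrite Rplus_0_l|].
exists (fun t => g (t + - y)). split; [now apply hform_shift|].
intros t. specialize (E (t - y)). replace (t - y + y) with t in E by ring. exact E.
Qed.

(** Each zero splits off a factor and lowers the degree by one. The sine condition says that the
    points are distinct modulo 2 pi. *)
Lemma hform_zero k f (p : nat -> R) : hform k f ->
  (forall i, (i <= k)%nat -> f (p i) = 0) ->
  (forall i j, (i < j <= k)%nat -> sin ((p i - p j) / 2) <> 0) ->
  forall t, f t = 0.
Proof.
revert f. induction k as [|k IH]; intros f Hf Hp Hs t.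
- destruct Hf as [c Hc]. rewrite Hc, <- (Hc (p 0%nat)). now apply Hp.
- destruct (hform_root k f (p (S k)) Hf) as (g & Hg & E); [now apply Hp|].
  rewrite E, (IH g); [ring|exact Hg| |].
  + intros i Hi. specialize (E (p i)). rewrite Hp in E by lia.
    destruct (Rmult_integral _ _ (eq_sym E)) as [H|H]; [|exact H].
    exfalso. revert H. apply Hs. lia.
  + intros i j Hij. apply Hs. lia.
Qed.

(** The form with prescribed zeros: the counterpart of the product of the [t - y i] for algebraic
    polynomials. *)
Fixpoint sprod (y : nat -> R) (k : nat) (t : R) : R :=
  match k with
  | O => 1
  | S k => sin ((t - y k) / 2) * sprod y k t
  end.

Lemma sprod_hform y k : hform k (sprod y k).
Proof.
induction k as [|k IH].
- now exists 1.
- apply hform_ext with (fun t =>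
    (- sin (y k / 2) * cos (t / 2) + cos (y k / 2) * sin (t / 2)) * sprod y k t).
  + intros t. simpl. replace ((t - y k) / 2) with (t / 2 - y k / 2) by field.
    rewrite sin_minus. ring.
  + now apply hform_mul.
Qed.

Lemma sprod_root y k i : (i < k)%nat -> sprod y k (y i) = 0.
Proof.
induction k as [|k IH]; intros Hi; [lia|]. simpl.
destruct (Nat.eq_dec i k) as [->|Hne].
- replace ((y k - y k) / 2) with 0 by field. rewrite sin_0. ring.
- rewrite IH by lia. ring.
Qed.

Lemma sprod_bound y k t : Rabs (sprod y k t) <= 1.
Proof.
induction k as [|k IH]; simpl.
- rewrite Rabs_R1. lra.
- rewrite Rabs_mult. rewrite <- (Rmult_1_l 1).
  apply Rmult_le_compat; try apply Rabs_pos; auto.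
  apply Rabs_le. apply SIN_bound.
Qed.

Lemma sprod_ge y k t c : 0 <= c ->
  (forall i, (i < k)%nat -> c <= Rabs (sin ((t - y i) / 2))) ->
  c ^ k <= Rabs (sprod y k t).
Proof.
intros Hc. induction k as [|k IH]; intros H; simpl.
- rewrite Rabs_R1. lra.
- rewrite Rabs_mult. apply Rmult_le_compat; auto using pow_le.
Qed.

(** * Trigonometric polynomials by order and leading part *)

Definition TP (m : nat) (f : R -> R) : Prop :=
  exists a b, forall t, f t = trig_poly m a b t.

(* Leading part of a polynomial of order n = S m, so that [TP m] is F_{n-1}. *)
Definition TPlead (m : nat) (a b : R) (f : R -> R) : Prop :=
  exists g, TP m g /\
    forall t, f t = a * cos (INR (S m) * t) + b * sin (INR (S m) * t) + g t.

Lemma TP_ext m f g : (forall t, f t = g t) -> TP m f -> TP m g.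
Proof. intros E (a & b & H). exists a, b. intros t. now rewrite <- E. Qed.

Lemma TP_0 f : TP 0 f <-> exists c, forall t, f t = c.
Proof.
split.
- intros (a & b & H). exists (a 0%nat). intros t. rewrite H. unfold trig_poly. simpl.
  rewrite Rmult_0_l, cos_0, sin_0. ring.
- intros [c H]. exists (fun _ => c), (fun _ => 0). intros t. rewrite H.
  unfold trig_poly. simpl. rewrite Rmult_0_l, cos_0, sin_0. ring.
Qed.

Lemma TP_S m f : TP (S m) f <-> exists a b, TPlead m a b f.
Proof.
split.
- intros (a & b & H). exists (a (S m)), (b (S m)), (trig_poly m a b). split.
  + now exists a, b.
  + intros t. rewrite H. unfold trig_poly. rewrite tech5. ring.
- intros (c & d & g & (a & b & Hg) & H).
  exists (fun k => if Nat.eq_dec k (S m) then c else a k),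
         (fun k => if Nat.eq_dec k (S m) then d else b k).
  intros t. rewrite H, Hg. unfold trig_poly. rewrite tech5.
  destruct (Nat.eq_dec (S m) (S m)) as [_|n]; [|now destruct n].
  rewrite Rplus_comm. f_equal. apply sum_eq. intros i Hi.
  destruct (Nat.eq_dec i (S m)); [lia|reflexivity].
Qed.

Lemma TP_lin m a b f g : TP m f -> TP m g -> TP m (fun t => a * f t + b * g t).
Proof.
intros (c & d & H) (c' & d' & H').
exists (fun k => a * c k + b * c' k), (fun k => a * d k + b * d' k).
intros t. rewrite H, H'. unfold trig_poly.
rewrite !scal_sum, <- sum_plus. apply sum_eq. intros. ring.
Qed.

Lemma TP_lift m f : TP m f -> TP (S m) f.
Proof.
intros H. apply TP_S. exists 0, 0, f. split; [exact H|]. intros; ring.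
Qed.

Lemma TP_harm k m a b : (k <= m)%nat ->
  TP m (fun t => a * cos (INR k * t) + b * sin (INR k * t)).
Proof.
intros Hk. induction Hk as [|m _ IH]; [|now apply TP_lift].
destruct k as [|k].
- apply TP_0. exists a. intros t. simpl. rewrite Rmult_0_l, cos_0, sin_0. ring.
- apply TP_S. exists a, b, (fun _ => 0). split.
  + exists (fun _ => 0), (fun _ => 0). intros t. unfold trig_poly.
    symmetry. apply sum_eq_R0. intros i _. ring.
  + intros; ring.
Qed.

Lemma TPlead_TP m a b f : TPlead m a b f -> TP (S m) f.
Proof. intros H. apply TP_S. now exists a, b. Qed.

Lemma TPlead_coef m a b a' b' f : a = a' -> b = b' ->
  TPlead m a b f -> TPlead m a' b' f.
Proof. now intros -> ->. Qed.

Lemma TPlead_lin m c d a b a' b' f g : TPlead m a b f -> TPlead m a' b' g ->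
  TPlead m (c * a + d * a') (c * b + d * b') (fun t => c * f t + d * g t).
Proof.
intros (u & Hu & E) (v & Hv & E').
exists (fun t => c * u t + d * v t). split; [now apply TP_lin|].
intros t. rewrite E, E'. ring.
Qed.

Lemma TPlead_low m f : TP m f -> TPlead m 0 0 f.
Proof. intros H. exists f. split; auto. intros; ring. Qed.

Lemma TP_const m c : TP m (fun _ => c).
Proof.
apply TP_ext with (fun t => c * cos (INR 0 * t) + 0 * sin (INR 0 * t)).
- intros t. simpl. rewrite Rmult_0_l, cos_0, sin_0. ring.
- apply TP_harm. lia.
Qed.

Lemma INR_S_mult k t : INR (S k) * t = INR k * t + t.
Proof. rewrite S_INR. ring. Qed.

Lemma TP_mul_cs m a b f : TP m f ->
  TP (S m) (fun t => (a * cos t + b * sin t) * f t).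
Proof.
revert f. induction m as [|m IH]; intros f Hf.
- apply TP_0 in Hf. destruct Hf as [c Hc].
  apply TP_ext with (fun t => a * c * cos (INR 1 * t) + b * c * sin (INR 1 * t)).
  + intros t. rewrite Hc. simpl. rewrite Rmult_1_l. ring.
  + now apply TP_harm.
- apply TP_S in Hf. destruct Hf as (c & d & g & Hg & E).
  apply TP_ext with (fun t => 1 * ((a * cos t + b * sin t) * g t) +
    1 * (1 * (((a * c - b * d) / 2) * cos (INR (S (S m)) * t) +
              ((a * d + b * c) / 2) * sin (INR (S (S m)) * t)) +
         1 * (((a * c + b * d) / 2) * cos (INR m * t) +
              ((a * d - b * c) / 2) * sin (INR m * t)))).
  + intros t. rewrite E, (INR_S_mult (S m)).
    replace (INR m * t) with (INR (S m) * t - t) by (rewrite S_INR; ring).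
    rewrite cos_plus, sin_plus, cos_minus, sin_minus. field.
  + apply TP_lin; [now apply TP_lift, IH|].
    apply TP_lin; apply TP_harm; lia.
Qed.

Lemma hform_harm k :
  hform (2 * k) (fun t => cos (INR k * t)) /\ hform (2 * k) (fun t => sin (INR k * t)).
Proof.
induction k as [|k [Hc Hs]].
- split; [exists 1|exists 0]; intros t; simpl; rewrite Rmult_0_l; [apply cos_0|apply sin_0].
- replace (2 * S k)%nat with (S (S (2 * k))) by lia.
  assert (Ec : forall t, cos t = cos (t/2) * cos (t/2) - sin (t/2) * sin (t/2)).
  { intros t. rewrite <- cos_plus. f_equal. field. }
  assert (Es : forall t, sin t = sin (t/2) * cos (t/2) + cos (t/2) * sin (t/2)).
  { intros t. rewrite <- sin_plus. f_equal. field. }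
  split.
  + exists (fun t => 1 * (cos (t/2) * cos (INR k * t)) + (-1) * (sin (t/2) * sin (INR k * t))),
           (fun t => (-1) * (sin (t/2) * cos (INR k * t)) + (-1) * (cos (t/2) * sin (INR k * t))).
    repeat split; try (apply hform_lin; auto using hform_cos, hform_sin).
    intros t. rewrite INR_S_mult, cos_plus, (Ec t), (Es t). ring.
  + exists (fun t => 1 * (cos (t/2) * sin (INR k * t)) + 1 * (sin (t/2) * cos (INR k * t))),
           (fun t => (-1) * (sin (t/2) * sin (INR k * t)) + 1 * (cos (t/2) * cos (INR k * t))).
    repeat split; try (apply hform_lin; auto using hform_cos, hform_sin).
    intros t. rewrite INR_S_mult, sin_plus, (Ec t), (Es t). ring.
Qed.

Lemma TP_hform m f : TP m f -> hform (2 * m) f.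
Proof.
revert f. induction m as [|m IH]; intros f Hf.
- apply TP_0 in Hf. exact Hf.
- apply TP_S in Hf. destruct Hf as (a & b & g & Hg & E).
  destruct (hform_harm (S m)) as [Hc Hs].
  apply hform_ext with (fun t => 1 * (a * cos (INR (S m) * t) + b * sin (INR (S m) * t)) + 1 * g t).
  + intros t. rewrite E. ring.
  + apply hform_lin; [now apply hform_lin|].
    replace (2 * S m)%nat with (S (S (2 * m))) by lia. now apply hform_lift, IH.
Qed.

(** A product of two half-angle functions is affine in [cos t] and [sin t], so two degrees of the
    form make one order. In this way products of an even number of half-angle sines are recognised
    as trigonometric polynomials. *)
Lemma hform_TP m f : hform (2 * m) f -> TP m f.
Proof.
revert f. induction m as [|m IH]; intros f Hf.
- now apply TP_0.
- replace (2 * S m)%nat with (S (S (2 * m))) in Hf by lia.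
  destruct Hf as (g & h & (g1 & g2 & Hg1 & Hg2 & Eg) & (h1 & h2 & Hh1 & Hh2 & Eh) & E).
  apply TP_ext with (fun t =>
    1 * (1 * (((1/2) * cos t + 0 * sin t) * (1 * g1 t + (-1) * h2 t)) +
         1 * ((0 * cos t + (1/2) * sin t) * (1 * g2 t + 1 * h1 t))) +
    (1/2) * (1 * g1 t + 1 * h2 t)).
  + intros t. rewrite E, Eg, Eh.
    assert (Ec : cos t = cos (t/2) * cos (t/2) - sin (t/2) * sin (t/2)).
    { rewrite <- cos_plus. f_equal. field. }
    assert (Es : sin t = 2 * (sin (t/2) * cos (t/2))).
    { rewrite <- Rmult_assoc, <- sin_2a. f_equal. field. }
    generalize (cos_sin_sq (t / 2)). rewrite Ec, Es.
    set (c := cos (t/2)). set (s := sin (t/2)). intros H.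
    replace (1 / 2 * (1 * g1 t + 1 * h2 t)) with
      (1 / 2 * ((c * c + s * s) * (1 * g1 t + 1 * h2 t))) by (rewrite H; ring).
    field.
  + apply IH in Hg1. apply IH in Hg2. apply IH in Hh1. apply IH in Hh2.
    apply TP_lin.
    * apply TP_lin; apply TP_mul_cs; now apply TP_lin.
    * now apply TP_lift, TP_lin.
Qed.

Lemma TP_shift m c f : TP m f -> TP m (fun t => f (t + c)).
Proof. intros H. now apply hform_TP, hform_shift, TP_hform. Qed.

Lemma TPlead_shift m c a b f : TPlead m a b f ->
  TPlead m (a * cos (INR (S m) * c) + b * sin (INR (S m) * c))
           (b * cos (INR (S m) * c) - a * sin (INR (S m) * c)) (fun t => f (t + c)).
Proof.
intros (g & Hg & E). exists (fun t => g (t + c)). split; [now apply TP_shift|].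
intros t. rewrite E, Rmult_plus_distr_l, cos_plus, sin_plus. ring.
Qed.

Lemma TPlead_reflect m a b f : TPlead m a b f -> TPlead m a (- b) (fun t => f (- t)).
Proof.
intros (g & (c & d & Hg) & E). exists (fun t => g (- t)). split.
- exists c, (fun k => - d k). intros t. rewrite Hg. apply sum_eq. intros i _.
  rewrite Ropp_mult_distr_r_reverse, cos_neg, sin_neg. ring.
- intros t. rewrite E, Ropp_mult_distr_r_reverse, cos_neg, sin_neg. ring.
Qed.

Lemma TP_bounded m f : TP m f -> exists C, forall t, Rabs (f t) <= C.
Proof.
revert f. induction m as [|m IH]; intros f Hf.
- apply TP_0 in Hf. destruct Hf as [c Hc]. exists (Rabs c). intros t. rewrite Hc. lra.
- apply TP_S in Hf. destruct Hf as (a & b & g & Hg & E).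
  destruct (IH g Hg) as [C HC]. exists (Rabs a + Rabs b + C). intros t.
  rewrite E. specialize (HC t).
  assert (H1 : Rabs (a * cos (INR (S m) * t)) <= Rabs a).
  { rewrite Rabs_mult. rewrite <- (Rmult_1_r (Rabs a)) at 2.
    apply Rmult_le_compat_l; [apply Rabs_pos|]. apply Rabs_le, COS_bound. }
  assert (H2 : Rabs (b * sin (INR (S m) * t)) <= Rabs b).
  { rewrite Rabs_mult. rewrite <- (Rmult_1_r (Rabs b)) at 2.
    apply Rmult_le_compat_l; [apply Rabs_pos|]. apply Rabs_le, SIN_bound. }
  eapply Rle_trans; [apply Rabs_triang|].
  apply Rplus_le_compat; [|exact HC].
  eapply Rle_trans; [apply Rabs_triang|]. lra.
Qed.

Lemma derivable_harm k a b t :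
  derivable_pt_lim (fun t => a * cos (k * t) + b * sin (k * t)) t
    (k * b * cos (k * t) + - (k * a) * sin (k * t)).
Proof.
assert (Hk : derivable_pt_lim (fun t => k * t) t (k * 1)).
{ apply (derivable_pt_lim_scal id k t 1), derivable_pt_lim_id. }
replace (k * b * cos (k * t) + - (k * a) * sin (k * t)) with
  (a * (- sin (k * t) * (k * 1)) + b * (cos (k * t) * (k * 1))) by ring.
apply (derivable_pt_lim_plus (fun t => a * cos (k * t)) (fun t => b * sin (k * t))).
- apply (derivable_pt_lim_scal (fun t => cos (k * t))).
  apply (derivable_pt_lim_comp (fun t => k * t) cos); [exact Hk|apply derivable_pt_lim_cos].
- apply (derivable_pt_lim_scal (fun t => sin (k * t))).
  apply (derivable_pt_lim_comp (fun t => k * t) sin); [exact Hk|apply derivable_pt_lim_sin].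
Qed.

Lemma derivable_pt_lim_ext f g x l : (forall t, f t = g t) ->
  derivable_pt_lim f x l -> derivable_pt_lim g x l.
Proof.
intros E H eps He. destruct (H eps He) as [d Hd]. exists d. intros h Hh Hhd.
rewrite <- !E. now apply Hd.
Qed.

Lemma TP_derivable m f : TP m f ->
  exists f', TP m f' /\ forall t, derivable_pt_lim f t (f' t).
Proof.
revert f. induction m as [|m IH]; intros f Hf.
- apply TP_0 in Hf. destruct Hf as [c Hc]. exists (fun _ => 0).
  split; [apply TP_const|]. intros t.
  apply derivable_pt_lim_ext with (fct_cte c); [intros x; now rewrite Hc|].
  apply derivable_pt_lim_const.
- apply TP_S in Hf. destruct Hf as (a & b & g & Hg & E).
  destruct (IH g Hg) as (g' & Hg' & D).
  exists (fun t => INR (S m) * b * cos (INR (S m) * t) +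
     - (INR (S m) * a) * sin (INR (S m) * t) + g' t). split.
  + apply TP_S. eexists _, _, g'. split; [exact Hg'|]. intros t. reflexivity.
  + intros t. eapply derivable_pt_lim_ext; [intros x; symmetry; apply E|].
    apply (derivable_pt_lim_plus (fun t => a * cos (INR (S m) * t) + b * sin (INR (S m) * t)) g);
      [apply derivable_harm|apply D].
Qed.

Lemma TPlead_derivable m a b f : TPlead m a b f ->
  exists f', TPlead m (INR (S m) * b) (- (INR (S m) * a)) f' /\
    forall t, derivable_pt_lim f t (f' t).
Proof.
intros (g & Hg & E). destruct (TP_derivable m g Hg) as (g' & Hg' & D).
exists (fun t => INR (S m) * b * cos (INR (S m) * t) +
     - (INR (S m) * a) * sin (INR (S m) * t) + g' t). split.
- exists g'. split; [exact Hg'|]. intros t. reflexivity.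
- intros t. eapply derivable_pt_lim_ext; [intros x; symmetry; apply E|].
  apply (derivable_pt_lim_plus (fun t => a * cos (INR (S m) * t) + b * sin (INR (S m) * t)) g);
      [apply derivable_harm|apply D].
Qed.

Lemma TP_continuity m f : TP m f -> continuity f.
Proof.
intros H x. destruct (TP_derivable m f H) as (f' & _ & D).
apply derivable_continuous_pt. exists (f' x). apply D.
Qed.

Lemma TP_periodic m f t : TP m f -> f (t + 2 * PI) = f t.
Proof.
intros (a & b & E). rewrite !E. apply sum_eq. intros k _.
replace (INR k * (t + 2 * PI)) with (INR k * t + 2 * INR k * PI) by ring.
now rewrite cos_period, sin_period.
Qed.

(** With n = k + 1, [u] is the modified Dirichlet kernel 1 + 2 (cos t + ... + cos kt) + cos nt and
    [v] is its conjugate 2 (sin t + ... + sin kt) + sin nt. They are sin nt and 1 - cos nt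
    multiplied by cot(t/2); the factor [sin (t / 2)] on the left avoids the division. *)
Lemma conjugate_kernel k :
  (exists u, TPlead k 1 0 u /\
     forall t, u t * sin (t / 2) = sin (INR (S k) * t) * cos (t / 2)) /\
  (exists v, TPlead k 0 1 v /\
     forall t, v t * sin (t / 2) = (1 - cos (INR (S k) * t)) * cos (t / 2)).
Proof.
assert (Ec : forall t, cos t = 1 - 2 * (sin (t/2) * sin (t/2))).
{ intros t. replace (cos t) with (cos (2 * (t / 2))) by (f_equal; field).
  rewrite cos_2a_sin. ring. }
assert (Es : forall t, sin t = 2 * (sin (t/2) * cos (t/2))).
{ intros t. replace (sin t) with (sin (2 * (t / 2))) by (f_equal; field).
  rewrite sin_2a. ring. }
induction k as [|k [(u & Hu & Eu) (v & Hv & Ev)]].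
- split.
  + exists (fun t => 1 * cos (INR 1 * t) + 0 * sin (INR 1 * t) + 1). split.
    * exists (fun _ => 1). split; [apply TP_const|reflexivity].
    * intros t. simpl. rewrite !Rmult_1_l, (Ec t), (Es t).
      generalize (cos_sin_sq (t / 2)). set (c := cos (t/2)). set (s := sin (t/2)). intros H.
      replace (c * c) with (1 - s * s) by lra.
      replace (2 * (s * c) * c) with (2 * s * (c * c)) by ring.
      replace (c * c) with (1 - s * s) by lra. ring.
  + exists (fun t => 0 * cos (INR 1 * t) + 1 * sin (INR 1 * t) + 0). split.
    * exists (fun _ => 0). split; [apply TP_const|reflexivity].
    * intros t. simpl. rewrite !Rmult_1_l, (Ec t), (Es t). ring.
- split.
  + exists (fun t => 1 * cos (INR (S (S k)) * t) + 0 * sin (INR (S (S k)) * t) +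
      (1 * u t + 1 * (1 * cos (INR (S k) * t) + 0 * sin (INR (S k) * t)))). split.
    * eexists. split; [|reflexivity]. apply TP_lin; [exact (TPlead_TP _ _ _ _ Hu)|].
      now apply TP_harm.
    * intros t. rewrite (INR_S_mult (S k)), sin_plus, cos_plus.
      transitivity (u t * sin (t/2) + (cos (INR (S k) * t) * cos t - sin (INR (S k) * t) * sin t
        + cos (INR (S k) * t)) * sin (t / 2)); [ring|].
      rewrite Eu, (Ec t), (Es t).
      generalize (cos_sin_sq (t / 2)). set (c := cos (t/2)). set (s := sin (t/2)).
      set (C := cos (INR (S k) * t)). set (D := sin (INR (S k) * t)). intros H.
      assert (K : c * c = 1 - s * s) by lra.
      transitivity (D * c + (C * (1 - 2 * (s * s)) * s + C * s - 2 * D * c * (s * s))); [ring|].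
      replace (s * s) with (1 - c * c) at 2 by lra.
      transitivity (D * (1 - 2 * (s * s)) * c + C * (2 * s * (c * c))); [rewrite K|]; ring_simplify.
      -- replace (s ^ 3) with (s * (1 - c * c)) by (rewrite <- H; ring).
         replace (s ^ 2) with (1 - c * c) by (rewrite <- H; ring). ring.
      -- ring.
  + exists (fun t => 0 * cos (INR (S (S k)) * t) + 1 * sin (INR (S (S k)) * t) +
      (1 * v t + 1 * (0 * cos (INR (S k) * t) + 1 * sin (INR (S k) * t)))). split.
    * eexists. split; [|reflexivity]. apply TP_lin; [exact (TPlead_TP _ _ _ _ Hv)|].
      now apply TP_harm.
    * intros t. rewrite (INR_S_mult (S k)), sin_plus, cos_plus.
      transitivity (v t * sin (t/2) + (sin (INR (S k) * t) * cos t + cos (INR (S k) * t) * sin t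
        + sin (INR (S k) * t)) * sin (t / 2)); [ring|].
      rewrite Ev, (Ec t), (Es t).
      generalize (cos_sin_sq (t / 2)). set (c := cos (t/2)). set (s := sin (t/2)).
      set (C := cos (INR (S k) * t)). set (D := sin (INR (S k) * t)). intros H.
      assert (K : c * c = 1 - s * s) by lra.
      transitivity (c - C * c * (1 - 2 * (s * s)) + 2 * D * s * (1 - s * s)); [ring|].
      rewrite <- K. ring.
Qed.

(** Once [xi] is shifted to 0, the two kernels multiply every harmonic by the cotangent and turn the
    coefficient pair (a, b) into (b, -a). This quarter turn commutes with the rotation of the pair
    caused by the shift, so shifting back leaves it unchanged. *)
Lemma TPlead_cot m a b h xi : TPlead m a b h -> h xi = 0 ->
  exists g, TPlead m b (- a) g /\
    forall t, g t * sin ((t - xi) / 2) = h t * cos ((t - xi) / 2).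
Proof.
(* Subtracting [h 0] instead of assuming that it vanishes is what makes the induction possible: the
   separate harmonics of [h] need not vanish at 0. *)
assert (base : forall a b h, TPlead m a b h -> exists g, TPlead m b (- a) g /\
    forall t, g t * sin (t / 2) = (h t - h 0) * cos (t / 2)).
{ clear. revert m. induction m as [|m IH]; intros a b h (h1 & Hh1 & E).
  - destruct (conjugate_kernel 0) as [(u & Hu & Eu) (v & Hv & Ev)].
    apply TP_0 in Hh1. destruct Hh1 as [c Hc].
    exists (fun t => b * u t + (- a) * v t). split.
    + eapply TPlead_coef; [| |apply (TPlead_lin 0 b (- a)); eassumption]; ring.
    + intros t. rewrite !E, !Hc, Rmult_0_r, cos_0, sin_0.
      rewrite Rmult_plus_distr_r, !Rmult_assoc, Eu, Ev. ring.
  - destruct (conjugate_kernel (S m)) as [(u & Hu & Eu) (v & Hv & Ev)].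
    apply TP_S in Hh1. destruct Hh1 as (c & d & H1).
    destruct (IH c d h1 H1) as (w & Hw & Ew).
    exists (fun t => 1 * (b * u t + (- a) * v t) + 1 * w t). split.
    + eapply TPlead_coef; [| |apply (TPlead_lin (S m) 1 1);
        [apply (TPlead_lin (S m) b (- a)); eassumption
        |apply TPlead_low; exact (TPlead_TP _ _ _ _ Hw)]]; ring.
    + intros t. rewrite !E, Rmult_0_r, cos_0, sin_0.
      transitivity (b * (u t * sin (t/2)) + - a * (v t * sin (t/2)) + w t * sin (t/2)); [ring|].
      rewrite Eu, Ev, Ew. ring. }
intros Hh H0. destruct (base _ _ _ (TPlead_shift m xi a b h Hh)) as (g & Hg & E).
exists (fun t => g (t + - xi)). split.
- apply (TPlead_shift m (- xi)) in Hg. revert Hg.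
  rewrite Ropp_mult_distr_r_reverse, cos_neg, sin_neg.
  generalize (cos_sin_sq (INR (S m) * xi)).
  set (c := cos (INR (S m) * xi)). set (s := sin (INR (S m) * xi)). intros H.
  apply TPlead_coef.
  + transitivity (b * (c * c + s * s)); [ring|rewrite H; ring].
  + transitivity (- a * (c * c + s * s)); [ring|rewrite H; ring].
- intros t. specialize (E (t - xi)). rewrite Rplus_0_l, H0 in E.
  replace (t - xi + xi) with t in E by ring. unfold Rminus in *. rewrite E. ring.
Qed.

(* [ring] does not normalise a variable power of the constant -1. *)
Ltac sign_ring :=
  repeat match goal with |- context [(-1) ^ ?j] => generalize ((-1) ^ j); intro end; ring.

(** * Alternating sums over 2n equidistant points *)

Lemma sum_cos_arith a h N :
  2 * sin (h / 2) * sum_f_R0 (fun j => cos (a + INR j * h)) N =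
  sin (a + (INR N + 1 / 2) * h) - sin (a - h / 2).
Proof.
induction N as [|N IH].
- simpl sum_f_R0. simpl INR.
  replace (a + (0 + 1 / 2) * h) with (a + h / 2) by field.
  replace (a + 0 * h) with a by ring. rewrite sin_plus, sin_minus. ring.
- rewrite tech5, Rmult_plus_distr_l, IH.
  replace (a + (INR (S N) + 1 / 2) * h) with (a + INR (S N) * h + h / 2) by field.
  replace (a + (INR N + 1 / 2) * h) with (a + INR (S N) * h - h / 2) by (rewrite S_INR; field).
  rewrite (sin_plus (a + INR (S N) * h)), (sin_minus (a + INR (S N) * h)). ring.
Qed.

Lemma cos_sin_plus_INR_PI x j :
  cos (x + INR j * PI) = (-1) ^ j * cos x /\ sin (x + INR j * PI) = (-1) ^ j * sin x.
Proof.
induction j as [|j [Hc Hs]].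
- simpl. rewrite Rmult_0_l, Rplus_0_r. split; ring.
- rewrite S_INR. replace (x + (INR j + 1) * PI) with (x + INR j * PI + PI) by ring.
  rewrite neg_cos, neg_sin, Hc, Hs. simpl. split; ring.
Qed.

Lemma sign_sq j : (-1) ^ j * (-1) ^ j = 1.
Proof. rewrite <- Rpow_mult_distr. replace (-1 * -1) with 1 by ring. apply pow1. Qed.

Lemma alt_sum_cos m k x : (k <= m)%nat ->
  sum_f_R0 (fun j => (-1) ^ j * cos (x + INR k * (INR j * (PI / INR (S m))))) (2 * m + 1) = 0.
Proof.
intros Hk.
assert (Hn : 0 < INR (S m)) by (apply lt_0_INR; lia).
(* The sign [(-1) ^ j] is the phase [j * PI], so the terms are cosines in arithmetic progression
   with step [h]. The 2n steps make up k + n full turns, and k < n keeps [h / 2] strictly between 0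
   and [PI]. *)
set (h := (INR k / INR (S m) + 1) * PI).
assert (Hh : 0 < h / 2 < PI).
{ unfold h. assert (0 <= INR k / INR (S m) < 1).
  { split; [apply Rmult_le_pos; [apply pos_INR|left; now apply Rinv_0_lt_compat]|].
    apply Rmult_lt_reg_r with (INR (S m)); [exact Hn|].
    unfold Rdiv. rewrite Rmult_assoc, Rinv_l by lra. rewrite Rmult_1_l, Rmult_1_r.
    apply lt_INR. lia. }
  generalize PI_RGT_0. nra. }
assert (Hs : sin (h / 2) > 0) by (apply sin_gt_0; lra).
apply Rmult_eq_reg_l with (2 * sin (h / 2)); [|lra].
rewrite Rmult_0_r.
rewrite sum_eq with (Bn := fun j => cos (x + INR j * h)).
- rewrite sum_cos_arith.
  replace (x + (INR (2 * m + 1) + 1 / 2) * h) with (x - h / 2 + 2 * INR (k + S m) * PI).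
  + rewrite sin_period. ring.
  + unfold h. rewrite !plus_INR, mult_INR, !S_INR. simpl INR.
    rewrite S_INR in Hn. field. lra.
- intros j _. rewrite <- (proj1 (cos_sin_plus_INR_PI _ j)).
  f_equal. unfold h. field. lra.
Qed.

Lemma alt_sum_TP m k f theta : (k <= m)%nat -> TP k f ->
  sum_f_R0 (fun j => (-1) ^ j * f (theta + INR j * (PI / INR (S m)))) (2 * m + 1) = 0.
Proof.
intros Hk. revert f. induction k as [|k IH]; intros f Hf.
- apply TP_0 in Hf. destruct Hf as [c Hc].
  rewrite sum_eq with (Bn := fun j =>
     (-1) ^ j * cos (0 + INR 0 * (INR j * (PI / INR (S m)))) * c).
  + rewrite <- scal_sum, alt_sum_cos by lia. ring.
  + intros j _. rewrite Hc.
    replace (0 + INR 0 * (INR j * (PI / INR (S m)))) with 0 by (change (INR 0) with 0; ring).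
    rewrite cos_0. sign_ring.
- apply TP_S in Hf. destruct Hf as (a & b & g & Hg & E).
  rewrite sum_eq with (Bn := fun j =>
     ((-1) ^ j * cos (INR (S k) * theta + INR (S k) * (INR j * (PI / INR (S m)))) * a +
      (-1) ^ j * cos (INR (S k) * theta - PI / 2 + INR (S k) * (INR j * (PI / INR (S m)))) * b) +
     (-1) ^ j * g (theta + INR j * (PI / INR (S m)))).
  + rewrite !sum_plus, <- !scal_sum, !alt_sum_cos, IH; [ring|lia|exact Hg|lia|lia].
  + intros j _. rewrite E.
    set (y := INR j * (PI / INR (S m))).
    replace (INR (S k) * theta + INR (S k) * y) with (INR (S k) * (theta + y)) by ring.
    replace (INR (S k) * theta - PI / 2 + INR (S k) * y) with
      (- (PI / 2 - INR (S k) * (theta + y))) by ring.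
    rewrite cos_neg, cos_shift. sign_ring.
Qed.

(** The alternating weights annihilate every order below n and read off the leading part. This
    yields both the uniqueness of the leading coefficients and the lower bound for the maximum of
    |T|. *)
Lemma alt_sum_TPlead m a b f theta : TPlead m a b f ->
  sum_f_R0 (fun j => (-1) ^ j * f (theta + INR j * (PI / INR (S m)))) (2 * m + 1) =
  2 * INR (S m) * (a * cos (INR (S m) * theta) + b * sin (INR (S m) * theta)).
Proof.
intros (g & Hg & E).
assert (Hn : 0 < INR (S m)) by (apply lt_0_INR; lia).
rewrite sum_eq with (Bn := fun j =>
   (a * cos (INR (S m) * theta) + b * sin (INR (S m) * theta)) +
   (-1) ^ j * g (theta + INR j * (PI / INR (S m)))).
- rewrite sum_plus, sum_cte, (alt_sum_TP m m g theta (le_n m) Hg).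
  replace (INR (S (2 * m + 1))) with (2 * INR (S m)); [ring|].
  rewrite !S_INR, plus_INR, mult_INR. simpl. ring.
- intros j _. rewrite E.
  replace (INR (S m) * (theta + INR j * (PI / INR (S m)))) with
    (INR (S m) * theta + INR j * PI) by (field; lra).
  destruct (cos_sin_plus_INR_PI (INR (S m) * theta) j) as [-> ->].
  transitivity (((-1) ^ j * (-1) ^ j) * (a * cos (INR (S m) * theta) + b * sin (INR
    (S m) * theta)) +
   (-1) ^ j * g (theta + INR j * (PI / INR (S m)))); [sign_ring|].
  rewrite sign_sq. ring.
Qed.

Lemma TPlead_zero m a b f : TPlead m a b f -> (forall t, f t = 0) -> a = 0 /\ b = 0.
Proof.
intros H E.
assert (Hn : 0 < INR (S m)) by (apply lt_0_INR; lia).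
assert (K : forall theta, a * cos (INR (S m) * theta) + b * sin (INR (S m) * theta) = 0).
{ intros theta. apply Rmult_eq_reg_l with (2 * INR (S m)); [|lra].
  rewrite <- (alt_sum_TPlead m a b f theta H), Rmult_0_r.
  apply sum_eq_R0. intros j _. rewrite E. sign_ring. }
split.
- specialize (K 0). rewrite Rmult_0_r, cos_0, sin_0 in K. lra.
- specialize (K (PI / 2 / INR (S m))).
  replace (INR (S m) * (PI / 2 / INR (S m))) with (PI / 2) in K by (field; lra).
  rewrite cos_PI2, sin_PI2 in K. lra.
Qed.

Definition mono (m : nat) (T : R -> R) : Prop := TPlead m 1 0 T.

Lemma sum_f_R0_Rabs_le f C N : (forall j, (j <= N)%nat -> Rabs (f j) <= C) ->
  Rabs (sum_f_R0 f N) <= INR (S N) * C.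
Proof.
intros H. eapply Rle_trans; [apply Rsum_abs|].
replace (INR (S N) * C) with (sum_f_R0 (fun _ => C) N) by (rewrite sum_cte; ring).
now apply sum_Rle.
Qed.

(** The alternating sum consists of 2n terms and equals 2n, so the terms cannot all be smaller than
    1. *)
Lemma mono_large m T : mono m T -> exists t, 1 <= Rabs (T t).
Proof.
intros H. apply NNPP. intros Hn.
assert (H1 : forall t, Rabs (T t) < 1).
{ intros t. apply Rnot_le_lt. intros H1. apply Hn. now exists t. }
assert (Hm : 0 < INR (S m)) by (apply lt_0_INR; lia).
generalize (alt_sum_TPlead m 1 0 T 0 H).
rewrite Rmult_0_r, cos_0, sin_0.
set (u := fun j => (-1) ^ j * T (0 + INR j * (PI / INR (S m)))). intros E.
assert (U : forall j, u j < 1).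
{ intros j. unfold u. eapply Rle_lt_trans; [apply Rle_abs|].
  rewrite Rabs_mult, pow_1_abs. rewrite Rmult_1_l. apply H1. }
assert (U' : forall N, sum_f_R0 u N < INR (S N)).
{ induction N as [|N IH]; [simpl; apply U|].
  rewrite tech5, (S_INR (S N)). specialize (U (S N)). lra. }
specialize (U' (2 * m + 1)%nat). rewrite E in U'.
revert U'. rewrite !S_INR, plus_INR, mult_INR. simpl. lra.
Qed.

(** * Lagrange interpolation at separated nodes *)

Lemma sum_f_R0_single u j N : (j <= N)%nat ->
  (forall i, (i <= N)%nat -> i <> j -> u i = 0) -> sum_f_R0 u N = u j.
Proof.
intros Hj H. destruct j as [|j].
- destruct N as [|N]; [reflexivity|].
  rewrite decomp_sum by lia. rewrite sum_eq_R0; [ring|].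
  intros i Hi. apply H; [simpl in Hi; lia|lia].
- induction N as [|N IH]; [lia|].
  rewrite tech5. destruct (Nat.eq_dec (S j) (S N)) as [E|E].
  + rewrite E. rewrite sum_eq_R0; [ring|]. intros i Hi. apply H; lia.
  + rewrite IH, (H (S N)); [ring|lia|lia|lia|]. intros i Hi. apply H. lia.
Qed.

Definition skip (i : nat) (p : nat -> R) (j : nat) : R :=
  if lt_dec j i then p j else p (S j).

(** Lagrange's fundamental polynomial for the 2m + 1 nodes p 0, ..., p (2m). One sine per remaining
    node gives 2m factors, hence order m. *)
Definition lagr (p : nat -> R) (m i : nat) (t : R) : R :=
  / sprod (skip i p) (2 * m) (p i) * sprod (skip i p) (2 * m) t.

Lemma lagr_TP p m i : TP m (lagr p m i).
Proof. apply hform_TP, hform_scal, sprod_hform. Qed.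

Lemma lagr_other p m i j : (i <= 2 * m)%nat -> (j <= 2 * m)%nat -> j <> i ->
  lagr p m i (p j) = 0.
Proof.
intros Hi Hj Hij. unfold lagr. apply Rmult_eq_0_compat_l.
destruct (lt_dec j i) as [H|H].
- replace (p j) with (skip i p j) by (unfold skip; destruct (lt_dec j i); [easy|lia]).
  apply sprod_root. lia.
- replace (p j) with (skip i p (pred j)).
  + apply sprod_root. lia.
  + unfold skip. destruct (lt_dec (pred j) i); [lia|]. f_equal. lia.
Qed.

Section Nodes.
Variables (m : nat) (p : nat -> R) (c : R).
Hypothesis Hc : 0 < c.
Hypothesis Hp : forall i j, (i <= 2 * m)%nat -> (j <= 2 * m)%nat -> i <> j ->
  c <= Rabs (sin ((p i - p j) / 2)).

Lemma sprod_skip_ge i : (i <= 2 * m)%nat ->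
  c ^ (2 * m) <= Rabs (sprod (skip i p) (2 * m) (p i)).
Proof.
intros Hi. apply sprod_ge; [lra|]. intros j Hj. unfold skip.
destruct (lt_dec j i); apply Hp; lia.
Qed.

Lemma lagr_bound i t : (i <= 2 * m)%nat -> Rabs (lagr p m i t) <= / c ^ (2 * m).
Proof.
intros Hi. unfold lagr. rewrite Rabs_mult, Rabs_inv, <- (Rmult_1_r (/ c ^ (2 * m))).
assert (H : 0 < c ^ (2 * m)) by now apply pow_lt.
apply Rmult_le_compat; try apply Rabs_pos.
- left. apply Rinv_0_lt_compat. eapply Rlt_le_trans; [exact H|]. now apply sprod_skip_ge.
- apply Rinv_le_contravar; [exact H|]. now apply sprod_skip_ge.
- apply sprod_bound.
Qed.

Lemma TP_interpolation f t : TP m f ->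
  f t = sum_f_R0 (fun i => f (p i) * lagr p m i t) (2 * m).
Proof.
intros Hf. apply Rminus_diag_uniq.
assert (HS : forall N, TP m (fun t => sum_f_R0 (fun i => f (p i) * lagr p m i t) N)).
{ induction N as [|N IH].
  - apply TP_ext with (fun t => f (p 0%nat) * lagr p m 0 t + 0 * lagr p m 0 t).
    + intros; simpl; ring.
    + apply TP_lin; apply lagr_TP.
  - apply TP_ext with (fun t => 1 * sum_f_R0 (fun i => f (p i) * lagr p m i t) N +
      f (p (S N)) * lagr p m (S N) t).
    + intros; simpl; ring.
    + apply TP_lin; [exact IH|apply lagr_TP]. }
refine (hform_zero (2 * m) (fun t => f t - sum_f_R0 (fun i => f (p i) * lagr p m i t)
  (2 * m)) p _ _ _ t).
- apply TP_hform. apply TP_ext with (fun t => 1 * f t + (-1) * sum_f_R0 (fun i => f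
  (p i) * lagr p m i t) (2 * m)).
  + intros; ring.
  + apply TP_lin; auto.
- intros j Hj.
  rewrite (sum_f_R0_single _ j) by
    (try exact Hj; intros i Hi Hij; rewrite lagr_other by lia; ring).
  unfold lagr. rewrite Rinv_l; [ring|].
  intros E. generalize (sprod_skip_ge j Hj) (pow_lt c (2 * m) Hc).
  rewrite E, Rabs_R0. lra.
- intros i j Hij E. assert (H := Hp i j). rewrite E, Rabs_R0 in H.
  specialize (H ltac:(lia) ltac:(lia) ltac:(lia)). lra.
Qed.

Lemma TP_bound_nodes f B t : TP m f ->
  (forall i, (i <= 2 * m)%nat -> Rabs (f (p i)) <= B) ->
  Rabs (f t) <= INR (S (2 * m)) * (B * / c ^ (2 * m)).
Proof.
intros Hf HB. rewrite (TP_interpolation f t Hf). apply sum_f_R0_Rabs_le.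
intros i Hi. rewrite Rabs_mult. apply Rmult_le_compat; try apply Rabs_pos; auto.
now apply lagr_bound.
Qed.

(** T has order m + 1, but T - cos nt has order m and is therefore controlled by 2m + 1 nodes; the
    cosine itself costs 1 at each transition. *)
Lemma mono_bound_nodes T B t : mono m T ->
  (forall i, (i <= 2 * m)%nat -> Rabs (T (p i)) <= B) ->
  Rabs (T t) <= 1 + INR (S (2 * m)) * ((1 + B) * / c ^ (2 * m)).
Proof.
intros (f & Hf & E) HB.
assert (Hcos : forall x, Rabs (1 * cos x + 0 * sin x) <= 1).
{ intros x. rewrite Rmult_0_l, Rplus_0_r, Rmult_1_l. apply Rabs_le, COS_bound. }
rewrite E. eapply Rle_trans; [apply Rabs_triang|]. apply Rplus_le_compat.
- apply Hcos.
- apply TP_bound_nodes; [exact Hf|]. intros i Hi. specialize (HB i Hi). rewrite E in HB.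
  specialize (Hcos (INR (S m) * p i)).
  set (x := 1 * cos (INR (S m) * p i) + 0 * sin (INR (S m) * p i)) in *.
  replace (f (p i)) with ((x + f (p i)) - x) by ring.
  eapply Rle_trans; [apply Rabs_triang|]. rewrite Rabs_Ropp. lra.
Qed.

End Nodes.

(** * Compactness of bounded families of admissible polynomials *)

Definition extraction (phi : nat -> nat) : Prop := forall j, (phi j < phi (S j))%nat.

Lemma extraction_lt phi i j : extraction phi -> (i < j)%nat -> (phi i < phi j)%nat.
Proof.
intros H Hij. induction Hij as [|j _ IH]; [apply H|]. specialize (H j). lia.
Qed.

Lemma extraction_ge phi j : extraction phi -> (j <= phi j)%nat.
Proof. intros H. induction j as [|j IH]; [lia|]. specialize (H j). lia. Qed.

Lemma extraction_comp phi psi : extraction phi -> extraction psi ->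
  extraction (fun j => phi (psi j)).
Proof. intros H H' j. apply extraction_lt; auto. Qed.

Lemma Un_cv_extraction u l phi : extraction phi -> Un_cv u l ->
  Un_cv (fun j => u (phi j)) l.
Proof.
intros H Hu eps He. destruct (Hu eps He) as [N HN]. exists N. intros j Hj.
apply HN. generalize (extraction_ge phi j H). lia.
Qed.

Lemma bolzano_weierstrass (u : nat -> R) C : (forall j, Rabs (u j) <= C) ->
  exists phi, extraction phi /\ exists l, Un_cv (fun j => u (phi j)) l.
Proof.
intros HC.
destruct (Bolzano_Weierstrass u (fun x => - C <= x <= C)) as [l Hl].
- apply compact_P3.
- intros j. generalize (HC j) (Rle_abs (u j)) (Rle_abs (- u j)). rewrite Rabs_Ropp. lra.
- assert (next : forall (N : nat) (eps : R), 0 < eps ->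
    { k | (N <= k)%nat /\ Rabs (u k - l) < eps }).
  { intros N eps He. apply constructive_indefinite_description.
    destruct (Hl (disc l (mkposreal eps He)) N) as (k & Hk & Hd).
    - exists (mkposreal eps He). intros y Hy. exact Hy.
    - exists k. split; [exact Hk|]. exact Hd. }
  assert (pos : forall j, 0 < / INR (S j)).
  { intros j. apply Rinv_0_lt_compat, lt_0_INR. lia. }
  set (phi := fix phi j := match j with
    | O => proj1_sig (next 0%nat _ (pos 0%nat))
    | S j' => proj1_sig (next (S (phi j')) _ (pos j)) end).
  assert (Hphi : forall j, Rabs (u (phi j) - l) < / INR (S j)).
  { intros [|j].
    - exact (proj2 (proj2_sig (next 0%nat _ (pos 0%nat)))).
    - exact (proj2 (proj2_sig (next (S (phi j)) _ (pos (S j))))). }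
  exists phi. split.
  + intros j. exact (proj1 (proj2_sig (next (S (phi j)) _ (pos (S j))))).
  + exists l. intros eps He. destruct (archimed_cor1 eps He) as (N & HN & HN0).
    exists N. intros j Hj. unfold Rdist. eapply Rlt_trans; [apply Hphi|].
    eapply Rle_lt_trans; [|exact HN]. apply Rinv_le_contravar.
    * now apply lt_0_INR.
    * apply le_INR. lia.
Qed.

Lemma bolzano_weierstrass_vec d (u : nat -> nat -> R) C :
  (forall j k, Rabs (u j k) <= C) ->
  exists phi, extraction phi /\ exists l : nat -> R,
    forall k, (k < d)%nat -> Un_cv (fun j => u (phi j) k) (l k).
Proof.
intros HC. induction d as [|d (phi & Hphi & l & Hl)].
- exists (fun j => j). split; [intros j; lia|]. exists (fun _ => 0). intros k Hk. lia.
- destruct (bolzano_weierstrass (fun j => u (phi j) d) C) as (psi & Hpsi & x & Hx).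
  + intros j. apply HC.
  + exists (fun j => phi (psi j)). split; [now apply extraction_comp|].
    exists (fun k => if Nat.eq_dec k d then x else l k). intros k Hk.
    destruct (Nat.eq_dec k d) as [->|Hne]; [exact Hx|].
    apply (Un_cv_extraction (fun j => u (phi j) k)); [exact Hpsi|]. apply Hl. lia.
Qed.

(** The values at 2m + 1 fixed nodes serve as coordinates on the polynomials of order m. A
    subsequence makes them converge, and the bound on the fundamental polynomials turns this into
    uniform convergence. *)
Lemma mono_compact m (T : nat -> R -> R) B :
  (forall j, mono m (T j)) -> (forall j t, Rabs (T j t) <= B) ->
  exists phi T0, extraction phi /\ mono m T0 /\
    forall eps, 0 < eps -> exists N, forall j, (N <= j)%nat ->
      forall t, Rabs (T (phi j) t - T0 t) <= eps.
Proof.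
intros HT HB.
(* Equidistant nodes on the circle: half the difference of two of them is a multiple of pi / (2m +
   1) below pi. *)
set (q := fun i => 2 * (INR i * (PI / INR (S (2 * m))))).
assert (Hn : 0 < INR (S (2 * m))) by (apply lt_0_INR; lia).
assert (Hq : forall i j, (i < j <= 2 * m)%nat -> sin ((q j - q i) / 2) > 0).
{ intros i j Hij. unfold q.
  replace ((2 * (INR j * (PI / INR (S (2 * m)))) - 2 * (INR i * (PI / INR (S (2 * m))))) / 2)
    with ((INR j - INR i) / INR (S (2 * m)) * PI) by (field; lra).
  assert (0 < (INR j - INR i) / INR (S (2 * m)) < 1).
  { rewrite <- minus_INR by lia.
    assert (H1 : 0 < INR (j - i)) by (apply lt_0_INR; lia).
    assert (H2 : INR (j - i) < INR (S (2 * m))) by (apply lt_INR; lia).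
    split.
    - now apply Rdiv_lt_0_compat.
    - apply Rmult_lt_reg_r with (INR (S (2 * m))); [exact Hn|].
      unfold Rdiv. rewrite Rmult_assoc, Rinv_l by lra. lra. }
  apply sin_gt_0; generalize PI_RGT_0; nra. }
assert (Hc : exists c, 0 < c /\ forall i j, (i <= 2 * m)%nat -> (j <= 2 * m)%nat -> i <> j ->
  c <= Rabs (sin ((q i - q j) / 2))).
{ assert (Hc : forall N, (N <= 2 * m)%nat -> exists c, 0 < c /\ forall i j, (i < j <= N)%nat ->
     c <= sin ((q j - q i) / 2)).
  { induction N as [|N IH]; intros HN; [exists 1; split; [lra|intros; lia]|].
    destruct IH as (c & Hc & Hc'); [lia|].
    assert (Hd : forall K, (K <= S N)%nat -> exists d, 0 < d /\ forall i, (i < K)%nat ->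
       d <= sin ((q (S N) - q i) / 2)).
    { induction K as [|K IHK]; intros HK; [exists 1; split; [lra|intros; lia]|].
      destruct IHK as (d & Hd & Hd'); [lia|].
      exists (Rmin d (sin ((q (S N) - q K) / 2))). split.
      - apply Rmin_pos; [exact Hd|]. apply Hq. lia.
      - intros i Hi. destruct (Nat.eq_dec i K) as [->|]; [apply Rmin_r|].
        eapply Rle_trans; [apply Rmin_l|]. apply Hd'. lia. }
    destruct (Hd (S N) (le_n _)) as (d & Hd0 & Hd').
    exists (Rmin c d). split; [now apply Rmin_pos|]. intros i j Hij.
    destruct (Nat.eq_dec j (S N)) as [->|].
    - eapply Rle_trans; [apply Rmin_r|]. apply Hd'. lia.
    - eapply Rle_trans; [apply Rmin_l|]. apply Hc'. lia. }
  destruct (Hc (2 * m)%nat (le_n _)) as (c & Hc0 & Hc'). exists c. split; [exact Hc0|].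
  intros i j Hi Hj Hij. destruct (lt_dec i j) as [H|H].
  - replace ((q i - q j) / 2) with (- ((q j - q i) / 2)) by field.
    rewrite sin_neg, Rabs_Ropp. eapply Rle_trans; [|apply Rle_abs]. apply Hc'. lia.
  - eapply Rle_trans; [|apply Rle_abs]. apply Hc'. lia. }
destruct Hc as (c & Hc & Hcq).
set (K := fun x => cos (INR (S m) * x)).
assert (HK : forall x, Rabs (K x) <= 1) by (intros x; apply Rabs_le, COS_bound).
set (f := fun j t => T j t - K t).
assert (Hf : forall j, TP m (f j)).
{ intros j. destruct (HT j) as (g & Hg & E). apply TP_ext with g; [|exact Hg].
  intros t. unfold f, K. rewrite E. ring. }
assert (Hfb : forall j t, Rabs (f j t) <= B + 1).
{ intros j t. unfold f. eapply Rle_trans; [apply Rabs_triang|]. rewrite Rabs_Ropp.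
  specialize (HB j t). specialize (HK t). lra. }
destruct (bolzano_weierstrass_vec (S (2 * m)) (fun j k => f j (q k)) (B + 1))
  as (phi & Hphi & v & Hv).
{ intros. apply Hfb. }
set (D := / c ^ (2 * m)).
assert (HD : 0 < D) by (apply Rinv_0_lt_compat, pow_lt, Hc).
set (f0 := fun t => sum_f_R0 (fun i => v i * lagr q m i t) (2 * m)).
exists phi, (fun t => K t + f0 t). split; [exact Hphi|]. split.
- exists f0. split.
  + unfold f0. generalize (2 * m)%nat as N. induction N as [|N IH].
    * apply TP_ext with (fun t => v 0%nat * lagr q m 0 t + 0 * lagr q m 0 t).
      -- intros; simpl; ring.
      -- apply TP_lin; apply lagr_TP.
    * apply TP_ext with (fun t => 1 * sum_f_R0 (fun i => v i * lagr q m i t) N +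
         v (S N) * lagr q m (S N) t).
      -- intros; simpl; ring.
      -- apply TP_lin; [exact IH|apply lagr_TP].
  + intros t. unfold K. ring.
- intros eps He.
  assert (He' : 0 < eps / (INR (S (2 * m)) * D)).
  { apply Rdiv_lt_0_compat; [exact He|]. now apply Rmult_lt_0_compat. }
  assert (HN : exists N, forall j, (N <= j)%nat -> forall k, (k < S (2 * m))%nat ->
     Rabs (f (phi j) (q k) - v k) <= eps / (INR (S (2 * m)) * D)).
  { revert Hv. generalize (S (2 * m)) at 1 2 as d. induction d as [|d IH]; intros Hv.
    - exists 0%nat. intros; lia.
    - destruct IH as (N & HN); [intros k Hk; apply Hv; lia|].
      destruct (Hv d (Nat.lt_succ_diag_r d) _ He') as (N' & HN').
      exists (Nat.max N N'). intros j Hj k Hk.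
      destruct (Nat.eq_dec k d) as [->|].
      + left. apply HN'. lia.
      + apply HN; lia. }
  destruct HN as (N & HN). exists N. intros j Hj t.
  replace (T (phi j) t - (K t + f0 t)) with (f (phi j) t - f0 t) by (unfold f; ring).
  rewrite (TP_interpolation m q c Hc Hcq (f (phi j)) t (Hf _)). unfold f0.
  rewrite <- minus_sum.
  replace eps with (INR (S (2 * m)) * (eps / (INR (S (2 * m)) * D) * D)).
  + apply sum_f_R0_Rabs_le. intros i Hi.
    rewrite <- Rmult_minus_distr_r, Rabs_mult.
    apply Rmult_le_compat; try apply Rabs_pos.
    * apply HN; lia.
    * now apply (lagr_bound m q c Hc Hcq).
  + field. split; lra.
Qed.

(** * Closed sets, and outer measure under Lipschitz relations *)

Lemma closed_set_le f c : continuity f -> closed_set (fun x => f x <= c).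
Proof.
intros Hf x Hx. unfold complementary in Hx. apply Rnot_le_lt in Hx.
destruct (Hf x (f x - c)) as (d & Hd & H); [lra|].
exists (mkposreal d Hd). intros y Hy. unfold complementary.
unfold disc in Hy. simpl in Hy. intros Hyc.
destruct (Req_dec x y) as [->|Hne]; [lra|].
assert (K : Rabs (f y - f x) < f x - c).
{ apply H. split; [split; [exact I|exact Hne]|exact Hy]. }
generalize (Rle_abs (- (f y - f x))). rewrite Rabs_Ropp. lra.
Qed.

Lemma closed_set_and A B : closed_set A -> closed_set B -> closed_set (fun x => A x /\ B x).
Proof.
intros HA HB x Hx. unfold complementary in Hx.
destruct (classic (A x)) as [Ax|Ax].
- destruct (HB x) as [d Hd]; [intros Bx; now apply Hx|].
  exists d. intros y Hy [_ By]. now apply (Hd y Hy).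
- destruct (HA x Ax) as [d Hd]. exists d. intros y Hy [Ay _]. now apply (Hd y Hy).
Qed.

Lemma continuity_affine a b : continuity (fun x => a * x + b).
Proof. intros x. reg. Qed.

Lemma closed_set_half_r c : closed_set (fun x => c <= x).
Proof.
intros x Hx. destruct (closed_set_le (fun x => -1 * x + 0) (- c) (continuity_affine _ _) x) as
  [d Hd].
- unfold complementary in *. lra.
- exists d. intros y Hy. specialize (Hd y Hy). unfold complementary in *. lra.
Qed.

Lemma closed_set_half_l c : closed_set (fun x => x <= c).
Proof.
intros x Hx. destruct (closed_set_le (fun x => 1 * x + 0) c (continuity_affine _ _) x) as [d Hd].
- unfold complementary in *. lra.
- exists d. intros y Hy. specialize (Hd y Hy). unfold complementary in *. lra.
Qed.

Lemma closed_set_shift A c : closed_set A -> closed_set (fun x => A (c + x)).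
Proof.
intros HA x Hx. destruct (HA (c + x) Hx) as [d Hd]. exists d. intros y Hy.
apply Hd. unfold disc in *. replace (c + y - (c + x)) with (y - x) by ring. exact Hy.
Qed.

Lemma segment_bounded_sub (A B : R -> Prop) : segment_bounded B ->
  (forall x, A x -> B x) -> segment_bounded A.
Proof. intros (a & b & H) HAB. exists a, b. auto. Qed.

Lemma segment_bounded_and (A P : R -> Prop) : segment_bounded A ->
  segment_bounded (fun x => A x /\ P x).
Proof. intros H. apply (segment_bounded_sub _ A); tauto. Qed.

Lemma segment_bounded_itv a b : segment_bounded (fun x => a <= x <= b).
Proof. exists a, b. tauto. Qed.

#[local] Hint Resolve segment_bounded_and segment_bounded_itv : core.

Lemma lebesgue_outer_ext (A B : R -> Prop) : segment_bounded A ->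
  (forall x, A x <-> B x) -> lebesgue_outer A = lebesgue_outer B.
Proof.
intros HA H. apply Rle_antisym; apply lebesgue_outer_mono; try apply H; auto.
apply (segment_bounded_sub _ A); [exact HA|apply H].
Qed.

Lemma cover_sum_exists A : segment_bounded A -> exists s, cover_sum A s.
Proof.
intros (a & b & HA).
exists (Rmax a b - a), (fun i => match i with O => a | _ => 0 end),
  (fun i => match i with O => Rmax a b | _ => 0 end).
split; [|split].
- intros [|i]; [apply Rmax_l|lra].
- intros x Hx. exists 0%nat. split; [now apply HA|].
  eapply Rle_trans; [now apply HA|apply Rmax_r].
- assert (E : forall N, sum_f_R0 (fun i => match i with O => Rmax a b | _ => 0 end -
      match i with O => a | _ => 0 end) N = Rmax a b - a).
  { induction N as [|N IH]; [reflexivity|]. rewrite tech5, IH. ring. }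
  intros eps He. exists 0%nat. intros n _. rewrite E. unfold Rdist.
  rewrite Rminus_diag, Rabs_R0. exact He.
Qed.

Lemma lebesgue_outer_ge0 A : segment_bounded A -> 0 <= lebesgue_outer A.
Proof.
intros HA. rewrite lebesgue_outer_cover. apply Rinf_greatest.
- now apply cover_sum_exists.
- apply cover_sum_ge0.
Qed.

Lemma lebesgue_outer_le_itv A a b : a <= b -> (forall x, A x -> a <= x <= b) ->
  lebesgue_outer A <= b - a.
Proof.
intros Hab H. rewrite <- (lebesgue_outer_itv a b Hab). now apply lebesgue_outer_mono.
Qed.

Lemma lebesgue_outer_ge_itv A a b : a <= b -> segment_bounded A ->
  (forall x, a <= x <= b -> A x) -> b - a <= lebesgue_outer A.
Proof.
intros Hab HA H. rewrite <- (lebesgue_outer_itv a b Hab). now apply lebesgue_outer_mono.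
Qed.

Lemma lebesgue_outer_pos A a b : a < b -> segment_bounded A ->
  (forall x, a < x < b -> A x) -> 0 < lebesgue_outer A.
Proof.
intros Hab HA H.
assert (K := lebesgue_outer_ge_itv A ((2 * a + b) / 3) ((a + 2 * b) / 3) ltac:(lra) HA).
enough ((a + 2 * b) / 3 - (2 * a + b) / 3 <= lebesgue_outer A) by lra.
apply K. intros x Hx. apply H. lra.
Qed.

(* The relation is a bi-partial map from [A] onto [B] which is [c]-Lipschitz; a
   relation is used because it covers a map as well as the inverse of a map. *)
Lemma lebesgue_outer_lipschitz (A B : R -> Prop) (rel : R -> R -> Prop) c :
  0 <= c -> segment_bounded A ->
  (forall y, B y -> exists x, A x /\ rel x y) ->
  (forall x x' y y', A x -> A x' -> rel x y -> rel x' y' ->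
     Rabs (y - y') <= c * Rabs (x - x')) ->
  lebesgue_outer B <= c * lebesgue_outer A.
Proof.
intros Hc HA HB Hlip.
assert (key : forall s, cover_sum A s -> lebesgue_outer B <= c * s).
{ intros s (a & b & Hab & Hcov & Hs).
  (* The part of [B] related to the i-th covering segment has diameter at most [c * (b i - a i)], so
     it fits into the segment of that length ending at its supremum. *)
  set (img := fun i y => B y /\ exists x, A x /\ rel x y /\ a i <= x <= b i).
  assert (Himg : forall i y y', img i y -> img i y' -> y <= y' + c * (b i - a i)).
  { intros i y y' (_ & x & Ax & Hx & Ix) (_ & x' & Ax' & Hx' & Ix').
    generalize (Hlip x x' y y' Ax Ax' Hx Hx') (Rle_abs (y - y')).
    assert (Rabs (x - x') <= b i - a i) by (apply Rabs_le; lra).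
    intros; nra. }
  assert (top : forall i, exists t, forall y, img i y -> t - c * (b i - a i) <= y <= t).
  { intros i. destruct (classic (exists y, img i y)) as [[y0 H0]|Hn].
    - destruct (completeness (img i)) as [t [Ht Ht']].
      + exists (y0 + c * (b i - a i)). intros y Hy. now apply Himg.
      + now exists y0.
      + exists t. intros y Hy. split; [|now apply Ht].
        enough (t <= y + c * (b i - a i)) by lra.
        apply Ht'. intros y' Hy'. now apply Himg.
    - exists 0. intros y Hy. exfalso. apply Hn. now exists y. }
  set (t := fun i => proj1_sig (constructive_indefinite_description _ (top i))).
  assert (Ht : forall i y, img i y -> t i - c * (b i - a i) <= y <= t i).
  { intros i. exact (proj2_sig (constructive_indefinite_description _ (top i))). }
  rewrite lebesgue_outer_cover. apply Rinf_lower with 0; [apply cover_sum_ge0|].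
  exists (fun i => t i - c * (b i - a i)), t. split; [|split].
  - intros i. specialize (Hab i). nra.
  - intros y By. destruct (HB y By) as (x & Ax & Hxy). destruct (Hcov x Ax) as (i & Hi).
    exists i. apply Ht. split; [exact By|]. now exists x.
  (* Dividing by [c + 1] rather than [c] covers the case [c = 0]. *)
  - intros eps He. destruct (Hs (eps / (c + 1))) as (N & HN).
    { apply Rdiv_lt_0_compat; lra. }
    exists N. intros n Hn. specialize (HN n Hn). unfold Rdist in *.
    rewrite sum_eq with (Bn := fun i => (b i - a i) * c) by (intros; ring).
    rewrite <- scal_sum, <- Rmult_minus_distr_l, Rabs_mult, (Rabs_pos_eq c Hc).
    set (u := Rabs (sum_f_R0 (fun i => b i - a i) n - s)) in *.
    assert (0 <= u) by apply Rabs_pos.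
    assert (u * (c + 1) < eps).
    { replace eps with (eps / (c + 1) * (c + 1)) by (field; lra).
      apply Rmult_lt_compat_r; lra. }
    nra. }
destruct (cover_sum_exists A HA) as [s0 Hs0].
destruct (Rle_lt_or_eq_dec 0 c Hc) as [Hc'|<-].
- rewrite (lebesgue_outer_cover A).
  assert (H : lebesgue_outer B / c <= Rinf (cover_sum A)).
  { apply Rinf_greatest; [now exists s0|]. intros s Hs. specialize (key s Hs).
    apply Rmult_le_reg_l with c; [exact Hc'|].
    replace (c * (lebesgue_outer B / c)) with (lebesgue_outer B) by (field; lra). exact key. }
  apply Rmult_le_compat_l with (r := c) in H; [|lra].
  replace (c * (lebesgue_outer B / c)) with (lebesgue_outer B) in H by (field; lra). exact H.
- specialize (key s0 Hs0). lra.
Qed.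

Lemma lebesgue_outer_isometry (A : R -> Prop) u c : u = 1 \/ u = -1 ->
  segment_bounded A -> lebesgue_outer (fun x => A (u * x + c)) = lebesgue_outer A.
Proof.
intros Hu HA.
assert (HA' : segment_bounded (fun x => A (u * x + c))).
{ destruct HA as (a & b & H).
  destruct Hu as [-> | ->]; [exists (a - c), (b - c)|exists (c - b), (c - a)];
    intros x Hx; apply H in Hx; lra. }
assert (E : forall x x', Rabs (u * x + c - (u * x' + c)) = Rabs (x - x')).
{ intros x x'. replace (u * x + c - (u * x' + c)) with (u * (x - x')) by ring.
  rewrite Rabs_mult. destruct Hu as [-> | ->]; [rewrite Rabs_R1|rewrite Rabs_left by lra]; ring. }
apply Rle_antisym.
- apply Rle_trans with (1 * lebesgue_outer A); [|lra].
  apply (lebesgue_outer_lipschitz _ _ (fun x y => x = u * y + c)); [lra|exact HA| |].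
  + intros y Hy. now exists (u * y + c).
  + intros x x' y y' _ _ -> ->. rewrite E. lra.
- apply Rle_trans with (1 * lebesgue_outer (fun x => A (u * x + c))); [|lra].
  apply (lebesgue_outer_lipschitz _ _ (fun x y => y = u * x + c)); [lra|exact HA'| |].
  + intros y Hy. exists (u * (y - c)).
    assert (Eq : u * (u * (y - c)) + c = y) by (destruct Hu as [-> | ->]; ring).
    split; now rewrite Eq.
  + intros x x' y y' _ _ -> ->. rewrite E. lra.
Qed.

(** * Measure over an arbitrary period *)

Definition window (E : R -> Prop) (c : R) (x : R) : Prop := E x /\ c <= x < c + 2 * PI.

Lemma window_bounded E c : segment_bounded (window E c).
Proof. exists c, (c + 2 * PI). intros x [_ H]. lra. Qed.
#[local] Hint Resolve window_bounded : core.

(** The piece of the first window to the left of [c'], translated by one period, is the piece of the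
    second window beyond [c + 2 * PI]; the rest is common to both. *)
Lemma window_near E c c' : periodic_set E -> c <= c' <= c + 2 * PI ->
  lebesgue_outer (window E c) = lebesgue_outer (window E c').
Proof.
intros HE Hc.
rewrite (lebesgue_outer_split (fun x => c' <= x) (window E c)) by
  (auto; apply closed_set_half_r).
rewrite (lebesgue_outer_split (fun x => c + 2 * PI <= x) (window E c')) by
  (auto; apply closed_set_half_r).
rewrite Rplus_comm. f_equal.
- rewrite <- (lebesgue_outer_isometry (fun x => window E c' x /\ c + 2 * PI <= x) 1
  (2 * PI)) by auto.
  apply lebesgue_outer_ext; [auto|]. intros x. unfold window. rewrite Rmult_1_l.
  rewrite <- (HE x). split; intros [[H1 H2] H3]; repeat split; auto; lra.
- apply lebesgue_outer_ext; [auto|]. intros x. unfold window.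
  split; intros [[H1 H2] H3]; repeat split; auto; lra.
Qed.

Lemma lebesgue_outer_window E c : periodic_set E ->
  lebesgue_outer (window E c) = mes_T E.
Proof.
intros HE. assert (HP := PI_RGT_0).
assert (step : forall N c, lebesgue_outer (window E (c + INR N * (2 * PI))) =
  lebesgue_outer (window E c)).
{ induction N as [|N IH]; intros x.
  - f_equal. f_equal. simpl. ring.
  - rewrite <- (IH x). symmetry. apply window_near; [exact HE|]. rewrite S_INR. lra. }
transitivity (lebesgue_outer (window E 0)).
- assert (pos : forall x, 0 <= x -> lebesgue_outer (window E x) = lebesgue_outer (window E 0)).
  { intros x Hx. destruct (euclidian_division x (2 * PI)) as (k & r & Ex & Hr & Hr'); [lra|].
    rewrite Rabs_pos_eq in Hr' by lra.
    assert (Hk : (-1 < k)%Z).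
    { apply lt_IZR. apply Rmult_lt_reg_r with (2 * PI); [lra|]. lra. }
    rewrite (window_near E 0 r) by (auto; lra).
    rewrite <- (step (Z.to_nat k) r). do 2 f_equal.
    rewrite INR_IZR_INZ, Z2Nat.id by lia. lra. }
  destruct (INR_archimed (2 * PI) (- c)) as [N HN]; [lra|].
  rewrite <- (step N c). apply pos. lra.
- apply lebesgue_outer_ext; [auto|]. intros x. unfold window.
  rewrite Rplus_0_l. tauto.
Qed.

(** * The bathtub principle *)

Lemma cos_half_decr x y : 0 <= x -> x <= y -> y < PI -> 0 < cos (y / 2) <= cos (x / 2).
Proof.
intros Hx Hxy Hy. split.
- apply cos_gt_0; generalize PI_RGT_0; lra.
- apply cos_decr_1; generalize PI_RGT_0; lra.
Qed.

Section Bathtub.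
Variable eps : R.
Hypothesis Heps : 0 < eps.
Let phi x := x + eps * tan (x / 2).

(** The derivative of [tan (x / 2)]: the extra density of the map [phi] per unit of [eps]. *)
Definition half_sec2 (a : R) : R := / (2 * (cos (a / 2) * cos (a / 2))).

Lemma half_sec2_le a b : 0 <= a -> a <= b -> b < PI -> 0 < half_sec2 a <= half_sec2 b.
Proof.
intros Ha Hab Hb. destruct (cos_half_decr a b Ha Hab Hb) as [H1 H2].
unfold half_sec2. split.
- apply Rinv_0_lt_compat. nra.
- apply Rinv_le_contravar; nra.
Qed.

Lemma half_sec2_lt a b : 0 <= a -> a < b -> b < PI -> half_sec2 a < half_sec2 b.
Proof.
intros Ha Hab Hb. assert (HP := PI_RGT_0).
assert (H1 : cos (b / 2) < cos (a / 2)) by (apply cos_decreasing_1; lra).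
assert (H2 : 0 < cos (b / 2)) by (apply cos_gt_0; lra).
unfold half_sec2. apply Rinv_lt_contravar; [|nra].
repeat apply Rmult_lt_0_compat; lra.
Qed.

Lemma half_sec2_opp a : half_sec2 (- a) = half_sec2 a.
Proof.
unfold half_sec2. replace (- a / 2) with (- (a / 2)) by field. now rewrite cos_neg.
Qed.

Lemma phi_derivable z : - PI < z < PI ->
  derivable_pt_lim phi z (1 + eps * half_sec2 z).
Proof.
intros Hz. unfold phi.
assert (Hc : cos (z / 2) <> 0) by (apply Rgt_not_eq, cos_gt_0; lra).
apply (derivable_pt_lim_plus id (fun z => eps * tan (z / 2))); [apply derivable_pt_lim_id|].
apply (derivable_pt_lim_scal (fun z => tan (z / 2))).
assert (H2 : derivable_pt_lim (fun z => z / 2) z (/ 2)).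
{ assert (H := derivable_pt_lim_scal id (/ 2) z 1 (derivable_pt_lim_id z)).
  rewrite Rmult_1_r in H. revert H. apply derivable_pt_lim_ext.
  intros x. unfold mult_real_fct, id. field. }
replace (half_sec2 z) with
  ((cos (z / 2) * cos (z / 2) - - sin (z / 2) * sin (z / 2)) / Rsqr (cos (z / 2)) * / 2).
- apply (derivable_pt_lim_comp (fun z => z / 2) tan); [exact H2|].
  apply (derivable_pt_lim_div sin cos); auto using derivable_pt_lim_sin, derivable_pt_lim_cos.
- unfold half_sec2, Rsqr.
  replace (cos (z/2) * cos (z/2) - - sin (z/2) * sin (z/2)) with 1
    by (generalize (cos_sin_sq (z / 2)); lra).
  field. exact Hc.
Qed.

Lemma phi_mvt x y : - PI < y -> y < x -> x < PI ->
  exists z, phi x - phi y = (1 + eps * half_sec2 z) * (x - y) /\ y < z < x.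
Proof.
intros Hy Hyx Hx.
destruct (MVT_cor2 phi (fun z => 1 + eps * half_sec2 z) y x Hyx) as (z & E & Hz).
- intros z Hz. apply phi_derivable. lra.
- now exists z.
Qed.

Lemma phi_expand a x y : 0 <= a -> a <= y -> y <= x -> x < PI ->
  (1 + eps * half_sec2 a) * (x - y) <= phi x - phi y.
Proof.
intros Ha Hy Hyx Hx. destruct (Rle_lt_or_eq_dec _ _ Hyx) as [H|<-].
- destruct (phi_mvt x y) as (z & E & Hz); try lra. rewrite E.
  apply Rmult_le_compat_r; [lra|].
  destruct (half_sec2_le a z) as [_ K]; try lra.
  apply Rplus_le_compat_l, Rmult_le_compat_l; lra.
- lra.
Qed.

Lemma phi_incr x y : - PI < y -> y <= x -> x < PI -> 0 <= phi x - phi y.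
Proof.
intros Hy Hyx Hx. destruct (Rle_lt_or_eq_dec _ _ Hyx) as [H|<-].
- destruct (phi_mvt x y) as (z & E & Hz); try lra. rewrite E.
  assert (0 < half_sec2 z).
  { unfold half_sec2. apply Rinv_0_lt_compat.
    assert (0 < cos (z / 2)) by (apply cos_gt_0; lra). nra. }
  assert (0 < eps * half_sec2 z) by now apply Rmult_lt_0_compat.
  apply Rmult_le_pos; lra.
- lra.
Qed.

Lemma phi_contract a x y : 0 <= a < PI -> - a <= y -> y <= x -> x <= a ->
  phi x - phi y <= (1 + eps * half_sec2 a) * (x - y).
Proof.
intros Ha Hy Hyx Hx. destruct (Rle_lt_or_eq_dec _ _ Hyx) as [H|<-].
- destruct (phi_mvt x y) as (z & E & Hz); try lra. rewrite E.
  apply Rmult_le_compat_r; [lra|].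
  assert (K : half_sec2 z <= half_sec2 a).
  { destruct (Rle_dec 0 z) as [Hz0|Hz0].
    - apply half_sec2_le; lra.
    - rewrite <- half_sec2_opp. apply half_sec2_le; lra. }
  apply Rplus_le_compat_l, Rmult_le_compat_l; lra.
- lra.
Qed.

Lemma phi_opp x : phi (- x) = - phi x.
Proof.
unfold phi. replace (- x / 2) with (- (x / 2)) by field. rewrite tan_neg. ring.
Qed.

(** To the right of [a] the derivative of [phi] is at least its value at [a], so the inverse of
    [phi] is Lipschitz with the reciprocal constant. The margin [d] stays away from the pole at
    [PI]. *)
Lemma slice_expand (X Y : R -> Prop) a d : 0 <= a -> 0 < d ->
  (forall x, X x -> a <= x <= PI - d) -> segment_bounded Y ->
  (forall x, X x -> Y (phi x)) ->
  (1 + eps * half_sec2 a) * lebesgue_outer X <= lebesgue_outer Y.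
Proof.
intros Ha Hd HX HY HXY.
destruct (classic (exists x, X x)) as [[x0 Hx0]|Hn].
- assert (Hsec : 0 < half_sec2 a).
  { apply HX in Hx0. apply (half_sec2_le a a); lra. }
  assert (Hs : 0 < 1 + eps * half_sec2 a).
  { assert (0 < eps * half_sec2 a) by now apply Rmult_lt_0_compat. lra. }
  apply Rmult_le_reg_l with (/ (1 + eps * half_sec2 a)); [now apply Rinv_0_lt_compat|].
  rewrite <- Rmult_assoc, Rinv_l, Rmult_1_l by lra.
  apply (lebesgue_outer_lipschitz Y X (fun y x => X x /\ y = phi x)).
  + left. now apply Rinv_0_lt_compat.
  + exact HY.
  + intros x Hx. exists (phi x). auto.
  + intros y y' x x' _ _ [Hx ->] [Hx' ->].
    assert (W : forall x x', X x -> X x' -> x' <= x ->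
       Rabs (x - x') <= / (1 + eps * half_sec2 a) * Rabs (phi x - phi x')).
    { clear x x' Hx Hx'. intros x x' Hx Hx' Hle.
      apply HX in Hx. apply HX in Hx'.
      assert (K := phi_expand a x x' Ha ltac:(lra) Hle ltac:(lra)).
      rewrite !Rabs_pos_eq; try lra.
      - apply Rmult_le_reg_l with (1 + eps * half_sec2 a); [exact Hs|].
        rewrite <- Rmult_assoc, Rinv_r, Rmult_1_l by lra. exact K.
      - apply phi_incr; lra. }
    destruct (Rle_dec x' x) as [H|H]; [now apply W|].
    rewrite (Rabs_minus_sym x), (Rabs_minus_sym (phi x)). apply W; auto. lra.
- assert (E : lebesgue_outer X <= 0).
  { apply Rle_trans with (0 - 0); [|lra].
    apply lebesgue_outer_le_itv; [lra|]. intros x Hx. exfalso. apply Hn. now exists x. }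
  assert (E' : 0 <= lebesgue_outer X).
  { apply lebesgue_outer_ge0. exists 0, 0. intros x Hx. exfalso. apply Hn. now exists x. }
  replace (lebesgue_outer X) with 0 by lra. rewrite Rmult_0_r.
  now apply lebesgue_outer_ge0.
Qed.
End Bathtub.

(** Of a mass [r] lying beyond [a], at least half lies beyond [a + r / 2], where the density exceeds
    that at [a] by at least the first factor. *)
Definition tail_gain (a r : R) : R := (half_sec2 (a + r / 2) - half_sec2 a) * (r / 2).

Lemma lebesgue_outer_split_gt A c : segment_bounded A ->
  lebesgue_outer A = lebesgue_outer (fun x => A x /\ x <= c) +
                     lebesgue_outer (fun x => A x /\ c < x).
Proof.
intros HA. rewrite (lebesgue_outer_split (fun x => x <= c) A) by
  (auto; apply closed_set_half_l).
f_equal. apply lebesgue_outer_ext; [auto|]. intros x. split; intros [H1 H2]; split; auto; lra.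
Qed.

(** The tail is cut at [a + r / 2] and each half is expanded by the smallest density on it. The gain
    involves only [a] and [r], so it is fixed before [eps] and [Y] are chosen. *)
Lemma tail_bound (K : R -> Prop) a d : 0 <= a -> 0 < d ->
  (forall x, K x -> x <= PI - d) -> segment_bounded K ->
  let r := lebesgue_outer (fun x => K x /\ a < x) in
  0 <= tail_gain a r /\ (0 < r -> 0 < tail_gain a r) /\
  forall eps Y, 0 < eps -> segment_bounded Y ->
    (forall x, K x -> Y (x + eps * tan (x / 2))) ->
    (1 + eps * half_sec2 a) * r + eps * tail_gain a r <=
    lebesgue_outer (fun y => Y y /\ a + eps * tan (a / 2) < y).
Proof.
intros Ha Hd HK bK r.
assert (Hr : 0 <= r) by (apply lebesgue_outer_ge0; auto).
destruct (Rle_lt_or_eq_dec 0 r Hr) as [Hr0|Hr0].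
- assert (Hra : r <= PI - d - a).
  { destruct (classic (exists x, K x /\ a < x)) as [[x0 [H1 H2]]|Hn].
    - apply lebesgue_outer_le_itv; [specialize (HK _ H1); lra|].
      intros x [Hx Hx']. specialize (HK _ Hx). lra.
    - exfalso. assert (r <= 0 - 0); [|lra].
      apply lebesgue_outer_le_itv; [lra|]. intros x Hx. exfalso. apply Hn. now exists x. }
  set (b := a + r / 2).
  assert (Hb : half_sec2 a < half_sec2 b) by (apply half_sec2_lt; unfold b; lra).
  assert (Hg : 0 < tail_gain a r) by (apply Rmult_lt_0_compat; fold b; lra).
  split; [lra|]. split; [auto|]. intros eps Y He bY HY.
  set (X := fun x => K x /\ a < x) in *.
  assert (bX : segment_bounded X) by (unfold X; auto).
  set (phi := fun x => x + eps * tan (x / 2)).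
  set (Z := fun y => Y y /\ phi a < y).
  change (lebesgue_outer (fun y => Y y /\ a + eps * tan (a / 2) < y)) with (lebesgue_outer Z).
  assert (bZ : segment_bounded Z) by (unfold Z; auto).
  assert (EX := lebesgue_outer_split_gt X b bX). fold r in EX.
  rewrite (lebesgue_outer_split_gt Z (phi b) bZ).
  set (r1 := lebesgue_outer (fun x => X x /\ x <= b)) in *.
  set (r2 := lebesgue_outer (fun x => X x /\ b < x)) in *.
  assert (Hr1 : r1 <= r / 2).
  { replace (r / 2) with (b - a) by (unfold b; field).
    apply lebesgue_outer_le_itv; [unfold b; lra|]. unfold X. intros x. lra. }
  assert (Hstrict : forall x y, a <= y -> y < x -> x < PI -> phi y < phi x).
  { intros x y H1 H2 H3. generalize (phi_expand eps He a x y Ha H1 ltac:(lra) H3).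
    destruct (half_sec2_le a a) as [Hp _]; try lra.
    assert (0 < (1 + eps * half_sec2 a) * (x - y)).
    { apply Rmult_lt_0_compat; [|lra].
      assert (0 < eps * half_sec2 a) by now apply Rmult_lt_0_compat. lra. }
    unfold phi. lra. }
  assert (S1 : (1 + eps * half_sec2 a) * r1 <= lebesgue_outer (fun y => Z y /\ y <= phi b)).
  { apply (slice_expand eps He _ _ a d); auto.
    - unfold X. intros x [[Hx Hx'] _]. specialize (HK x Hx). lra.
    - unfold X, Z. intros x [[Hx Hx'] Hxb]. specialize (HK x Hx). split; [split|].
      + now apply HY.
      + apply Hstrict; lra.
      + fold (phi x). generalize (phi_incr eps He b x ltac:(generalize PI_RGT_0; lra) Hxb
        ltac:(unfold b; lra)).
        unfold phi. lra. }
  assert (S2 : (1 + eps * half_sec2 b) * r2 <= lebesgue_outer (fun y => Z y /\ phi b < y)).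
  { apply (slice_expand eps He _ _ b d); auto.
    - unfold b. lra.
    - unfold X. intros x [[Hx Hx'] Hxb]. specialize (HK x Hx). lra.
    - unfold X, Z. intros x [[Hx Hx'] Hxb]. specialize (HK x Hx). split; [split|].
      + now apply HY.
      + apply Hstrict; lra.
      + apply Hstrict; unfold b in *; lra. }
  unfold tail_gain. fold b.
  assert (Hm : eps * ((half_sec2 b - half_sec2 a) * (r / 2)) <= eps * ((half_sec2 b
    - half_sec2 a) * r2)).
  { apply Rmult_le_compat_l; [lra|]. apply Rmult_le_compat_l; lra. }
  rewrite EX at 1. nra.
- rewrite <- Hr0. unfold tail_gain. replace (0 / 2) with 0 by field.
  rewrite !Rmult_0_r. split; [lra|]. split; [lra|]. intros eps Y He bY HY.
  apply Rle_trans with 0; [right; ring|]. apply lebesgue_outer_ge0. auto.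
Qed.

(* Bathtub principle: since the density 1 + eps/(2 cos^2(x/2)) of the map
   x |-> x + eps tan(x/2) increases with |x|, the image of K is longest from below
   when K is the segment [-L/2, L/2]; delta measures the mass of K outside of it. *)
Lemma bathtub (K : R -> Prop) d : closed_set K -> 0 < d ->
  (forall x, K x -> - PI + d <= x <= PI - d) ->
  let L := lebesgue_outer K in
  exists delta, 0 <= delta /\
    (0 < lebesgue_outer (fun x => K x /\ ~ (- (L / 2) <= x <= L / 2)) -> 0 < delta) /\
    forall eps Y, 0 < eps -> segment_bounded Y ->
      (forall x, K x -> Y (x + eps * tan (x / 2))) ->
      L + 2 * eps * tan (L / 4) + eps * delta <= lebesgue_outer Y.
Proof.
intros clK Hd HK L. assert (HP := PI_RGT_0).
assert (bK : segment_bounded K) by now exists (- PI + d), (PI - d).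
assert (HL : 0 <= L) by now apply lebesgue_outer_ge0.
set (a := L / 2).
destruct (Rlt_le_dec PI d) as [Hdd|Hdd].
{ exists 0. assert (Hn : forall x, ~ K x) by (intros x Hx; specialize (HK x Hx); lra).
  assert (HL0 : L = 0).
  { enough (L <= 0 - 0) by lra. apply lebesgue_outer_le_itv;
    [lra|]. intros x Hx. now apply Hn in Hx. }
  split; [lra|]. split.
  - intros H. exfalso.
    assert (lebesgue_outer (fun x => K x /\ ~ - a <= x <= a) <= 0 - 0); [|lra].
    apply lebesgue_outer_le_itv; [lra|]. intros x [Hx _]. now apply Hn in Hx.
  - intros eps Y He bY _. rewrite HL0. replace (0 / 4) with 0 by field. rewrite tan_0.
    generalize (lebesgue_outer_ge0 Y bY). lra. }
assert (HLd : L <= 2 * PI - 2 * d).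
{ replace (2 * PI - 2 * d) with (PI - d - (- PI + d)) by ring.
  apply lebesgue_outer_le_itv; [lra|exact HK]. }
assert (Ha : 0 <= a < PI) by (unfold a; lra).
(* The mass to the left of [- a] is treated as the right tail of the reflected set. *)
set (K' := fun x => K (-1 * x + 0)).
assert (bK' : segment_bounded K').
{ exists (- PI + d), (PI - d). intros x Hx. apply HK in Hx. lra. }
destruct (tail_bound K a d) as (G1 & G1' & T1); try lra; auto; [intros x Hx; now apply HK|].
destruct (tail_bound K' a d) as (G2 & G2' & T2); try lra; auto.
{ intros x Hx. apply HK in Hx. lra. }
set (r := lebesgue_outer (fun x => K x /\ a < x)) in *.
set (l := lebesgue_outer (fun x => K' x /\ a < x)) in *.
exists (tail_gain a r + tail_gain a l). split; [lra|].
assert (El : l = lebesgue_outer (fun x => K x /\ x < - a)).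
{ rewrite <- (lebesgue_outer_isometry (fun x => K x /\ x < - a) (-1) 0) by auto.
  apply lebesgue_outer_ext; [auto|]. intros x. unfold K'. split; intros [H1 H2]; split; auto; lra. }
assert (Hr : 0 <= r) by (apply lebesgue_outer_ge0; auto).
assert (Hl : 0 <= l) by (apply lebesgue_outer_ge0; auto).
split.
{ intros H. destruct (Rle_lt_or_eq_dec 0 r Hr) as [H1|H1]; [specialize (G1' H1); lra|].
  destruct (Rle_lt_or_eq_dec 0 l Hl) as [H2|H2]; [specialize (G2' H2); lra|].
  exfalso. enough (lebesgue_outer (fun x => K x /\ ~ - a <= x <= a) <= r + l) by lra.
  rewrite El. apply lebesgue_outer_sub; auto. intros x [Hx Hx'].
  destruct (Rlt_le_dec a x); [left; auto|right; split; auto].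
  apply Rnot_le_lt. intros H3. apply Hx'. lra. }
intros eps Y He bY HY.
set (phi := fun x => x + eps * tan (x / 2)) in *.
set (Y' := fun y => Y (-1 * y + 0)).
assert (bY' : segment_bounded Y').
{ destruct bY as (u & v & H). exists (- v), (- u). intros y Hy. apply H in Hy. lra. }
specialize (T1 eps Y He bY HY).
specialize (T2 eps Y' He bY'). 
assert (HY' : forall x, K' x -> Y' (x + eps * tan (x / 2))).
{ intros x Hx. unfold Y'. specialize (HY _ Hx).
  replace (-1 * x + 0) with (- x) in HY by ring.
  replace (- x / 2) with (- (x / 2)) in HY by field. rewrite tan_neg in HY.
  replace (-1 * (x + eps * tan (x / 2)) + 0) with (- x + eps * - tan (x / 2)) by ring. exact HY. }
specialize (T2 HY').
change (a + eps * tan (a / 2)) with (phi a) in T1, T2.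
assert (E2 : lebesgue_outer (fun y => Y' y /\ phi a < y) =
             lebesgue_outer (fun y => Y y /\ y < - phi a)).
{ rewrite <- (lebesgue_outer_isometry (fun y => Y y /\ y < - phi a) (-1) 0) by auto.
  apply lebesgue_outer_ext; [auto|]. intros x. unfold Y'. split; intros [H1 H2]; split; auto; lra. }
rewrite E2 in T2.
assert (Hopp : forall x, phi (- x) = - phi x) by (intros x; apply phi_opp).
assert (Hinc : forall x y, - PI < y -> y <= x -> x < PI -> phi y <= phi x).
{ intros x y H1 H2 H3. generalize (phi_incr eps He x y H1 H2 H3). unfold phi. lra. }
assert (Hpa : 0 <= phi a).
{ replace 0 with (phi 0); [apply Hinc; lra|].
  unfold phi. replace (0 / 2) with 0 by field. rewrite tan_0. ring. }
rewrite (lebesgue_outer_split_gt Y (phi a) bY).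
rewrite (lebesgue_outer_split (fun y => - phi a <= y) (fun y => Y y /\ y <= phi a))
  by (auto; apply closed_set_half_r).
rewrite (lebesgue_outer_ext (fun x => (Y x /\ x <= phi a) /\ ~ - phi a <= x)
  (fun y => Y y /\ y < - phi a)) by (auto; intros x; intuition lra).
set (mid := lebesgue_outer (fun x => (Y x /\ x <= phi a) /\ - phi a <= x)).
(* [K] has the length of the segment, so what it lacks inside equals what it has outside. *)
assert (EK : lebesgue_outer (fun x => - a <= x <= a /\ ~ K x) = r + l).
{ assert (E1 := lebesgue_outer_split K (fun x => - a <= x <= a) clK (segment_bounded_itv _ _)).
  rewrite lebesgue_outer_itv in E1 by lra.
  assert (E3 := lebesgue_outer_split_gt K a bK). fold L r in E3.
  rewrite (lebesgue_outer_split (fun y => - a <= y) (fun y => K y /\ y <= a)) in E3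
    by (auto; apply closed_set_half_r).
  rewrite (lebesgue_outer_ext (fun x => (K x /\ x <= a) /\ ~ - a <= x)
    (fun y => K y /\ y < - a)), <- El in E3
    by (auto; intros x; intuition lra).
  rewrite (lebesgue_outer_ext (fun x => (K x /\ x <= a) /\ - a <= x)
    (fun x => - a <= x <= a /\ K x)) in E3 by (auto; intros x; tauto).
  unfold a in *. lra. }
(* The image of the whole segment is covered by the middle part of [Y] and the images of the points
   that [K] lacks. These are stretched at most by the density at [a], the factor by which the tails
   are stretched at least, so the two contributions balance. *)
assert (Hmid : phi a - - phi a <= mid + (1 + eps * half_sec2 a) * (r + l)).
{ rewrite <- EK. rewrite <- (lebesgue_outer_itv (- phi a) (phi a)) by lra.
  apply Rle_trans with (mid + lebesgue_outer (fun y => - phi a <= y <= phi a /\ ~ Y y)).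
  - apply lebesgue_outer_sub; auto. intros y Hy. destruct (classic (Y y)); tauto.
  - apply Rplus_le_compat_l.
    assert (Hsec : 0 < half_sec2 a) by (apply (half_sec2_le a a); lra).
    assert (0 < eps * half_sec2 a) by now apply Rmult_lt_0_compat.
    apply (lebesgue_outer_lipschitz _ _ (fun x y => - a <= x <= a /\ y = phi x)); [lra|auto| |].
    + intros y [Hy HnY].
      destruct (Rle_lt_or_eq_dec (- a) a) as [Haa|Haa]; [lra| |].
      * destruct (f_interv_is_interv phi (- a) a y Haa) as (x & Hx & Ex).
        -- rewrite Hopp. exact Hy.
        -- intros z Hz. apply derivable_continuous_pt. eexists. apply phi_derivable. lra.
        -- exists x. repeat split; try lra. intros Kx. apply HnY.
           rewrite <- Ex. now apply HY.
      * exists a. assert (Ea : a = 0) by lra.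
        assert (Ey : y = phi a).
        { rewrite Ea in *. enough (phi 0 = 0) by lra.
          unfold phi. replace (0 / 2) with 0 by field. rewrite tan_0. ring. }
        repeat split; try lra. intros Kx. apply HnY. rewrite Ey. now apply HY.
    + intros x x' y y' _ _ [Hx ->] [Hx' ->].
      assert (W : forall x x', - a <= x <= a -> - a <= x' <= a -> x' <= x ->
         Rabs (phi x - phi x') <= (1 + eps * half_sec2 a) * Rabs (x - x')).
      { clear x x' Hx Hx'. intros x x' Hx Hx' Hle.
        rewrite !Rabs_pos_eq; try lra.
        - apply phi_contract; lra.
        - generalize (Hinc x x' ltac:(lra) Hle ltac:(lra)). lra. }
      destruct (Rle_dec x' x) as [H1|H1]; [now apply W|].
      rewrite (Rabs_minus_sym x), (Rabs_minus_sym (phi x)). apply W; auto. lra. }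
assert (Ephi : phi a = L / 2 + eps * tan (L / 4)).
{ unfold phi, a. do 3 f_equal. field. }
lra.
Qed.

(** * The sharp lower bound *)

(** Greedy choice: the points of the circle too close to those already chosen, together with the two
    end pieces of [0, 2 pi], do not exhaust a set of measure [L0]. The end pieces are discarded
    because 0 and 2 pi are the same point of the circle. It matters that [c] does not depend on
    [A]. *)
Lemma separated_nodes N L0 : 0 < L0 -> exists c, 0 < c /\
  forall A : R -> Prop, (forall t, A t -> 0 <= t <= 2 * PI) -> L0 <= lebesgue_outer A ->
  exists p : nat -> R, (forall i, (i <= N)%nat -> A (p i)) /\
    forall i j, (i <= N)%nat -> (j <= N)%nat -> i <> j -> c <= Rabs (sin ((p i - p j) / 2)).
Proof.
intros HL. assert (HP := PI_RGT_0).
(* At most [2 * d + 2 * N * d] of the length is ever excluded, which is less than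
   [4 * (N + 2) * d <= L0]. *)
set (d := Rmin (PI / 2) (L0 / (4 * (INR N + 2)))).
assert (HN : 0 < INR N + 2) by (generalize (pos_INR N); lra).
assert (Hd : 0 < d).
{ apply Rmin_pos; [lra|]. apply Rdiv_lt_0_compat; lra. }
assert (Hd1 : d <= PI / 2) by apply Rmin_l.
assert (Hd2 : 4 * (INR N + 2) * d <= L0).
{ apply Rle_trans with (4 * (INR N + 2) * (L0 / (4 * (INR N + 2)))).
  - apply Rmult_le_compat_l; [lra|apply Rmin_r].
  - right. field. lra. }
exists (sin (d / 2)). split; [apply sin_gt_0; lra|].
intros A HA HLA.
assert (bA : segment_bounded A) by now exists 0, (2 * PI).
assert (near : forall t p, 0 <= t <= 2 * PI -> 0 <= p <= 2 * PI ->
   Rabs (sin ((t - p) / 2)) < sin (d / 2) ->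
   0 <= t <= d \/ 2 * PI - d <= t <= 2 * PI \/ p - d <= t <= p + d).
{ assert (W : forall x, 0 <= x <= PI -> Rabs (sin x) < sin (d / 2) -> x < d / 2 \/ PI - d / 2 < x).
  { intros x Hx Hs. rewrite Rabs_pos_eq in Hs by (apply sin_ge_0; lra).
    destruct (Rlt_le_dec x (d / 2)) as [H1|H1]; [now left|].
    destruct (Rlt_le_dec (PI - d / 2) x) as [H2|H2]; [now right|]. exfalso.
    destruct (Rle_dec x (PI / 2)) as [H3|H3].
    - generalize (sin_incr_1 (d / 2) x). lra.
    - rewrite <- sin_PI_x in Hs.
      generalize (sin_incr_1 (d / 2) (PI - x)). lra. }
  intros t p Ht Hp Hs.
  destruct (Rle_dec p t) as [H|H].
  - destruct (W ((t - p) / 2)); try lra.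
  - replace ((t - p) / 2) with (- ((p - t) / 2)) in Hs by field.
    rewrite sin_neg, Rabs_Ropp in Hs. destruct (W ((p - t) / 2)); try lra. }
assert (Hun : forall (p : nat -> R) k, segment_bounded (fun t => exists i, (i < k)%nat /\ p i - d
  <= t <= p i + d) /\
   lebesgue_outer (fun t => exists i, (i < k)%nat /\ p i - d <= t <= p i + d) <= 2 * INR k * d).
{ intros p. induction k as [|k [IHb IH]].
  - assert (Hno : forall t, ~ exists i, (i < 0)%nat /\ p i - d <= t <= p i + d).
    { intros t (i & Hi & _). lia. }
    split.
    + exists 0, 0. intros x Hx. now apply Hno in Hx.
    + simpl. apply Rle_trans with (0 - 0); [|lra].
      apply lebesgue_outer_le_itv; [lra|]. intros x Hx. now apply Hno in Hx.
  - assert (Hcov : forall t, (exists i, (i < S k)%nat /\ p i - d <= t <= p i + d) ->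
       (exists i, (i < k)%nat /\ p i - d <= t <= p i + d) \/ p k - d <= t <= p k + d).
    { intros t (i & Hi & Ht). destruct (Nat.eq_dec i k) as [->|]; [now right|].
      left. exists i. split; [lia|exact Ht]. }
    split.
    + destruct IHb as (a & b & IHb). exists (Rmin a (p k - d)), (Rmax b (p k + d)).
      intros t Ht. generalize (Rmin_l a (p k - d)) (Rmin_r a (p k - d))
        (Rmax_l b (p k + d)) (Rmax_r b (p k + d)).
      destruct (Hcov t Ht) as [H|H]; [apply IHb in H|]; lra.
    + eapply Rle_trans; [apply lebesgue_outer_sub with (2 := segment_bounded_itv (p k - d) (p k
      + d)); [exact IHb|exact Hcov]|].
      rewrite lebesgue_outer_itv by lra. rewrite S_INR. lra. }
assert (build : forall k, (k <= S N)%nat -> exists p : nat -> R, (forall i, (i < k)%nat -> A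
  (p i)) /\
    forall i j, (i < j < k)%nat -> sin (d / 2) <= Rabs (sin ((p j - p i) / 2))).
{ induction k as [|k IH]; intros Hk; [exists (fun _ => 0); split; intros; lia|].
  destruct IH as (p & Hp & Hs); [lia|].
  assert (ex : exists t, A t /\ forall i, (i < k)%nat -> sin (d / 2) <= Rabs (sin ((t - p i) / 2))).
  { apply NNPP. intros Hno.
    assert (lebesgue_outer A <= 2 * d + 2 * INR k * d).
    { destruct (Hun p k) as [Hb Hm].
      eapply Rle_trans; [apply (lebesgue_outer_sub A (fun t => 0 <= t <= d \/ 2 * PI - d <= t
        <= 2 * PI) _)
        with (2 := Hb)|].
      - exists 0, (2 * PI). intros x. intuition lra.
      - intros t At. destruct (classic (exists i, (i < k)%nat /\ Rabs (sin ((t - p i) / 2)) < sin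
        (d / 2))) as [(i & Hi & Ht)|Hn].
        + destruct (near t (p i)) as [H|[H|H]]; auto.
          right. now exists i.
        + exfalso. apply Hno. exists t. split; [exact At|]. intros i Hi.
          apply Rnot_lt_le. intros Hlt. apply Hn. now exists i.
      - apply Rplus_le_compat; [|exact Hm].
        eapply Rle_trans; [apply (lebesgue_outer_sub _ (fun t => 0 <= t <= d) (fun t => 2 * PI
          - d <= t <= 2 * PI)); auto|].
        rewrite !lebesgue_outer_itv by lra. lra. }
    assert (INR k <= INR N) by (apply le_INR; lia).
    assert (INR k * d <= INR N * d) by (apply Rmult_le_compat_r; lra).
    generalize (pos_INR N). intros. assert (0 <= INR N * d) by (apply Rmult_le_pos; lra). lra. }
  destruct ex as (t & At & Ht).
  exists (fun i => if Nat.eq_dec i k then t else p i). split.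
  - intros i Hi. destruct (Nat.eq_dec i k); [exact At|]. apply Hp. lia.
  - intros i j Hij. destruct (Nat.eq_dec i k); [lia|].
    destruct (Nat.eq_dec j k); [apply Ht|apply Hs]; lia. }
destruct (build (S N) (le_n _)) as (p & Hp & Hs). exists p. split.
- intros i Hi. apply Hp. lia.
- intros i j Hi Hj Hij. destruct (lt_dec i j) as [H|H].
  + replace ((p i - p j) / 2) with (- ((p j - p i) / 2)) by field.
    rewrite sin_neg, Rabs_Ropp. apply Hs. lia.
  + apply Hs. lia.
Qed.

(** A qualitative Remez inequality. The level 2 suffices for both applications: levels up to 1 in
    the lower bound, and levels up to [B + 1] with [B <= 1] in the construction of a best
    approximation. *)
Lemma mono_bound_measure m L0 : 0 < L0 -> exists B, forall T (A : R -> Prop), mono m T ->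
  (forall t, A t -> 0 <= t <= 2 * PI) -> L0 <= lebesgue_outer A ->
  (forall t, A t -> Rabs (T t) <= 2) -> forall t, Rabs (T t) <= B.
Proof.
intros HL. destruct (separated_nodes (2 * m) L0 HL) as (c & Hc & Hnodes).
exists (1 + INR (S (2 * m)) * ((1 + 2) * / c ^ (2 * m))).
intros T A HT HA HLA HTA t. destruct (Hnodes A HA HLA) as (p & Hp & Hs).
apply (mono_bound_nodes m p c Hc Hs); auto.
Qed.

(** * Level sets and their measure *)

Definition lev (T : R -> R) (M : R) (t : R) : Prop := Rabs (T t) <= M.
Definition meas (T : R -> R) (M : R) : R := mes_T (lev T M).

Lemma mono_TP m T : mono m T -> TP (S m) T.
Proof. apply TPlead_TP. Qed.

Lemma continuity_Rabs_comp f : continuity f -> continuity (fun t => Rabs (f t)).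
Proof. intros Hf x. apply (continuity_pt_comp f Rabs); [apply Hf|apply Rcontinuity_abs]. Qed.

Lemma lev_periodic m T M : TP m T -> periodic_set (lev T M).
Proof. intros H x. unfold lev. now rewrite (TP_periodic m T x H). Qed.

Lemma lev_closed m T M : TP m T -> closed_set (lev T M).
Proof.
intros H. apply closed_set_le, continuity_Rabs_comp. exact (TP_continuity m T H).
Qed.

(** The half-open period is not closed; adding its null endpoint produces closed sets, to which
    continuity from above applies. *)
Lemma mes_T_closed E : mes_T E = lebesgue_outer (fun x => 0 <= x <= 2 * PI /\ E x).
Proof.
apply Rle_antisym.
- apply lebesgue_outer_mono; auto. intros x. intuition lra.
- apply Rle_trans with (mes_T E + lebesgue_outer (fun x => 2 * PI <= x <= 2 * PI)).
  + apply lebesgue_outer_sub; auto.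
    * exists 0, (2 * PI). intros x. intuition lra.
    * intros x [H Ex]. destruct (Rlt_le_dec x (2 * PI)); [left; split; [exact Ex|lra]|right; lra].
  + rewrite lebesgue_outer_itv; lra.
Qed.

Lemma mes_T_bounds E : 0 <= mes_T E <= 2 * PI.
Proof.
generalize PI_RGT_0; intros HP. split.
- apply lebesgue_outer_ge0. exists 0, (2 * PI). intros x. intuition lra.
- replace (2 * PI) with (2 * PI - 0) by ring. apply lebesgue_outer_le_itv; [lra|].
  intros x. intuition lra.
Qed.

Lemma mes_T_mono (E F : R -> Prop) : (forall x, E x -> F x) -> mes_T E <= mes_T F.
Proof.
intros H. apply lebesgue_outer_mono.
- exists 0, (2 * PI). intros x. intuition lra.
- intros x [Ex Hx]. auto.
Qed.

Lemma mes_T_centered E c : periodic_set E -> ~ E (c + PI) ->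
  mes_T E = lebesgue_outer (fun x => - PI <= x <= PI /\ E (c + x)).
Proof.
intros HE Hc. rewrite <- (lebesgue_outer_window E (c - PI)) by exact HE.
rewrite <- (lebesgue_outer_isometry (window E (c - PI)) 1 c) by auto.
apply lebesgue_outer_ext.
- exists (- PI), PI. unfold window. intros x. intuition lra.
- intros x. unfold window. rewrite Rmult_1_l, (Rplus_comm x c). split.
  + intros [Ex Hx]. split; [lra|exact Ex].
  + intros [Hx Ex]. split; [exact Ex|]. split; [lra|].
    destruct (Req_dec x PI) as [->|]; [contradiction|lra].
Qed.

Lemma TP_lipschitz m f : TP m f ->
  exists B, 0 <= B /\ forall t u, Rabs (f u - f t) <= B * Rabs (u - t).
Proof.
intros Hf. destruct (TP_derivable m f Hf) as (f' & Hf' & D).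
destruct (TP_bounded m f' Hf') as [B HB]. exists B. split.
- apply Rle_trans with (Rabs (f' 0)); [apply Rabs_pos|apply HB].
- assert (W : forall t u, t < u -> Rabs (f u - f t) <= B * Rabs (u - t)).
  { intros t u Htu. destruct (MVT_cor2 f f' t u Htu) as (z & E & _); [intros; apply D|].
    rewrite E, Rabs_mult. apply Rmult_le_compat_r; [apply Rabs_pos|apply HB]. }
  intros t u. destruct (Rtotal_order t u) as [H|[->|H]].
  + now apply W.
  + rewrite !Rminus_diag, Rabs_R0. lra.
  + rewrite (Rabs_minus_sym (f u)), (Rabs_minus_sym u). now apply W.
Qed.

Lemma TP_taylor m f f' : TP m f -> TP m f' -> (forall t, derivable_pt_lim f t (f' t)) ->
  exists B, 0 <= B /\ forall t h, Rabs (f (t + h) - f t - h * f' t) <= B * (h * h).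
Proof.
intros Hf Hf' D. destruct (TP_lipschitz m f' Hf') as (B & HB & H). exists B.
split; [exact HB|]. intros t h.
assert (mv : exists z, f (t + h) - f t = f' z * h /\ Rabs (z - t) <= Rabs h).
{ destruct (Rtotal_order h 0) as [Hh|[->|Hh]].
  - destruct (MVT_cor2 f f' (t + h) t) as (z & E & Hz); [lra|intros; apply D|].
    exists z. split; [|rewrite !Rabs_left; lra].
    replace (f (t + h) - f t) with (- (f t - f (t + h))) by ring. rewrite E. ring.
  - exists t. rewrite Rplus_0_r, !Rminus_diag, Rabs_R0. split; lra.
  - destruct (MVT_cor2 f f' t (t + h)) as (z & E & Hz); [lra|intros; apply D|].
    exists z. split; [rewrite E; ring|rewrite !Rabs_right; lra]. }
destruct mv as (z & E & Hz). rewrite E.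
replace (f' z * h - h * f' t) with ((f' z - f' t) * h) by ring.
rewrite Rabs_mult. replace (h * h) with (Rabs h * Rabs h).
- rewrite <- Rmult_assoc. apply Rmult_le_compat_r; [apply Rabs_pos|].
  eapply Rle_trans; [apply H|]. apply Rmult_le_compat_l; auto.
- rewrite <- Rabs_mult. apply Rabs_pos_eq. nra.
Qed.

Lemma mono_derivable m T : mono m T -> exists T',
  TPlead m 0 (- INR (S m)) T' /\ forall t, derivable_pt_lim T t (T' t).
Proof.
intros H. destruct (TPlead_derivable m 1 0 T H) as (T' & HT' & D). exists T'.
split; [|exact D]. revert HT'. apply TPlead_coef; ring.
Qed.

(* The vector field cot((t - xi)/2) multiplies T' to a polynomial of order n because
   xi is critical; moving T along it scales the leading coefficient by 1 - n eps. *)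
Lemma perturb m T T' M xi : mono m T -> 0 < M ->
  TPlead m 0 (- INR (S m)) T' -> (forall t, derivable_pt_lim T t (T' t)) ->
  T' xi = 0 -> M < Rabs (T xi) ->
  let L := meas T M in
  L < 2 * PI /\ exists delta C eps0, 0 <= delta /\ 0 <= C /\ 0 < eps0 /\
    (0 < lebesgue_outer (fun x => (- PI <= x <= PI /\ lev T M (xi + PI + x)) /\
                           ~ (- (L / 2) <= x <= L / 2)) -> 0 < delta) /\
    forall eps, 0 < eps < eps0 -> exists T1, mono m T1 /\ eps * INR (S m) < 1 /\
      L + 2 * eps * tan (L / 4) + eps * delta <=
      meas T1 ((M + C * (eps * eps)) / (1 - eps * INR (S m))).
Proof.
intros HT HM HT' D Hxi HMxi L. assert (HP := PI_RGT_0).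
assert (PT := mono_TP m T HT).
assert (Hn : 0 < INR (S m)) by (apply lt_0_INR; lia).
set (c := xi + PI).
set (K := fun x => - PI <= x <= PI /\ lev T M (c + x)).
assert (Hc : ~ lev T M (c + PI)).
{ unfold lev, c. replace (xi + PI + PI) with (xi + 2 * PI) by ring.
  rewrite (TP_periodic _ T xi PT). lra. }
assert (EL : L = lebesgue_outer K).
{ apply mes_T_centered; [exact (lev_periodic _ T M PT)|exact Hc]. }
(* The level set avoids a neighbourhood of [xi], the pole of the vector field. *)
assert (Hd : exists d, 0 < d <= 1 /\ forall t, Rabs (t - xi) < d -> M < Rabs (T t)).
{ destruct (continuity_Rabs_comp T (TP_continuity _ T PT) xi (Rabs (T xi) - M)) as (d & Hd & H);
  [lra|].
  exists (Rmin d 1). split; [split; [apply Rmin_pos; lra|apply Rmin_r]|]. intros t Ht.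
  destruct (Req_dec xi t) as [<-|Hne]; [exact HMxi|].
  assert (Hk : Rabs (Rabs (T t) - Rabs (T xi)) < Rabs (T xi) - M).
  { apply H. split; [split; [exact I|exact Hne]|]. simpl. unfold Rdist.
    eapply Rlt_le_trans; [exact Ht|apply Rmin_l]. }
  generalize (Rle_abs (- (Rabs (T t) - Rabs (T xi)))). rewrite Rabs_Ropp. lra. }
destruct Hd as (d & Hd & Hnear).
assert (HK : forall x, K x -> - PI + d <= x <= PI - d).
{ intros x [Hx Hlev]. unfold lev in Hlev. split; apply Rnot_lt_le; intros Hlt.
  - assert (M < Rabs (T (c + x))); [|lra]. apply Hnear. unfold c.
    rewrite Rabs_pos_eq; lra.
  - assert (M < Rabs (T (c + x))); [|lra].
    replace (c + x) with (c + x - 2 * PI + 2 * PI) by ring. rewrite (TP_periodic _ T _ PT).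
    apply Hnear. unfold c. rewrite Rabs_left1; lra. }
assert (clK : closed_set K).
{ apply (closed_set_and (fun x => - PI <= x <= PI)).
  - apply closed_set_and; [apply closed_set_half_r|apply closed_set_half_l].
  - apply (closed_set_shift (lev T M)). exact (lev_closed _ T M PT). }
destruct (bathtub K d clK (proj1 Hd) HK) as (delta & Hdelta & Hdelta' & Hbath).
rewrite <- EL in Hdelta', Hbath.
destruct (TPlead_cot m _ _ T' xi HT' Hxi) as (g & Hg & Eg).
destruct (TP_taylor (S m) T T' PT (TPlead_TP _ _ _ _ HT') D) as (B2 & HB2 & H2).
destruct (TP_lipschitz (S m) g (TPlead_TP _ _ _ _ Hg)) as (B3 & HB3 & H3).
assert (HP1 := PI2_1).
set (tau := tan ((PI - d) / 2)).
assert (Htau : 0 < tau) by (apply tan_gt_0; lra).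
(* [tau] bounds |tan(x/2)| on [K]. The first term is the Taylor error of [T] under a displacement
   [eps * tan (x / 2)], the second the variation of [g] under the same displacement. *)
set (C := B2 * (tau * tau) + B3 * tau).
assert (HC : 0 <= C).
{ apply Rplus_le_le_0_compat; apply Rmult_le_pos; try lra. nra. }
split.
{ rewrite EL. apply Rle_lt_trans with (PI - d - (- PI + d)); [|lra].
  apply lebesgue_outer_le_itv; [lra|exact HK]. }
(* The first bound on [eps] keeps the leading coefficient [1 - eps * n] positive, the second keeps
   the displaced points in [[- PI, PI]]. *)
exists delta, C, (Rmin (/ INR (S m)) (d / tau)).
split; [exact Hdelta|]. split; [exact HC|]. split.
{ apply Rmin_pos; [now apply Rinv_0_lt_compat|]. apply Rdiv_lt_0_compat; lra. }
split; [exact Hdelta'|].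
intros eps [He He0].
assert (He1 : eps * INR (S m) < 1).
{ apply Rmult_lt_reg_r with (/ INR (S m)); [now apply Rinv_0_lt_compat|].
  rewrite Rmult_assoc, Rinv_r, Rmult_1_l, Rmult_1_r by lra.
  eapply Rlt_le_trans; [exact He0|apply Rmin_l]. }
assert (He2 : eps * tau < d).
{ apply Rmult_lt_reg_r with (/ tau); [now apply Rinv_0_lt_compat|].
  rewrite Rmult_assoc, Rinv_r, Rmult_1_r by lra.
  eapply Rlt_le_trans; [exact He0|apply Rmin_r]. }
set (q := 1 - eps * INR (S m)). assert (Hq : 0 < q) by (unfold q; lra).
set (S := fun t => 1 * T t + eps * g t).
set (M' := M + C * (eps * eps)).
exists (fun t => / q * S t + 0 * S t). split; [|split; [exact He1|]].
{ assert (HS := TPlead_lin m 1 eps _ _ _ _ T g HT Hg).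
  assert (HS' := TPlead_lin m (/ q) 0 _ _ _ _ S S HS HS).
  revert HS'. apply TPlead_coef; unfold q; [field; fold q; lra|ring]. }
assert (PS : TP (Datatypes.S m) S).
{ apply TP_lin; [exact PT|exact (TPlead_TP _ _ _ _ Hg)]. }
apply Rle_trans with (lebesgue_outer (fun y => - PI <= y <= PI /\ lev S M' (c + y))).
- apply Hbath; [exact He|auto|]. intros x Kx. assert (Hx := HK x Kx). destruct Kx as [_ Hlev].
  assert (Hcos : 0 < cos (x / 2)) by (apply cos_gt_0; lra).
  assert (Hu : Rabs (tan (x / 2)) <= tau).
  { unfold tau. apply Rabs_le. split.
    - rewrite <- tan_neg. destruct (Req_dec (x / 2) (- ((PI - d) / 2))) as [->|]; [lra|].
      left. apply tan_increasing; lra.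
    - destruct (Req_dec (x / 2) ((PI - d) / 2)) as [->|]; [lra|].
      left. apply tan_increasing; lra. }
  set (u := tan (x / 2)) in *.
  assert (Hu' : Rabs (eps * u) <= eps * tau).
  { rewrite Rabs_mult, (Rabs_pos_eq eps) by lra. apply Rmult_le_compat_l; lra. }
  split.
  + generalize (Rle_abs (eps * u)) (Rle_abs (- (eps * u))). rewrite Rabs_Ropp. lra.
  (* Measured from the point opposite to [xi], the half angle gains [PI / 2] and the cotangent
     becomes [- tan (x / 2)]. *)
  + assert (Egx : g (c + x) = - (T' (c + x) * u)).
    { specialize (Eg (c + x)).
      replace ((c + x - xi) / 2) with (x / 2 + PI / 2) in Eg by (unfold c; field).
      rewrite sin_plus, cos_plus, cos_PI2, sin_PI2 in Eg.
      unfold u, tan. apply Rmult_eq_reg_r with (cos (x / 2)); [|lra].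
      transitivity (- (T' (c + x) * sin (x / 2))); [|field; lra].
      rewrite !Rmult_0_r, !Rmult_1_r in Eg. lra. }
    unfold lev, S, M'. rewrite <- Rplus_assoc.
    (* The first-order changes cancel: the displacement adds [eps * u * T'] and the perturbation
       [eps * g] removes it. Only errors of order [eps * eps] remain. *)
    replace (1 * T (c + x + eps * u) + eps * g (c + x + eps * u)) with
      (T (c + x) + ((T (c + x + eps * u) - T (c + x) - eps * u * T' (c + x)) +
        eps * (g (c + x + eps * u) - g (c + x)))) by (rewrite Egx; ring).
    eapply Rle_trans; [apply Rabs_triang|]. apply Rplus_le_compat; [exact Hlev|].
    eapply Rle_trans; [apply Rabs_triang|].
    replace (C * (eps * eps)) with (B2 * ((eps * tau) * (eps * tau)) + eps * (B3 * (eps * tau)))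
      by (unfold C; ring).
    apply Rplus_le_compat.
    * eapply Rle_trans; [apply H2|]. apply Rmult_le_compat_l; [exact HB2|].
      replace (eps * u * (eps * u)) with (Rabs (eps * u) * Rabs (eps * u)).
      -- apply Rmult_le_compat; auto using Rabs_pos.
      -- rewrite <- Rabs_mult. apply Rabs_pos_eq. apply Rle_0_sqr.
    * rewrite Rabs_mult, (Rabs_pos_eq eps) by lra. apply Rmult_le_compat_l; [lra|].
      eapply Rle_trans; [apply H3|]. apply Rmult_le_compat_l; [exact HB3|].
      replace (c + x + eps * u - (c + x)) with (eps * u) by ring. exact Hu'.
- assert (Elev : forall t, lev S M' t <-> lev (fun t => / q * S t + 0 * S t) (M' / q) t).
  { intros t. unfold lev. replace (/ q * S t + 0 * S t) with (/ q * S t) by ring.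
    rewrite Rabs_mult, Rabs_inv, (Rabs_pos_eq q) by lra. unfold Rdiv.
    rewrite (Rmult_comm M'). split; intros H.
    - apply Rmult_le_compat_l; [left; now apply Rinv_0_lt_compat|exact H].
    - apply Rmult_le_reg_l with (/ q); [now apply Rinv_0_lt_compat|exact H]. }
  unfold meas. rewrite <- (lebesgue_outer_window _ (c - PI)).
  + rewrite <- (lebesgue_outer_isometry (window _ (c - PI)) 1 c) by auto.
    apply Rle_trans with (lebesgue_outer (fun x => window (lev (fun t => / q * S t + 0 * S t)
      (M' / q)) (c - PI) (1 * x + c)) +
       lebesgue_outer (fun x => PI <= x <= PI)).
    * apply lebesgue_outer_sub; auto.
      -- exists (- PI), PI. unfold window. intros x. intuition lra.
      -- intros x [Hx Hl]. destruct (Req_dec x PI) as [->|]; [right; lra|].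
         left. unfold window. rewrite Rmult_1_l, (Rplus_comm x c). split; [now apply Elev|lra].
    * rewrite lebesgue_outer_itv by lra. lra.
  + apply (lev_periodic (Datatypes.S m)). now apply TP_lin.
Qed.

(** * First-order growth of the functional along the flow *)

Lemma derivable_pt_lim_incr q D : derivable_pt_lim q 0 D -> 0 < D ->
  exists d, 0 < d /\ forall h, 0 < h < d -> q 0 < q h.
Proof.
intros H HD. destruct (H D HD) as [d Hd]. exists d. split; [apply cond_pos|].
intros h Hh. specialize (Hd h ltac:(lra)). rewrite (Rabs_pos_eq h) in Hd by lra.
specialize (Hd (proj2 Hh)). rewrite Rplus_0_l in Hd.
assert (K : 0 < (q h - q 0) / h).
{ generalize (Rle_abs (- ((q h - q 0) / h - D))). rewrite Rabs_Ropp. lra. }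
assert (K' : 0 < (q h - q 0) / h * h) by (apply Rmult_lt_0_compat; lra).
replace ((q h - q 0) / h * h) with (q h - q 0) in K' by (field; lra). lra.
Qed.

Lemma derivable_pt_lim_affine u v x : derivable_pt_lim (fun e => u + v * e) x v.
Proof.
assert (H := derivable_pt_lim_plus (fct_cte u) (mult_real_fct v id) x 0 (v * 1)
  (derivable_pt_lim_const u x) (derivable_pt_lim_scal id v x 1 (derivable_pt_lim_id x))).
rewrite Rmult_1_r, Rplus_0_l in H. exact H.
Qed.

(** The function differentiated is a lower bound for [Phi] after the step e: [a + b * e] bounds a
    quarter of the new measure from below, and (M + C e^2)/(1 - n e) is the new level. The quadratic
    term does not contribute at 0. *)
Lemma gain_derivative n a b M C theta : 0 < sin a -> 0 < M ->
  derivable_pt_lim (fun e => 2 * n * ln (sin (a + b * e)) -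
     theta * (ln (M + C * (e * e)) - ln (1 + - n * e))) 0
   (2 * n * (b * cos a / sin a) - theta * n).
Proof.
intros Ha HM.
assert (H1 : derivable_pt_lim (fun e => ln (sin (a + b * e))) 0 (/ sin a * (cos a * b))).
{ enough (H : derivable_pt_lim (fun e => ln (sin (a + b * e))) 0
    (/ sin (a + b * 0) * (cos (a + b * 0) * b))) by (rewrite Rmult_0_r, Rplus_0_r in H; exact H).
  apply (derivable_pt_lim_comp (fun e => sin (a + b * e)) ln).
  - apply (derivable_pt_lim_comp (fun e => a + b * e) sin);
      [apply derivable_pt_lim_affine|apply derivable_pt_lim_sin].
  - apply derivable_pt_lim_ln. now rewrite Rmult_0_r, Rplus_0_r. }
assert (H2 : derivable_pt_lim (fun e => M + C * (e * e)) 0 0).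
{ assert (H := derivable_pt_lim_plus (fct_cte M) (mult_real_fct C (id * id)%F) 0 0
    (C * (1 * id 0 + id 0 * 1)) (derivable_pt_lim_const M 0)
    (derivable_pt_lim_scal _ C 0 _ (derivable_pt_lim_mult id id 0 1 1
       (derivable_pt_lim_id 0) (derivable_pt_lim_id 0)))).
  replace (0 + C * (1 * id 0 + id 0 * 1)) with 0 in H by (unfold id; ring). exact H. }
assert (H3 : derivable_pt_lim (fun e => ln (M + C * (e * e))) 0 (/ M * 0)).
{ enough (H : derivable_pt_lim (fun e => ln (M + C * (e * e))) 0 (/ (M + C * (0 * 0)) * 0))
    by (replace (M + C * (0 * 0)) with M in H by ring; exact H).
  apply (derivable_pt_lim_comp (fun e => M + C * (e * e)) ln); [exact H2|].
  apply derivable_pt_lim_ln. lra. }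
assert (H4 : derivable_pt_lim (fun e => ln (1 + - n * e)) 0 (/ 1 * - n)).
{ enough (H : derivable_pt_lim (fun e => ln (1 + - n * e)) 0 (/ (1 + - n * 0) * - n))
    by (rewrite Rmult_0_r, Rplus_0_r in H; exact H).
  apply (derivable_pt_lim_comp (fun e => 1 + - n * e) ln); [apply derivable_pt_lim_affine|].
  apply derivable_pt_lim_ln. lra. }
replace (2 * n * (b * cos a / sin a) - theta * n) with
  (2 * n * (/ sin a * (cos a * b)) - theta * (/ M * 0 - / 1 * - n)) by (field; lra).
apply (derivable_pt_lim_minus (fun e => 2 * n * ln (sin (a + b * e)))
  (fun e => theta * (ln (M + C * (e * e)) - ln (1 + - n * e)))).
- now apply (derivable_pt_lim_scal (fun e => ln (sin (a + b * e)))).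
- apply (derivable_pt_lim_scal (fun e => ln (M + C * (e * e)) - ln (1 + - n * e))).
  now apply (derivable_pt_lim_minus (fun e => ln (M + C * (e * e))) (fun e => ln (1 + - n * e))).
Qed.

Lemma ln_sin_le x y : 0 < x -> x <= y -> y <= PI / 2 ->
  0 < sin x /\ ln (sin x) <= ln (sin y) /\ ln (sin y) <= 0.
Proof.
intros Hx Hxy Hy. assert (HP := PI_RGT_0).
assert (Hsx : 0 < sin x) by (apply sin_gt_0; lra).
assert (Hle : sin x <= sin y) by (apply sin_incr_1; lra).
assert (le_ln : forall u v, 0 < u -> u <= v -> ln u <= ln v).
{ intros u v Hu [Huv|<-]; [left; now apply ln_increasing|lra]. }
split; [exact Hsx|]. split; [now apply le_ln|].
rewrite <- ln_1. apply le_ln; [lra|]. apply SIN_bound.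
Qed.

Definition Phi (m : nat) (theta : R) (T : R -> R) (M : R) : R :=
  2 * INR (S m) * ln (sin (meas T M / 4)) - theta * ln M.

Lemma improve m T T' M xi theta eta : mono m T -> 0 < M ->
  TPlead m 0 (- INR (S m)) T' -> (forall t, derivable_pt_lim T t (T' t)) ->
  T' xi = 0 -> M < Rabs (T xi) -> 0 < meas T M -> 0 < theta <= 1 ->
  (theta < 1 \/ 0 < lebesgue_outer (fun x => (- PI <= x <= PI /\ lev T M (xi + PI + x)) /\
                           ~ (- (meas T M / 2) <= x <= meas T M / 2))) ->
  0 < eta ->
  exists T1 M1, mono m T1 /\ M <= M1 <= M + eta /\ 0 < meas T1 M1 /\
    Phi m theta T M < Phi m theta T1 M1.
Proof.
intros HT HM HT' D Hxi HMxi HL Hth Hor Heta. assert (HP := PI_RGT_0).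
destruct (perturb m T T' M xi HT HM HT' D Hxi HMxi)
  as (HL2 & delta & C & eps0 & Hdelta & HC & He0 & Hpos & Hpert).
set (L := meas T M) in *. set (n := INR (S m)) in *.
assert (Hn : 0 < n) by (apply lt_0_INR; lia).
set (a := L / 4). assert (Ha : 0 < a < PI / 2) by (unfold a; lra).
assert (Hsa : 0 < sin a) by (apply sin_gt_0; lra).
assert (Hca : 0 < cos a) by (apply cos_gt_0; lra).
(* A quarter of the growth rate [2 * tan (L / 4) + delta] of the measure. *)
set (b := tan a / 2 + delta / 4).
assert (HD : 0 < 2 * n * (b * cos a / sin a) - theta * n).
{ replace (2 * n * (b * cos a / sin a) - theta * n) with
    (n * (1 - theta) + n * (delta * (cos a / sin a)) / 2) by (unfold b, tan; field; lra).
  assert (Hcot : 0 < cos a / sin a) by now apply Rdiv_lt_0_compat.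
  destruct Hor as [Hth1|Hpos1].
  - assert (0 < n * (1 - theta)) by (apply Rmult_lt_0_compat; lra).
    assert (0 <= n * (delta * (cos a / sin a))) by (apply Rmult_le_pos;
      [|apply Rmult_le_pos]; lra). lra.
  - specialize (Hpos Hpos1).
    assert (0 <= n * (1 - theta)) by (apply Rmult_le_pos; lra).
    assert (0 < n * (delta * (cos a / sin a))) by (apply Rmult_lt_0_compat;
      [|apply Rmult_lt_0_compat]; lra). lra. }
destruct (derivable_pt_lim_incr _ _ (gain_derivative n a b M C theta Hsa HM) HD) as (d & Hd & Hinc).
(* For [eps <= 1], [M1 <= M + eta] follows from [eps * (C + n * (M + eta)) <= eta]. *)
set (k := eta / (C + n * (M + eta))).
assert (HCk : 0 < C + n * (M + eta)).
{ assert (0 < n * (M + eta)) by (apply Rmult_lt_0_compat; lra). lra. }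
assert (Hk : 0 < k) by now apply Rdiv_lt_0_compat.
set (eps := Rmin (Rmin d eps0) (Rmin k 1) / 2).
assert (He : 0 < eps /\ eps < d /\ eps < eps0 /\ eps <= k /\ eps <= 1).
{ unfold eps. generalize (Rmin_l (Rmin d eps0) (Rmin k 1)) (Rmin_r (Rmin d eps0) (Rmin k 1))
    (Rmin_l d eps0) (Rmin_r d eps0) (Rmin_l k 1) (Rmin_r k 1).
  assert (0 < Rmin (Rmin d eps0) (Rmin k 1)) by (repeat apply Rmin_pos; lra). lra. }
destruct He as (He & Hed & Hee & Hek & He1).
destruct (Hpert eps (conj He Hee)) as (T1 & HT1 & Hen & Hm1). fold n in Hen, Hm1.
set (q := 1 - eps * n) in *. assert (Hq : 0 < q <= 1).
{ unfold q. assert (0 < eps * n) by now apply Rmult_lt_0_compat. lra. }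
set (M1 := (M + C * (eps * eps)) / q) in *.
assert (HCe : 0 <= C * (eps * eps)) by (apply Rmult_le_pos; [lra|nra]).
assert (HMq : M1 * q = M + C * (eps * eps)) by (unfold M1; field; lra).
assert (HMM1 : M <= M1).
{ apply Rmult_le_reg_r with q; [lra|]. rewrite HMq. nra. }
exists T1, M1. split; [exact HT1|]. split; [split; [exact HMM1|]|].
{ apply Rmult_le_reg_r with q; [lra|]. rewrite HMq. unfold q.
  assert (eps * (C + n * (M + eta)) <= eta).
  { apply Rle_trans with (k * (C + n * (M + eta))); [apply Rmult_le_compat_r; lra|].
    right. unfold k. field. lra. }
  assert (C * (eps * eps) <= C * eps) by (apply Rmult_le_compat_l; nra). nra. }
replace (L / 4) with a in Hm1 by reflexivity.
assert (Hab : a + b * eps <= meas T1 M1 / 4) by (unfold b, a in *; lra).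
assert (Hbe : 0 <= b * eps).
{ apply Rmult_le_pos; [|lra]. unfold b.
  assert (0 < tan a) by (apply tan_gt_0; lra). lra. }
split; [lra|]. unfold Phi. fold L n.
assert (Hln : 2 * n * ln (sin (a + b * eps)) <= 2 * n * ln (sin (meas T1 M1 / 4))).
{ apply Rmult_le_compat_l; [lra|]. apply ln_sin_le; try lra.
  generalize (mes_T_bounds (lev T1 M1)). unfold meas. lra. }
assert (Hlm : ln M1 = ln (M + C * (eps * eps)) - ln (1 + - n * eps)).
{ replace (1 + - n * eps) with q by (unfold q; ring).
  unfold M1, Rdiv. rewrite ln_mult, ln_Rinv; try lra. now apply Rinv_0_lt_compat. }
specialize (Hinc eps (conj He Hed)).
replace (a + b * 0) with a in Hinc by ring.
replace (M + C * (0 * 0)) with M in Hinc by ring.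
replace (1 + - n * 0) with 1 in Hinc by ring. rewrite ln_1, Rminus_0_r in Hinc.
fold a. rewrite Hlm. lra.
Qed.

Lemma max_critical m T T' : TP m T -> (forall t, derivable_pt_lim T t (T' t)) ->
  forall a b xi, a < xi < b -> (forall t, a < t < b -> Rabs (T t) <= Rabs (T xi)) ->
  T xi <> 0 -> T' xi = 0.
Proof.
intros HT D a b xi Hxi Hmax Hne.
(* The square is differentiable and has its maxima where |T| has them. *)
assert (D2 : derivable_pt_lim (T * T)%F xi (T' xi * T xi + T xi * T' xi))
  by (apply derivable_pt_lim_mult; apply D).
assert (pr : derivable_pt (T * T)%F xi) by (eexists; exact D2).
assert (E := deriv_maximum (T * T)%F a b xi pr (proj1 Hxi) (proj2 Hxi)).
rewrite (derive_pt_eq_0 _ _ _ pr D2) in E.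
assert (H : T' xi * T xi + T xi * T' xi = 0).
{ apply E. intros x Hx Hx'. unfold mult_fct. specialize (Hmax x (conj Hx Hx')).
  apply Rsqr_le_abs_1 in Hmax. exact Hmax. }
assert (H' : T xi * T' xi = 0) by lra.
destruct (Rmult_integral _ _ H'); [contradiction|assumption].
Qed.

Lemma global_max m T : TP m T -> exists xi, forall t, Rabs (T t) <= Rabs (T xi).
Proof.
intros HT. assert (HP := PI_RGT_0).
destruct (continuity_ab_maj (fun t => Rabs (T t)) 0 (2 * PI)) as (xi & Hmax & Hxi).
- lra.
- intros c _. apply continuity_Rabs_comp. exact (TP_continuity m T HT).
- exists xi. intros t.
  assert (shift : forall N x, T (x + INR N * (2 * PI)) = T x).
  { induction N as [|N IH]; intros x.
    - f_equal. simpl. ring.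
    - rewrite <- (IH x), <- (TP_periodic m T (x + INR N * (2 * PI)) HT).
      f_equal. rewrite S_INR. ring. }
  assert (pos : forall x, 0 <= x -> Rabs (T x) <= Rabs (T xi)).
  { intros x Hx. destruct (euclidian_division x (2 * PI)) as (k & r & Ex & Hr & Hr'); [lra|].
    rewrite Rabs_pos_eq in Hr' by lra.
    assert (Hk : (-1 < k)%Z).
    { apply lt_IZR. apply Rmult_lt_reg_r with (2 * PI); [lra|]. lra. }
    replace x with (r + INR (Z.to_nat k) * (2 * PI)).
    - rewrite shift. apply Hmax. lra.
    - rewrite INR_IZR_INZ, Z2Nat.id by lia. lra. }
  destruct (INR_archimed (2 * PI) (- t)) as [N HN]; [lra|].
  rewrite <- (shift N t). apply pos. lra.
Qed.

Lemma mono_critical m T : mono m T -> exists T' xi,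
  TPlead m 0 (- INR (S m)) T' /\ (forall t, derivable_pt_lim T t (T' t)) /\
  T' xi = 0 /\ 1 <= Rabs (T xi).
Proof.
intros HT. assert (PT := mono_TP m T HT).
destruct (mono_derivable m T HT) as (T' & HT' & D).
destruct (global_max _ T PT) as (xi & Hxi). destruct (mono_large m T HT) as (t & Ht).
specialize (Hxi t) as Hxt.
exists T', xi. split; [exact HT'|]. split; [exact D|]. split; [|lra].
apply (max_critical _ T T' PT D (xi - 1) (xi + 1)); [lra|auto|].
intros E. rewrite E, Rabs_R0 in Hxt. lra.
Qed.

(** * Limits of level sets *)

Lemma meas_right_continuous m T M : TP m T ->
  Un_cv (fun i => meas T (M + / INR (S i))) (meas T M).
Proof.
intros HT. unfold meas. rewrite mes_T_closed.
assert (pos : forall i, 0 < / INR (S i)) by (intros i; apply Rinv_0_lt_compat, lt_0_INR; lia).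
assert (H := lebesgue_outer_decr (fun i x => 0 <= x <= 2 * PI /\ lev T (M + / INR (S i)) x)).
assert (E : lebesgue_outer (fun x => forall i, 0 <= x <= 2 * PI /\ lev T (M + / INR (S i)) x) =
            lebesgue_outer (fun x => 0 <= x <= 2 * PI /\ lev T M x)).
{ apply lebesgue_outer_ext.
  - exists 0, (2 * PI). intros x Hx. apply (Hx 0%nat).
  - intros x. split.
    + intros Hx. split; [apply (Hx 0%nat)|]. unfold lev. apply Rnot_lt_le. intros Hlt.
      destruct (archimed_cor1 (Rabs (T x) - M)) as (N & HN & HN0); [lra|].
      destruct (Hx (pred N)) as [_ Hl]. unfold lev in Hl.
      replace (S (pred N)) with N in Hl by lia. lra.
    + intros [Hx Hl] i. split; [exact Hx|]. unfold lev in *. specialize (pos i). lra. }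
cbv beta in H. rewrite E in H.
intros eps He. destruct (fun a b c => H a b c eps He) as (N & HN).
- intros i. apply closed_set_and; [apply closed_set_and;
  [apply closed_set_half_r|apply closed_set_half_l]|].
  exact (lev_closed m T _ HT).
- auto.
- intros i x [Hx Hl]. split; [exact Hx|]. unfold lev in *.
  assert (/ INR (S (S i)) <= / INR (S i)); [|lra].
  apply Rinv_le_contravar; [apply lt_0_INR; lia|apply le_INR; lia].
- exists N. intros i Hi. rewrite mes_T_closed. now apply HN.
Qed.

Lemma Un_cv_le_eventually u l c : Un_cv u l ->
  (exists N, forall j, (N <= j)%nat -> u j <= c) -> l <= c.
Proof.
intros Hu (N & HN). apply Rnot_lt_le. intros Hlt.
destruct (Hu (l - c)) as (N' & HN'); [lra|].
specialize (HN' (Nat.max N N') ltac:(lia)). specialize (HN (Nat.max N N') ltac:(lia)).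
unfold Rdist in HN'. generalize (Rle_abs (- (u (Nat.max N N') - l))). rewrite Rabs_Ropp. lra.
Qed.

Lemma Un_cv_ge_eventually u l c : Un_cv u l ->
  (exists N, forall j, (N <= j)%nat -> c <= u j) -> c <= l.
Proof.
intros Hu (N & HN). apply Rnot_lt_le. intros Hlt.
destruct (Hu (c - l)) as (N' & HN'); [lra|].
specialize (HN' (Nat.max N N') ltac:(lia)). specialize (HN (Nat.max N N') ltac:(lia)).
unfold Rdist in HN'. generalize (Rle_abs (u (Nat.max N N') - l)). lra.
Qed.

Lemma inv_INR_cv (c : R) : Un_cv (fun j => c / INR (S j)) 0.
Proof.
intros eps He. destruct (INR_archimed eps (Rabs c)) as [N HN]; [lra|].
exists N. intros j Hj. unfold Rdist. rewrite Rminus_0_r.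
assert (Hp : 0 < INR (S j)) by (apply lt_0_INR; lia).
unfold Rdiv. rewrite Rabs_mult, Rabs_inv, (Rabs_pos_eq (INR (S j))) by lra.
apply Rmult_lt_reg_r with (INR (S j)); [exact Hp|].
rewrite Rmult_assoc, Rinv_l, Rmult_1_r by lra.
eapply Rlt_le_trans; [exact HN|]. rewrite (Rmult_comm eps).
apply Rmult_le_compat_r; [lra|]. apply le_INR. lia.
Qed.

Lemma sin_le_id x : 0 <= x -> sin x <= x.
Proof. intros [H|<-]; [left; now apply sin_lt_x|rewrite sin_0; lra]. Qed.

(** For large j the level set of [Tj j] lies in that of [T] at a slightly higher level. Together
    with right continuity in the level this is upper semicontinuity of the measure, the direction
    required because [Phi] increases with the measure. *)
Lemma meas_limit m (Tj : nat -> R -> R) T (Mj : nat -> R) M : TP m T ->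
  (forall e, 0 < e -> exists N, forall j, (N <= j)%nat -> forall t, Rabs (Tj j t - T t) <= e) ->
  Un_cv Mj M ->
  forall i, exists N, forall j, (N <= j)%nat -> meas (Tj j) (Mj j) <= meas T (M + / INR (S i)).
Proof.
intros HT Hunif HM i.
assert (pos : 0 < / INR (S i) / 2).
{ assert (0 < / INR (S i)) by (apply Rinv_0_lt_compat, lt_0_INR; lia). lra. }
destruct (Hunif _ pos) as (N1 & HN1). destruct (HM _ pos) as (N2 & HN2).
exists (Nat.max N1 N2). intros j Hj. apply mes_T_mono. intros x Hx. unfold lev in *.
specialize (HN1 j ltac:(lia) x). specialize (HN2 j ltac:(lia)). unfold Rdist in HN2.
generalize (Rle_abs (Mj j - M)). intros H.
replace (T x) with (Tj j x + - (Tj j x - T x)) by ring.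
eapply Rle_trans; [apply Rabs_triang|]. rewrite Rabs_Ropp. lra.
Qed.

Lemma ln_cv u l : 0 < l -> Un_cv u l -> Un_cv (fun j => ln (u j)) (ln l).
Proof.
intros Hl Hu. apply (continuity_seq ln); [|exact Hu].
apply derivable_continuous_pt. exists (/ l). now apply derivable_pt_lim_ln.
Qed.

(* With an exponent theta < 1 on M the first-order gain is strict for every
   competitor, so the functional Phi has no maximiser with M < 1. *)
Lemma mono_lower_bound m T M : mono m T -> 0 < M ->
  sin (meas T M / 4) ^ (2 * S m) <= M.
Proof.
intros HT HM. apply Rnot_lt_le. intros Hlt.
assert (HP := PI_RGT_0).
set (n := INR (S m)). assert (Hn : 0 < n) by (apply lt_0_INR; lia).
set (L := meas T M) in *.
assert (HL : 0 <= L <= 2 * PI) by apply mes_T_bounds.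
assert (Hs : 0 <= sin (L / 4)) by (apply sin_ge_0; lra).
assert (HL0 : 0 < L).
{ destruct (Rle_lt_or_eq_dec 0 L (proj1 HL)) as [H|H]; [exact H|exfalso].
  rewrite <- H in Hlt. replace (0 / 4) with 0 in Hlt by field.
  rewrite sin_0, pow_i in Hlt by lia. lra. }
destruct (ln_sin_le (L / 4) (L / 4)) as (Hs0 & _ & Hln); try lra.
set (sg := 2 * n * ln (sin (L / 4))).
assert (Hsg : sg <= 0).
{ unfold sg. assert (0 <= n * - ln (sin (L / 4))) by (apply Rmult_le_pos; lra). lra. }
assert (Hlnp : ln (sin (L / 4) ^ (2 * S m)) = sg).
{ rewrite ln_pow by exact Hs0. unfold sg, n. rewrite mult_INR. simpl (INR 2). ring. }
assert (HlnM : ln M < sg) by (rewrite <- Hlnp; now apply ln_increasing).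
(* Halfway between [sg / ln M] and 1: below 1, and yet the supposed counterexample keeps the
   positive value [(sg - ln M) / 2] of [Phi]. *)
set (theta := (1 + sg / ln M) / 2).
assert (Hr : 0 <= sg / ln M < 1).
{ assert (0 < / - ln M) by (apply Rinv_0_lt_compat; lra).
  replace (sg / ln M) with (- sg * / - ln M) by (field; lra). split.
  - apply Rmult_le_pos; lra.
  - apply Rmult_lt_reg_r with (- ln M); [lra|].
    rewrite Rmult_assoc, Rinv_l by lra. lra. }
assert (Hth : 0 < theta < 1) by (unfold theta; lra).
assert (HPhi0 : 0 < Phi m theta T M).
{ unfold Phi. fold n L sg. unfold theta.
  replace (sg - (1 + sg / ln M) / 2 * ln M) with ((sg - ln M) / 2) by (field; lra). lra. }
set (P0 := Phi m theta T M) in *.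
set (V := fun v => exists T' M', mono m T' /\ M <= M' <= 1 /\ 0 < meas T' M' /\ v
  = Phi m theta T' M').
assert (le_ln : forall u v, 0 < u -> u <= v -> ln u <= ln v).
{ intros u v Hu [Huv|<-]; [left; now apply ln_increasing|lra]. }
assert (HM1 : M <= 1).
{ left. apply ln_lt_inv; [lra|lra|rewrite ln_1; lra]. }
assert (Hsn : forall T' M', 0 < meas T' M' -> 2 * n * ln (sin (meas T' M' / 4)) <= 0).
{ intros T' M' H. generalize (mes_T_bounds (lev T' M')). fold (meas T' M'). intros Hb.
  destruct (ln_sin_le (meas T' M' / 4) (meas T' M' / 4)) as (_ & _ & H'); try lra.
  assert (0 <= n * - ln (sin (meas T' M' / 4))) by (apply Rmult_le_pos; lra). lra. }
assert (Vb : bound V).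
{ exists (- theta * ln M). intros v (T' & M' & _ & HM' & Hm' & ->). unfold Phi. fold n.
  specialize (Hsn T' M' Hm').
  assert (theta * ln M <= theta * ln M') by (apply Rmult_le_compat_l;
    [lra|apply le_ln; lra]). lra. }
destruct (completeness V Vb) as [v [Hv Hv']].
{ exists P0, T, M. repeat split; auto; lra. }
assert (HPv : P0 <= v).
{ apply Hv. exists T, M. repeat split; auto; lra. }
(* The tolerance never exceeds [P0 <= v], so [Phi] is positive along the whole maximising
   sequence. *)
assert (approx : forall j : nat, exists p : (R -> R) * R, mono m (fst p) /\ M <= snd p <= 1 /\
   0 < meas (fst p) (snd p) /\ v - P0 / INR (S j) < Phi m theta (fst p) (snd p)).
{ intros j. apply NNPP. intros Hno.
  assert (0 < P0 / INR (S j)) by (apply Rdiv_lt_0_compat; [lra|apply lt_0_INR; lia]).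
  assert (v <= v - P0 / INR (S j)); [|lra].
  apply Hv'. intros w (T' & M' & HT' & HM' & Hm' & ->).
  apply Rnot_lt_le. intros Hw. apply Hno. now exists (T', M'). }
set (F := fun j => proj1_sig (constructive_indefinite_description _ (approx j))).
assert (HF : forall j, mono m (fst (F j)) /\ M <= snd (F j) <= 1 /\
   0 < meas (fst (F j)) (snd (F j)) /\ v - P0 / INR (S j) < Phi m theta (fst (F j)) (snd (F j))).
{ intros j. exact (proj2_sig (constructive_indefinite_description _ (approx j))). }
(* Since [Phi] is positive and the levels are at least [M], sin(x/4) exceeds [sigma] for every
   measure x in the sequence. This is the uniform bound from below on which compactness rests. *)
set (sigma := exp (theta * ln M / (2 * n))).
assert (Hsigma : 0 < sigma) by apply exp_pos.
assert (Hlow : forall j, 4 * sigma <= meas (fst (F j)) (snd (F j))).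
{ intros j. destruct (HF j) as (_ & HMj & Hmj & HPj).
  set (x := meas (fst (F j)) (snd (F j))) in *.
  assert (Hx : x <= 2 * PI) by apply mes_T_bounds.
  assert (P0 / INR (S j) <= P0).
  { unfold Rdiv. rewrite <- (Rmult_1_r P0) at 2. apply Rmult_le_compat_l; [lra|].
    rewrite <- Rinv_1. apply Rinv_le_contravar; [lra|]. change 1 with (INR 1). apply le_INR. lia. }
  assert (Hsx : 0 < sin (x / 4)) by (apply sin_gt_0; lra).
  assert (Hl : theta * ln M < 2 * n * ln (sin (x / 4))).
  { unfold Phi in HPj. fold n x in HPj.
    assert (theta * ln M <= theta * ln (snd (F j))) by (apply Rmult_le_compat_l;
      [lra|apply le_ln; lra]).
    lra. }
  assert (Hl' : theta * ln M / (2 * n) < ln (sin (x / 4))).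
  { apply Rmult_lt_reg_l with (2 * n); [lra|].
    replace (2 * n * (theta * ln M / (2 * n))) with (theta * ln M) by (field; lra). exact Hl. }
  apply exp_increasing in Hl'. rewrite exp_ln in Hl' by exact Hsx. fold sigma in Hl'.
  generalize (sin_le_id (x / 4)). lra. }
destruct (mono_bound_measure m (4 * sigma)) as (B & HB); [lra|].
assert (HTB : forall j t, Rabs (fst (F j) t) <= B).
{ intros j. destruct (HF j) as (HTj & HMj & _ & _).
  apply (HB _ (fun x => 0 <= x <= 2 * PI /\ lev (fst (F j)) (snd (F j)) x) HTj).
  - intros t [Ht _]. exact Ht.
  - rewrite <- mes_T_closed. apply Hlow.
  - intros t [_ Ht]. unfold lev in Ht. lra. }
destruct (mono_compact m (fun j => fst (F j)) B) as (phi & T0 & Hphi & HT0 & Hunif);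
  [apply HF|exact HTB|].
destruct (bolzano_weierstrass (fun j => snd (F (phi j))) 1) as (psi & Hpsi & M0 & HM0).
{ intros j. destruct (HF (phi j)) as (_ & HMj & _). apply Rabs_le. lra. }
set (chi := fun j => phi (psi j)).
assert (Hchi : extraction chi) by exact (extraction_comp phi psi Hphi Hpsi).
assert (Hunif' : forall e, 0 < e -> exists N, forall j, (N <= j)%nat ->
   forall t, Rabs (fst (F (chi j)) t - T0 t) <= e).
{ intros e He. destruct (Hunif e He) as (N & HN). exists N. intros j Hj. apply HN.
  generalize (extraction_ge psi j Hpsi). lia. }
assert (HM0b : M <= M0 <= 1).
{ split.
  - apply (Un_cv_ge_eventually _ _ _ HM0). exists 0%nat. intros j _. apply HF.
  - apply (Un_cv_le_eventually _ _ _ HM0). exists 0%nat. intros j _. apply HF. }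
assert (PT0 := mono_TP m T0 HT0).
assert (Hlim := meas_limit (S m) (fun j => fst (F (chi j))) T0 (fun j => snd (F
  (chi j))) M0 PT0 Hunif' HM0).
set (G := fun x => 2 * n * ln (sin (x / 4))).
assert (HA : forall i, 4 * sigma <= meas T0 (M0 + / INR (S i)) /\
   v + theta * ln M0 <= G (meas T0 (M0 + / INR (S i)))).
{ intros i. destruct (Hlim i) as (N & HN). split.
  - eapply Rle_trans; [apply (Hlow (chi N))|]. apply HN. lia.
  - apply (Un_cv_le_eventually (fun j => v - P0 / INR (S (chi j)) + theta * ln (snd (F (chi j))))).
    + replace (v + theta * ln M0) with (v - 0 + theta * ln M0) by ring.
      apply CV_plus; [apply CV_minus|].
      * intros e He. exists 0%nat. intros. unfold Rdist. rewrite Rminus_diag, Rabs_R0. lra.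
      * apply (Un_cv_extraction (fun j => P0 / INR (S j)) 0 chi Hchi), inv_INR_cv.
      * apply (CV_mult (fun _ => theta) (fun j => ln (snd (F (chi j))))).
        -- intros e He. exists 0%nat. intros. unfold Rdist. rewrite Rminus_diag, Rabs_R0. lra.
        -- apply ln_cv; [lra|exact HM0].
    + exists N. intros j Hj. specialize (HN j Hj). destruct (HF (chi j)) as (_ & _ & Hmj & HPj).
      unfold Phi in HPj. fold n in HPj.
      assert (G (meas (fst (F (chi j))) (snd (F (chi j)))) <= G (meas T0 (M0 + / INR (S i)))).
      { apply Rmult_le_compat_l; [lra|]. apply ln_sin_le; try lra.
        generalize (mes_T_bounds (lev T0 (M0 + / INR (S i)))). fold (meas T0 (M0 + / INR
          (S i))). lra. }
      unfold G in *. lra. }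
assert (Hcv := meas_right_continuous (S m) T0 M0 PT0).
set (L0 := meas T0 M0) in *.
assert (HL0b : 4 * sigma <= L0).
{ apply (Un_cv_ge_eventually _ _ _ Hcv). exists 0%nat. intros j _. apply HA. }
assert (HL0c : L0 <= 2 * PI) by apply mes_T_bounds.
assert (HG : v + theta * ln M0 <= G L0).
{ apply (Un_cv_ge_eventually (fun i => G (meas T0 (M0 + / INR (S i))))).
  - apply (continuity_seq G); [|exact Hcv].
    apply derivable_continuous_pt.
    assert (Hs4 : 0 < sin (L0 / 4)) by (apply sin_gt_0; lra).
    exists (2 * n * (/ sin (L0 / 4) * (cos (L0 / 4) * / 4))).
    apply (derivable_pt_lim_scal (fun x => ln (sin (x / 4)))).
    apply (derivable_pt_lim_comp (fun x => sin (x / 4)) ln); [|now apply derivable_pt_lim_ln].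
    apply (derivable_pt_lim_comp (fun x => x / 4) sin); [|apply derivable_pt_lim_sin].
    apply derivable_pt_lim_ext with (fun x => 0 + / 4 * x); [intros; field|].
    apply derivable_pt_lim_affine.
  - exists 0%nat. intros i _. apply HA. }
(* At level 1 [Phi] is at most 0, whereas the limit has value at least [v > 0]. Hence the level can
   still be raised by [1 - M0] within the class of competitors. *)
assert (HM0lt : M0 < 1).
{ destruct (Rle_lt_or_eq_dec M0 1 (proj2 HM0b)) as [H|H]; [exact H|exfalso].
  rewrite H, ln_1 in HG. specialize (Hsn T0 M0). fold L0 in Hsn. unfold G in HG. lra. }
destruct (mono_critical m T0 HT0) as (T' & xi & HT' & D & Hxi & Hxi1).
destruct (improve m T0 T' M0 xi theta (1 - M0) HT0) as (T1 & M1 & HT1 & HM1' & Hm1 & HPhi1);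
  auto; try lra.
{ fold L0. lra. }
assert (H1 : Phi m theta T1 M1 <= v).
{ apply Hv. exists T1, M1. repeat split; auto; lra. }
assert (H0 : Phi m theta T0 M0 = G L0 - theta * ln M0) by reflexivity.
lra.
Qed.

(** * Extremal polynomials *)

(** A missing point of a closed set comes with a missing interval, which has positive measure inside
    the segment. *)
Lemma closed_full_arc (F : R -> Prop) a : closed_set F -> 0 < a ->
  lebesgue_outer (fun x => - a <= x <= a /\ F x) = 2 * a ->
  forall x, - a <= x <= a -> F x.
Proof.
intros HF Ha HFa x Hx. apply NNPP. intros Hn.
assert (E := lebesgue_outer_split F (fun x => - a <= x <= a) HF (segment_bounded_itv _ _)).
rewrite lebesgue_outer_itv in E by lra.
destruct (HF x Hn) as [d Hd]. assert (Hd0 := cond_pos d).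
assert (Hpos : 0 < lebesgue_outer (fun x => - a <= x <= a /\ ~ F x)).
{ apply (lebesgue_outer_pos _ (Rmax (- a) (x - d)) (Rmin a (x + d))); [|auto|].
  - apply Rmax_lub_lt; apply Rmin_glb_lt; lra.
  - intros y Hy.
    assert (Hy1 := Rmax_l (- a) (x - d)). assert (Hy2 := Rmax_r (- a) (x - d)).
    assert (Hy3 := Rmin_l a (x + d)). assert (Hy4 := Rmin_r a (x + d)).
    split; [lra|]. apply (Hd y). apply Rabs_def1; lra. }
lra.
Qed.

(** * Level sets in the case of equality *)

Section Rigidity.
Variables (m : nat) (T : R -> R) (M : R).
Hypothesis HT : mono m T.
Hypothesis HM : 0 < M < 1.
Let L := meas T M.
Let a := L / 2.
Hypothesis HL : 0 < L.
Hypothesis Hext : M = sin (L / 4) ^ (2 * S m).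

Let PT : TP (S m) T := mono_TP m T HT.
Let K c x := - PI <= x <= PI /\ lev T M (c + x).

(** With theta = 1 the value of [Phi] is 0 and can nowhere be positive, so the strict gain from mass
    outside the arc is impossible. Every critical point above the level is allowed, not just a
    global maximum; that is how further critical points are excluded afterwards. *)
Lemma extremal_critical T' xi :
  TPlead m 0 (- INR (S m)) T' -> (forall t, derivable_pt_lim T t (T' t)) ->
  T' xi = 0 -> M < Rabs (T xi) ->
  lebesgue_outer (fun x => K (xi + PI) x /\ ~ (- a <= x <= a)) = 0 /\
  (forall x, - a <= x <= a -> lev T M (xi + PI + x)) /\ a < PI.
Proof.
intros HT' D Hxi HMxi. assert (HP := PI_RGT_0).
set (c := xi + PI).
assert (bK : segment_bounded (K c)) by (unfold K; auto).
assert (HaPI : a < PI).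
{ destruct (perturb m T T' M xi HT (proj1 HM) HT' D Hxi HMxi) as [H _]. fold L in H.
  unfold a. lra. }
assert (H0 : lebesgue_outer (fun x => K c x /\ ~ (- a <= x <= a)) = 0).
{ apply Rle_antisym; [|apply lebesgue_outer_ge0; auto].
  apply Rnot_lt_le. intros Hpos.
  destruct (improve m T T' M xi 1 1 HT (proj1 HM) HT' D Hxi HMxi HL ltac:(lra) (or_intror Hpos)
    ltac:(lra))
    as (T1 & M1 & HT1 & HM1 & Hm1 & HPhi).
  assert (HM1p : 0 < M1) by lra.
  assert (Hlow := mono_lower_bound m T1 M1 HT1 HM1p).
  unfold Phi in HPhi. fold L in HPhi.
  assert (Hb := mes_T_bounds (lev T1 M1)). fold (meas T1 M1) in Hb.
  assert (Hs : 0 < sin (L / 4)) by (unfold a in HaPI; apply sin_gt_0; lra).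
  assert (Hs1 : 0 < sin (meas T1 M1 / 4)) by (apply sin_gt_0; lra).
  assert (E : ln M = 2 * INR (S m) * ln (sin (L / 4))).
  { rewrite Hext at 1. rewrite ln_pow by exact Hs. rewrite mult_INR. simpl (INR 2). ring. }
  assert (E1 : 2 * INR (S m) * ln (sin (meas T1 M1 / 4)) <= ln M1).
  { replace (2 * INR (S m)) with (INR (2 * S m)) by (rewrite mult_INR; simpl (INR 2); ring).
    rewrite <- ln_pow by exact Hs1. destruct Hlow as [H|H]; [|rewrite H; lra].
    left. apply ln_increasing; [now apply pow_lt|exact H]. }
  lra. }
split; [exact H0|]. split; [|exact HaPI].
assert (EL : L = lebesgue_outer (K c)).
{ apply mes_T_centered; [exact (lev_periodic _ T M PT)|]. unfold lev, c.
  replace (xi + PI + PI) with (xi + 2 * PI) by ring.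
  rewrite (TP_periodic _ T xi PT). lra. }
rewrite (lebesgue_outer_split (fun x => - a <= x <= a) (K c)), H0 in EL; auto.
2: { apply closed_set_and; [apply closed_set_half_r|apply closed_set_half_l]. }
rewrite (lebesgue_outer_ext _ (fun x => - a <= x <= a /\ lev T M (c + x))) in EL.
2: { auto. }
2: { intros x. unfold K. intuition lra. }
apply closed_full_arc.
- apply closed_set_shift. exact (lev_closed _ T M PT).
- unfold a. lra.
- unfold a in *. lra.
Qed.

(** The preceding lemma describes the level set up to a null set only. Between the arc and a stray
    point of the level set, |T| would have a local maximum above [M]. *)
Lemma extremal_level_arc : exists c, a < PI /\
  forall x, - PI <= x <= PI -> (lev T M (c + x) <-> - a <= x <= a).
Proof.
assert (HP := PI_RGT_0).
destruct (mono_critical m T HT) as (T' & xi & HT' & D & Hxi & Hxi1).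
destruct (extremal_critical T' xi HT' D Hxi ltac:(lra)) as (H0 & Harc & HaPI).
set (c := xi + PI) in *. exists c. split; [exact HaPI|].
assert (Ha : 0 < a) by (unfold a; lra).
assert (bK : segment_bounded (fun x => K c x /\ ~ (- a <= x <= a))) by (unfold K; auto).
assert (noint : forall u v, u < v -> (forall x, u < x < v -> K c x /\ ~ (- a <= x <= a)) -> False).
{ intros u v Huv H. assert (Hpos := lebesgue_outer_pos _ u v Huv bK H). lra. }
(* Such a point would have its own arc of length [2 * a] in the level set, with another centre; the
   part of it sticking out of the first arc has positive measure. *)
assert (nocrit : forall z, a < z < PI \/ - PI < z < - a -> T' (c + z) = 0 -> ~ M < Rabs (T (c
  + z))).
{ intros z Hz Hcr HMz. destruct (extremal_critical T' (c + z) HT' D Hcr HMz) as (_ & Harc' & _).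
  destruct Hz as [Hz|Hz].
  - apply (noint (z - PI - a) (Rmin (- a) (z - PI + a))).
    + apply Rmin_glb_lt; lra.
    + intros x Hx. generalize (Rmin_l (- a) (z - PI + a)) (Rmin_r (- a) (z - PI + a)). intros.
      split; [split|]; try lra.
      specialize (Harc' (x - z + PI) ltac:(lra)). unfold lev in *.
      replace (c + z + PI + (x - z + PI)) with (c + x + 2 * PI) in Harc' by ring.
      now rewrite (TP_periodic _ T _ PT) in Harc'.
  - apply (noint (Rmax a (z + PI - a)) (z + PI + a)).
    + apply Rmax_lub_lt; lra.
    + intros x Hx. generalize (Rmax_l a (z + PI - a)) (Rmax_r a (z + PI - a)). intros.
      split; [split|]; try lra.
      specialize (Harc' (x - z - PI) ltac:(lra)).
      replace (c + z + PI + (x - z - PI)) with (c + x) in Harc' by ring. exact Harc'. }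
assert (Hends : forall x, x = PI \/ x = - PI -> ~ lev T M (c + x)).
{ intros x Hx. unfold lev, c. destruct Hx as [-> | ->].
  - replace (xi + PI + PI) with (xi + 2 * PI) by ring. rewrite (TP_periodic _ T xi PT). lra.
  - replace (xi + PI + - PI) with xi by ring. lra. }
assert (inner : forall u v, u < v -> (a <= u /\ v < PI) \/ (- PI < u /\ v <= - a) ->
   lev T M (c + u) -> lev T M (c + v) -> False).
{ intros u v Huv Hpos Hu Hv.
  destruct (continuity_ab_maj (fun x => Rabs (T (c + x))) u v) as (z & Hmax & Hz).
  - lra.
  - intros x _. apply (continuity_Rabs_comp (fun x => T (c + x))).
    intros y. apply (continuity_pt_comp (fun x => c + x) T); [reg|].
    apply (TP_continuity _ T PT).
  - assert (Hz' : M < Rabs (T (c + z))).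
    { apply Rnot_le_lt. intros Hle. apply (noint u v Huv). intros x Hx. split; [split|]; try lra.
      unfold lev. eapply Rle_trans; [apply Hmax; lra|exact Hle]. }
    unfold lev in Hu, Hv.
    assert (z <> u) by (intros ->; lra). assert (z <> v) by (intros ->; lra).
    apply (nocrit z); [lra| |exact Hz'].
    apply (max_critical _ T T' PT D (c + u) (c + v)); [lra| |].
    + intros t Ht. specialize (Hmax (t - c) ltac:(lra)).
      replace (c + (t - c)) with t in Hmax by ring. exact Hmax.
    + intros E. rewrite E, Rabs_R0 in Hz'. lra. }
intros x Hx. split; [|apply Harc].
intros Hlev. split; apply Rnot_lt_le; intros Hlt.
- assert (x <> - PI) by (intros ->; apply (Hends (- PI)); auto).
  apply (inner x (- a)); try lra; auto. apply Harc. lra.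
- assert (x <> PI) by (intros ->; apply (Hends PI); auto).
  apply (inner a x); try lra; auto. apply Harc. lra.
Qed.
End Rigidity.

(** * Alternation points on the arc *)

Lemma first_hit P u b v : continuity P -> P u <> v -> (exists t, u <= t <= b /\ P t = v) ->
  exists x, u < x <= b /\ P x = v /\ forall t, u <= t < x -> P t <> v.
Proof.
intros HP Hu (t0 & Ht0 & Et0).
set (E := fun s => u <= s /\ forall t, u <= t <= s -> P t <> v).
assert (HE0 : forall s, E s -> s < t0).
{ intros s [Hs H]. apply Rnot_le_lt. intros Hle. now apply (H t0). }
destruct (completeness E) as [x [Hx Hx']].
- exists t0. intros s Hs. left. now apply HE0.
- exists u. split; [lra|]. intros t Ht. replace t with u by lra. exact Hu.
- assert (Hxt : x <= t0) by (apply Hx'; intros s Hs; left; now apply HE0).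
  assert (Hux : u <= x).
  { apply Hx. split; [lra|]. intros t Ht. replace t with u by lra. exact Hu. }
  assert (Hbefore : forall t, u <= t < x -> P t <> v).
  { intros t Ht. assert (Hs : exists s, E s /\ t < s).
    { apply NNPP. intros Hn. assert (x <= t); [|lra]. apply Hx'. intros s Hs.
      apply Rnot_lt_le. intros Hlt. apply Hn. now exists s. }
    destruct Hs as (s & [Hs1 Hs2] & Hts). apply Hs2. lra. }
  assert (Px : P x = v).
  { apply NNPP. intros Hn.
    assert (x <> t0) by (intros ->; contradiction).
    destruct (HP x (Rabs (P x - v))) as (d & Hd & H1).
    { apply Rabs_pos_lt. lra. }
    assert (K : forall t, Rabs (t - x) < d -> P t <> v).
    { intros t Ht Et. destruct (Req_dec x t) as [<-|Hne]; [contradiction|].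
      assert (K : Rabs (P t - P x) < Rabs (P x - v)).
      { apply H1. split; [split; [exact I|exact Hne]|exact Ht]. }
      rewrite Et, Rabs_minus_sym in K. lra. }
    assert (Hs : Rmin (x + d / 2) t0 <= x).
    { apply Hx. generalize (Rmin_l (x + d / 2) t0) (Rmin_r (x + d / 2) t0).
      intros H2 H3. split.
      - apply Rmin_glb; lra.
      - intros t Ht. destruct (Rlt_le_dec t x); [apply Hbefore; lra|].
        apply K. rewrite Rabs_pos_eq; lra. }
    revert Hs. apply Rmin_case; lra. }
  exists x. split; [|split; [exact Px|exact Hbefore]].
  split; [|lra]. destruct (Req_dec u x) as [->|]; [contradiction|lra].
Qed.

(** The [k - i] zeros to the right of [x] contribute one minus sign each; [k + i] has the same
    parity and avoids truncated subtraction. *)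
Lemma sprod_sign y k i x : (i <= k)%nat ->
  (forall j, (j < i)%nat -> 0 < x - y j < 2 * PI) ->
  (forall j, (i <= j < k)%nat -> 0 < y j - x < 2 * PI) ->
  0 < (-1) ^ (k + i) * sprod y k x.
Proof.
intros Hi H1 H2. assert (HP := PI_RGT_0). induction Hi as [|k Hi IH].
- assert (W : forall k, (k <= i)%nat -> 0 < sprod y k x).
  { induction k as [|k IHk]; intros Hk; simpl; [lra|].
    apply Rmult_lt_0_compat; [|apply IHk; lia].
    specialize (H1 k ltac:(lia)). apply sin_gt_0; lra. }
  replace (i + i)%nat with (2 * i)%nat by lia. rewrite pow_1_even, Rmult_1_l. now apply W.
- simpl. replace (-1 * (-1) ^ (k + i) * (sin ((x - y k) / 2) * sprod y k x)) with
    (sin (- ((x - y k) / 2)) * ((-1) ^ (k + i) * sprod y k x))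
    by (rewrite sin_neg; sign_ring).
  apply Rmult_lt_0_compat.
  + specialize (H2 k ltac:(lia)). apply sin_gt_0; lra.
  + apply IH. intros j Hj. apply H2. lia.
Qed.

(* The zeros of [sprod y k] separate the alternation points x_0 < ... < x_k, so that
   [sprod y k] has the sign of [(-1)^k P] at every point of [-a, x_k] where |P| = M. *)
Definition alternates (P : R -> R) (a M : R) (k : nat) (x y : nat -> R) : Prop :=
  (forall i, (i <= k)%nat -> - a <= x i <= a /\ P (x i) = (-1) ^ i * M) /\
  (forall i, (i < k)%nat -> x i < y i < x (S i)) /\
  (forall t, - a <= t <= x k -> Rabs (P t) = M -> 0 < (-1) ^ k * P t * sprod y k t).

Lemma increasing_le (x y : nat -> R) k : (forall i, (i < k)%nat -> x i < y i < x (S i)) ->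
  forall i j, (i <= j <= k)%nat -> x i <= x j.
Proof.
intros H i j Hij. induction j as [|j IH].
- replace i with 0%nat by lia. lra.
- destruct (Nat.eq_dec i (S j)) as [->|]; [lra|].
  specialize (IH ltac:(lia)). specialize (H j ltac:(lia)). lra.
Qed.

Lemma sign_or k : (-1) ^ k = 1 \/ (-1) ^ k = -1.
Proof. induction k as [|k [H|H]]; simpl; [now left| |]; rewrite H; [right|left]; ring. Qed.

Lemma sign_cancel k u v : (-1) ^ k * ((-1) ^ k * u) * v = u * v.
Proof. rewrite <- (Rmult_assoc _ _ u), sign_sq. ring. Qed.

Lemma sprod_pos y k t : (forall i, (i < k)%nat -> 0 < t - y i < 2 * PI) -> 0 < sprod y k t.
Proof.
intros H. assert (K := sprod_sign y k k t (le_n k) H).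
replace (k + k)%nat with (2 * k)%nat in K by lia.
rewrite pow_1_even, Rmult_1_l in K. apply K. intros; lia.
Qed.

Section Alternation.
Variables (P : R -> R) (a M : R).
Hypothesis HP : continuity P.
Hypothesis Ha : 0 < a < PI.
Hypothesis HM : 0 < M.
Hypothesis Hb : forall t, - a <= t <= a -> Rabs (P t) <= M.
Hypothesis HPa : P (- a) = M.

Lemma abs_extremal t k : Rabs (P t) = M -> P t <> - ((-1) ^ k * M) -> P t = (-1) ^ k * M.
Proof.
intros H Hne. destruct (sign_or k) as [E|E]; rewrite E in *;
  unfold Rabs in H; destruct (Rcase_abs (P t)); lra.
Qed.

Lemma alternates_pos_after k x y t : alternates P a M k x y -> x k <= t <= a ->
  0 < sprod y k t.
Proof.
intros (H1 & H2 & H3) Ht. apply sprod_pos. intros i Hi.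
destruct (H2 i Hi). assert (x (S i) <= x k) by (apply (increasing_le x y k H2); lia).
destruct (H1 i ltac:(lia)). lra.
Qed.

(** The new alternation point is the first [z] where the opposite extreme value is taken, and the
    new zero [w] is placed just before it. Before [z] the opposite value does not occur, between [w]
    and [z] the old one does not, so the sign change at [w] is correct for all extremal points. *)
Lemma alternation_step k x y : alternates P a M k x y ->
  (exists t, x k <= t <= a /\ P t = - ((-1) ^ k * M)) ->
  exists x' y', alternates P a M (S k) x' y'.
Proof.
intros Halt Hex. assert (Hpos := fun t => alternates_pos_after k x y t Halt).
destruct Halt as (H1 & H2 & H3).
assert (Hs := sign_or k).
destruct (H1 k (le_n k)) as [Hxk Pxk].
destruct (first_hit P (x k) a (- ((-1) ^ k * M))) as (z & Hz & Pz & Hbefore); auto.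
{ rewrite Pxk. destruct Hs as [E|E]; rewrite E; lra. }
(* The two extreme values differ by [2 * M], so within tolerance [M] of [P z] the other one is not
   taken. *)
destruct (HP z M HM) as (d & Hd & Hcont).
set (w := Rmax ((x k + z) / 2) (z - d / 2)).
assert (Hw1 : x k < w < z).
{ unfold w. split.
  - eapply Rlt_le_trans; [|apply Rmax_l]. lra.
  - apply Rmax_lub_lt; lra. }
assert (Hw2 : z - d / 2 <= w) by apply Rmax_r.
assert (Hafter : forall t, w <= t <= z -> P t <> (-1) ^ k * M).
{ intros t Ht E. destruct (Req_dec z t) as [<-|Hne].
  - rewrite Pz in E. destruct Hs as [E'|E']; rewrite E' in E; lra.
  - assert (K : Rabs (P t - P z) < M).
    { apply Hcont. split; [split; [exact I|exact Hne]|].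
      simpl. unfold Rdist. apply Rabs_def1; lra. }
    rewrite E, Pz in K. apply Rabs_def2 in K.
    destruct Hs as [E'|E']; rewrite E' in K; lra. }
set (x' := fun i => if Nat.eq_dec i (S k) then z else x i).
set (y' := fun i => if Nat.eq_dec i k then w else y i).
assert (Ey : forall t, sprod y' (S k) t = sin ((t - w) / 2) * sprod y k t).
{ intros t. simpl. unfold y' at 1. destruct (Nat.eq_dec k k) as [_|n]; [|now destruct n].
  f_equal. assert (W : forall j, (j <= k)%nat -> sprod y' j t = sprod y j t).
  { induction j as [|j IHj]; intros Hj; [reflexivity|]. simpl. rewrite IHj by lia.
    unfold y'. destruct (Nat.eq_dec j k); [lia|reflexivity]. }
  now apply W. }
exists x', y'. split; [|split].
- intros i Hi. unfold x'. destruct (Nat.eq_dec i (S k)) as [->|Hne].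
  + split; [lra|]. rewrite Pz. simpl. ring.
  + apply H1. lia.
- intros i Hi. unfold x', y'. destruct (Nat.eq_dec i (S k)); [lia|].
  destruct (Nat.eq_dec i k) as [->|Hne].
  + destruct (Nat.eq_dec (S k) (S k)) as [_|n']; [exact Hw1|now destruct n'].
  + destruct (Nat.eq_dec (S i) (S k)); [lia|]. apply H2. lia.
- unfold x' at 1. destruct (Nat.eq_dec (S k) (S k)) as [_|n]; [|now destruct n].
  intros t Ht HtM. rewrite Ey.
  destruct (Rlt_le_dec w t) as [Hwt|Hwt].
  + assert (Pt : P t = (-1) ^ (S k) * M).
    { apply abs_extremal; [exact HtM|]. simpl.
      replace (- (-1 * (-1) ^ k * M)) with ((-1) ^ k * M) by ring. apply Hafter. lra. }
    rewrite Pt, sign_cancel.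
    apply Rmult_lt_0_compat; [exact HM|]. apply Rmult_lt_0_compat; [|apply Hpos; lra].
    apply sin_gt_0; generalize PI_RGT_0; lra.
  + assert (Hlow : (t < w \/ t = w)) by lra.
    assert (Hk : 0 < (-1) ^ k * P t * sprod y k t /\ t < w).
    { destruct (Rle_lt_dec t (x k)) as [Htk|Htk].
      - split; [apply H3; [lra|exact HtM]|lra].
      - assert (Pt : P t = (-1) ^ k * M).
        { apply abs_extremal; [exact HtM|]. apply Hbefore. lra. }
        split.
        + rewrite Pt, sign_cancel.
          apply Rmult_lt_0_compat; [exact HM|apply Hpos; lra].
        + destruct Hlow as [H|H]; [exact H|]. exfalso. apply (Hafter t); [lra|exact Pt]. }
    destruct Hk as [Hk Htw].
    replace ((-1) ^ S k * P t * (sin ((t - w) / 2) * sprod y k t)) with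
      (sin (- ((t - w) / 2)) * ((-1) ^ k * P t * sprod y k t)) by (rewrite sin_neg; simpl; ring).
    apply Rmult_lt_0_compat; [|exact Hk].
    apply sin_gt_0; generalize PI_RGT_0; lra.
Qed.

(** If the construction stops at [k], no later point takes the opposite value, and the product of
    the [k] sines has the sign of [(-1) ^ k * P] at all extremal points of the arc. *)
Lemma alternation N : (exists x y, alternates P a M N x y) \/
  exists k x y, (k < N)%nat /\ alternates P a M k x y /\
    forall t, x k <= t <= a -> P t <> - ((-1) ^ k * M).
Proof.
induction N as [|N [(x & y & H)|(k & x & y & Hk & H)]].
- left. exists (fun _ => - a), (fun _ => 0). split; [|split].
  + intros i Hi. replace i with 0%nat by lia. simpl. rewrite HPa. split; [lra|ring].
  + intros i Hi. lia.
  + intros t Ht _. replace t with (- a) by lra. rewrite HPa. simpl. lra.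
- destruct (classic (exists t, x N <= t <= a /\ P t = - ((-1) ^ N * M))) as [He|Hn].
  + left. exact (alternation_step N x y H He).
  + right. exists N, x, y. split; [lia|]. split; [exact H|].
    intros t Ht E. apply Hn. now exists t.
- right. exists k, x, y. split; [lia|exact H].
Qed.
End Alternation.

(** The easy direction of Kolmogorov's criterion: subtracting a small multiple of [G] lowers |P|
    near the extremal points, and elsewhere there is room to spare. Compactness of the arc makes
    both statements uniform. *)
Lemma kolmogorov_improve (P G : R -> R) a M : continuity P -> continuity G ->
  0 < a -> 0 < M -> (forall t, Rabs (G t) <= 1) ->
  (forall t, - a <= t <= a -> Rabs (P t) <= M) ->
  (forall t, - a <= t <= a -> Rabs (P t) = M -> 0 < P t * G t) ->
  exists eta M', 0 < M' < M /\ forall t, - a <= t <= a -> Rabs (P t - eta * G t) <= M'.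
Proof.
intros HP HG Ha HM HG1 Hb Hext.
(* Twice the maximum of [M * M - P t * P t] and [P t * G t]. It is positive on the whole arc, so its
   minimum gives one constant [c] for both alternatives. *)
set (q := fun t => (M * M - P t * P t) + P t * G t + Rabs ((M * M - P t * P t) - P t * G t)).
assert (Hsq : forall t, - a <= t <= a -> P t * P t <= M * M).
{ intros t Ht. specialize (Hb t Ht). apply Rsqr_le_abs_1.
  rewrite (Rabs_pos_eq M); lra. }
assert (Cq : continuity q).
{ assert (CP : continuity (fun t => M * M - P t * P t)).
  { apply (continuity_minus (fct_cte (M * M)) (P * P)%F).
    - apply continuity_const. now intros x y.
    - now apply continuity_mult. }
  assert (CG : continuity (P * G)%F) by now apply continuity_mult.
  apply (continuity_plus (plus_fct (fun t => M * M - P t * P t) (mult_fct P G))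
    (fun t => Rabs ((M * M - P t * P t) - P t * G t))).
  - now apply continuity_plus.
  - apply continuity_Rabs_comp.
    now apply (continuity_minus (fun t => M * M - P t * P t) (P * G)%F). }
destruct (continuity_ab_min q (- a) a) as (t0 & Hmin & Ht0); [lra|intros; apply Cq|].
assert (Hq0 : 0 < q t0).
{ unfold q. specialize (Hsq t0 Ht0).
  destruct (Req_dec (Rabs (P t0)) M) as [E|E].
  - specialize (Hext t0 Ht0 E).
    assert (P t0 * P t0 = M * M).
    { replace (P t0 * P t0) with (Rabs (P t0) * Rabs (P t0)); [now rewrite E|].
      rewrite <- Rabs_mult. apply Rabs_pos_eq. apply Rle_0_sqr. }
    generalize (Rle_abs (- (M * M - P t0 * P t0 - P t0 * G t0))). rewrite Rabs_Ropp. lra.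
  - specialize (Hb t0 Ht0).
    assert (P t0 * P t0 < M * M).
    { replace (P t0 * P t0) with (Rabs (P t0) * Rabs (P t0)).
      - generalize (Rabs_pos (P t0)). nra.
      - rewrite <- Rabs_mult. apply Rabs_pos_eq. apply Rle_0_sqr. }
    generalize (Rle_abs (M * M - P t0 * P t0 - P t0 * G t0)). lra. }
set (c := q t0 / 2). assert (Hc : 0 < c) by (unfold c; lra).
assert (Hor : forall t, - a <= t <= a -> P t * P t <= M * M - c \/ c <= P t * G t).
{ intros t Ht. specialize (Hmin t Ht). unfold q in Hmin at 2.
  assert (q t0 = 2 * c) by (unfold c; field).
  unfold Rabs in Hmin. destruct (Rcase_abs _) in Hmin; [right|left]; lra. }
(* Chosen so that (P - eta G)^2 <= M^2 - eta c in both cases: where P G >= c this needs eta <= c,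
   where P^2 <= M^2 - c it needs 2 eta M + eta^2 <= c - eta c. *)
set (eta := Rmin (Rmin c 1) (c / (2 * M + 1 + c))).
assert (Hden : 0 < 2 * M + 1 + c) by lra.
assert (Heta : 0 < eta /\ eta <= c /\ eta <= 1 /\ eta * (2 * M + 1 + c) <= c).
{ unfold eta. split; [|split; [|split]].
  - repeat apply Rmin_pos; try lra. apply Rdiv_lt_0_compat; lra.
  - eapply Rle_trans; [apply Rmin_l|apply Rmin_l].
  - eapply Rle_trans; [apply Rmin_l|apply Rmin_r].
  - apply Rle_trans with (c / (2 * M + 1 + c) * (2 * M + 1 + c)).
    + apply Rmult_le_compat_r; [lra|apply Rmin_r].
    + right. field. lra. }
destruct Heta as (He & Hec & He1 & Hem).
(* Ensures (M - kap)^2 >= M^2 - 2 kap M >= M^2 - eta c. *)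
set (kap := Rmin (M / 2) (eta * c / (2 * M))).
assert (Hkap : 0 < kap /\ kap <= M / 2 /\ 2 * kap * M <= eta * c).
{ unfold kap. split; [|split].
  - apply Rmin_pos; [lra|]. apply Rdiv_lt_0_compat; [now apply Rmult_lt_0_compat|lra].
  - apply Rmin_l.
  - apply Rle_trans with (2 * (eta * c / (2 * M)) * M).
    + apply Rmult_le_compat_r; [lra|]. apply Rmult_le_compat_l; [lra|apply Rmin_r].
    + right. field. lra. }
destruct Hkap as (Hk0 & Hk1 & Hk2).
exists eta, (M - kap). split; [lra|]. intros t Ht.
specialize (HG1 t). specialize (Hb t Ht).
assert (HGG : G t * G t <= 1).
{ replace 1 with (1 * 1) by ring. apply Rsqr_le_abs_1. rewrite Rabs_R1. exact HG1. }
assert (Hsqr : (P t - eta * G t) * (P t - eta * G t) <= M * M - eta * c).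
{ replace ((P t - eta * G t) * (P t - eta * G t)) with
    (P t * P t - 2 * eta * (P t * G t) + eta * eta * (G t * G t)) by ring.
  assert (H1 : eta * eta * (G t * G t) <= eta * eta).
  { rewrite <- (Rmult_1_r (eta * eta)) at 2. apply Rmult_le_compat_l; nra. }
  destruct (Hor t Ht) as [H|H].
  - assert (H2 : - (P t * G t) <= M).
    { apply Rle_trans with (Rabs (- (P t * G t))); [apply Rle_abs|].
      rewrite Rabs_Ropp, Rabs_mult, <- (Rmult_1_r M).
      apply Rmult_le_compat; auto using Rabs_pos. }
    assert (H3 : eta * - (P t * G t) <= eta * M) by (apply Rmult_le_compat_l; lra).
    assert (H4 : eta * eta <= eta * 1) by (apply Rmult_le_compat_l; lra). lra.
  - assert (H2 : eta * c <= eta * (P t * G t)) by (apply Rmult_le_compat_l; lra).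
    assert (H3 : eta * eta <= eta * c) by (apply Rmult_le_compat_l; lra).
    specialize (Hsq t Ht). lra. }
rewrite <- (Rabs_pos_eq (M - kap)) by lra.
apply Rsqr_le_abs_0. unfold Rsqr. nra.
Qed.

(** The odd function d(t) = P(t) - P(-t) alternates weakly at 2n + 1 points of the arc and vanishes
    at pi, one zero too many for order n. As the alternation is only weak, zeros could coincide.
    Adding [eta * G] makes it strict; the perturbed function then has 2n separate zeros and the
    value [eta * G PI] at pi, hence is of size [eta] everywhere. *)
Lemma alternates_even m P a M x y : TP (S m) P -> 0 < a < PI ->
  (forall t, - a <= t <= a -> Rabs (P t) <= M) ->
  alternates P a M (2 * S m) x y ->
  forall t, P t = P (- t).
Proof.
intros PP Ha Hb (H1 & H2 & _) t. assert (HPI := PI_RGT_0).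
set (N := (2 * S m)%nat) in *.
set (d := fun t => 1 * P t + (-1) * P (- t)).
assert (Pd : TP (S m) d).
{ apply TP_lin; [exact PP|]. apply TP_S in PP. destruct PP as (u & v & HP).
  apply TP_S. exists u, (- v). now apply TPlead_reflect. }
assert (dpi : d PI = 0).
{ unfold d. rewrite <- (TP_periodic (S m) P (- PI) PP).
  replace (- PI + 2 * PI) with PI by ring. ring. }
assert (dsign : forall i, (i <= N)%nat -> 0 <= (-1) ^ i * d (x i)).
{ intros i Hi. destruct (H1 i Hi) as [Hx Px]. unfold d. rewrite Px.
  specialize (Hb (- x i) ltac:(lra)).
  generalize (sign_sq i) (Rle_abs (P (- x i))) (Rle_abs (- P (- x i))). rewrite Rabs_Ropp.
  destruct (sign_or i) as [E|E]; rewrite E; lra. }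
set (G := sprod y N).
assert (Gsign : forall i, (i <= N)%nat -> 0 < (-1) ^ i * G (x i)).
{ intros i Hi.
  assert (K := sprod_sign y N i (x i) Hi).
  assert (0 < (-1) ^ (N + i) * sprod y N (x i)) as K'.
  { apply K.
    - intros j Hj. destruct (H2 j ltac:(lia)).
      assert (x (S j) <= x i) by (apply (increasing_le x y N H2); lia).
      destruct (H1 j ltac:(lia)), (H1 i ltac:(lia)). lra.
    - intros j Hj. destruct (H2 j ltac:(lia)).
      assert (x i <= x j) by (apply (increasing_le x y N H2); lia).
      destruct (H1 (S j) ltac:(lia)), (H1 i ltac:(lia)). lra. }
  rewrite pow_add in K'. unfold N in K' at 1. rewrite pow_1_even, Rmult_1_l in K'. exact K'. }
(* A lower bound at [PI] for every product of [N] half-angle sines with zeros in the arc; it is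
   independent of [eta], although the zeros [z] are not. *)
set (kap := cos (a / 2) ^ N).
assert (Hcos : 0 < cos (a / 2)) by (apply cos_gt_0; lra).
assert (Hkap : 0 < kap) by now apply pow_lt.
assert (key : forall eta, 0 < eta -> Rabs (d t + eta * G t) * kap <= eta).
{ intros eta He.
  set (de := fun t => 1 * d t + eta * G t).
  assert (Pde : TP (S m) de) by (apply TP_lin; [exact Pd|apply hform_TP, sprod_hform]).
  assert (Cde := TP_continuity _ _ Pde).
  assert (design : forall i, (i <= N)%nat -> 0 < (-1) ^ i * de (x i)).
  { intros i Hi. unfold de. specialize (dsign i Hi). specialize (Gsign i Hi).
    replace ((-1) ^ i * (1 * d (x i) + eta * G (x i))) with
      ((-1) ^ i * d (x i) + eta * ((-1) ^ i * G (x i))) by ring.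
    assert (0 < eta * ((-1) ^ i * G (x i))) by now apply Rmult_lt_0_compat. lra. }
  assert (zero : forall i, exists z, (i < N)%nat -> x i < z < x (S i) /\ de z = 0).
  { intros i. destruct (le_lt_dec N i) as [Hi|Hi]; [exists 0; intros; lia|].
    assert (Hx : x i < x (S i)) by (destruct (H2 i Hi); lra).
    assert (S1 := design i ltac:(lia)). assert (S2 := design (S i) ltac:(lia)). simpl in S2.
    destruct (IVT_cor de (x i) (x (S i)) Cde) as (z & Hz & Ez); [lra| |].
    - destruct (sign_or i) as [E|E]; rewrite E in S1, S2; nra.
    - exists z. intros _. split; [|exact Ez].
      assert (z <> x i) by (intros ->; rewrite Ez in S1; lra).
      assert (z <> x (S i)) by (intros ->; rewrite Ez in S2; lra). lra. }
  set (z := fun i => proj1_sig (constructive_indefinite_description _ (zero i))).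
  assert (Hz : forall i, (i < N)%nat -> x i < z i < x (S i) /\ de (z i) = 0).
  { intros i. exact (proj2_sig (constructive_indefinite_description _ (zero i))). }
  assert (Hzb : forall i, (i < N)%nat -> - a < z i < a).
  { intros i Hi. destruct (Hz i Hi) as [Hzi _]. destruct (H1 i ltac:(lia)), (H1 (S i)
    ltac:(lia)). lra. }
  assert (Hzinc : forall i j, (i < j < N)%nat -> z i < z j).
  { intros i j Hij. destruct (Hz i ltac:(lia)), (Hz j ltac:(lia)).
    assert (x (S i) <= x j) by (apply (increasing_le x y N H2); lia). lra. }
  (* A form of degree [N] with the [N + 1] zeros [z i] and [PI]. *)
  assert (prop : sprod z N PI * de t + - de PI * sprod z N t = 0).
  { apply (hform_zero N (fun t => sprod z N PI * de t + - de PI * sprod z N t)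
      (fun i => if lt_dec i N then z i else PI)).
    - apply hform_lin; [now apply (TP_hform (S m))|apply sprod_hform].
    - intros i Hi. destruct (lt_dec i N) as [H|H].
      + rewrite (proj2 (Hz i H)), sprod_root by exact H. ring.
      + ring.
    - intros i j Hij. destruct (lt_dec i N) as [Hi|Hi]; [|lia].
      apply Rlt_not_eq. destruct (lt_dec j N) as [Hj|Hj].
      + assert (K := Hzinc i j ltac:(lia)). assert (K1 := Hzb i Hi). assert (K2 := Hzb j Hj).
        apply sin_lt_0_var; lra.
      + assert (K1 := Hzb i Hi). apply sin_lt_0_var; lra. }
  assert (Hge : kap <= Rabs (sprod z N PI)).
  { apply sprod_ge; [lra|]. intros i Hi. assert (K1 := Hzb i Hi).
    replace ((PI - z i) / 2) with (PI / 2 - z i / 2) by field.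
    rewrite sin_shift. eapply Rle_trans; [|apply Rle_abs].
    destruct (Rle_lt_dec 0 (z i)).
    - apply cos_decr_1; lra.
    - rewrite <- (cos_neg (z i / 2)). apply cos_decr_1; lra. }
  assert (Ede : d t + eta * G t = de t) by (unfold de; ring).
  assert (Epi : de PI = eta * G PI) by (unfold de; rewrite dpi; ring).
  rewrite Ede. apply Rle_trans with (Rabs (de t) * Rabs (sprod z N PI)).
  { apply Rmult_le_compat_l; [apply Rabs_pos|exact Hge]. }
  rewrite <- Rabs_mult. replace (de t * sprod z N PI) with (de PI * sprod z N t) by lra.
  rewrite Epi, !Rabs_mult, (Rabs_pos_eq eta) by lra.
  rewrite Rmult_assoc. apply Rle_trans with (eta * 1); [|lra]. apply Rmult_le_compat_l; [lra|].
  rewrite <- (Rmult_1_r 1). apply Rmult_le_compat; auto using Rabs_pos; apply sprod_bound. }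
assert (Hd0 : d t = 0).
{ apply NNPP. intros Hn. assert (Hdp : 0 < Rabs (d t)) by now apply Rabs_pos_lt.
  assert (HG1 : Rabs (G t) <= 1) by apply sprod_bound.
  set (eta := Rabs (d t) * kap / (2 * (1 + kap))).
  assert (He : 0 < eta).
  { apply Rdiv_lt_0_compat; [now apply Rmult_lt_0_compat|lra]. }
  specialize (key eta He).
  assert (K : Rabs (d t) - eta <= Rabs (d t + eta * G t)).
  { replace (d t) with (d t + eta * G t + - (eta * G t)) at 1 by ring.
    assert (K1 := Rabs_triang (d t + eta * G t) (- (eta * G t))).
    rewrite Rabs_Ropp, (Rabs_mult eta), (Rabs_pos_eq eta) in K1 by lra.
    assert (eta * Rabs (G t) <= eta * 1) by (apply Rmult_le_compat_l; lra). lra. }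
  assert (K2 : (Rabs (d t) - eta) * kap <= eta).
  { eapply Rle_trans; [|exact key]. apply Rmult_le_compat_r; lra. }
  assert (K3 : eta * (2 * (1 + kap)) = Rabs (d t) * kap) by (unfold eta; field; lra).
  assert (0 < eta * kap) by now apply Rmult_lt_0_compat. lra. }
unfold d in Hd0. lra.
Qed.

Lemma TP_le k m f : (k <= m)%nat -> TP k f -> TP m f.
Proof. intros H Hf. induction H as [|m _ IH]; [exact Hf|now apply TP_lift]. Qed.

Lemma extremal_center m T M : mono m T -> 0 < M < 1 -> 0 < meas T M ->
  M = sin (meas T M / 4) ^ (2 * S m) ->
  exists c, sin (INR (S m) * c) = 0 /\
    forall x, - PI <= x <= PI -> (lev T M (c + x) <-> - (meas T M / 2) <= x <= meas T M / 2).
Proof.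
intros HT HM HL Hext. assert (HP := PI_RGT_0).
destruct (extremal_level_arc m T M HT HM HL Hext) as (c & HaPI & Harc).
set (L := meas T M) in *. set (a := L / 2) in *.
assert (Ha : 0 < a) by (unfold a; lra).
exists c. split; [|exact Harc].
assert (PT := mono_TP m T HT). assert (CT := TP_continuity _ T PT).
assert (Cc : continuity (fun x => T (c + x))).
{ intros y. apply (continuity_pt_comp (fun x => c + x) T); [reg|apply CT]. }
assert (Hedge : forall e, e = a \/ e = - a -> Rabs (T (c + e)) = M).
{ intros e He. apply Rle_antisym; [apply Harc; lra|]. apply Rnot_lt_le. intros Hlt.
  destruct (continuity_Rabs_comp _ Cc e (M - Rabs (T (c + e)))) as (d & Hd & H); [lra|].
  set (h := Rmin (d / 2) (PI - a)).
  assert (Hh : 0 < h /\ h < d /\ h <= PI - a).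
  { unfold h. split; [apply Rmin_pos; lra|]. split; [|apply Rmin_r].
    eapply Rle_lt_trans; [apply Rmin_l|lra]. }
  assert (near : forall y, e <> y -> Rabs (y - e) < d -> lev T M (c + y)).
  { intros y Hne Hy. specialize (H y (conj (conj I Hne) Hy)). simpl in H. unfold Rdist in H.
    apply Rabs_def2 in H. unfold lev. lra. }
  destruct He as [-> | ->].
  - assert (H1 : lev T M (c + (a + h))).
    { apply near; [lra|]. rewrite Rabs_pos_eq; lra. }
    apply Harc in H1; lra.
  - assert (H1 : lev T M (c + (- a - h))).
    { apply near; [lra|]. rewrite Rabs_left1; lra. }
    apply Harc in H1; lra. }
(* Opposite signs at the ends would give a zero of [T] on the complementary arc, where |T| exceeds
   [M]. *)
assert (Hsame : 0 < T (c + a) * T (c + - a)).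
{ assert (H1 := Hedge a (or_introl eq_refl)). assert (H2 := Hedge (- a) (or_intror eq_refl)).
  apply Rnot_le_lt. intros Hle.
  destruct (IVT_cor (fun x => T (c + x)) a (2 * PI - a) Cc) as (z & Hz & Ez); [lra| |].
  - replace (c + (2 * PI - a)) with (c + - a + 2 * PI) by ring.
    rewrite (TP_periodic _ T _ PT). exact Hle.
  - destruct (Rle_lt_dec z PI) as [Hz1|Hz1].
    + assert (Hl : lev T M (c + z)) by (unfold lev; rewrite Ez, Rabs_R0; lra).
      apply Harc in Hl; [|lra]. assert (z = a) by lra. subst z.
      rewrite Ez, Rabs_R0 in H1. lra.
    + assert (Ez' : T (c + (z - 2 * PI)) = 0).
      { rewrite <- Ez, <- (TP_periodic _ T (c + (z - 2 * PI)) PT). f_equal. ring. }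
      assert (Hl : lev T M (c + (z - 2 * PI))) by (unfold lev; rewrite Ez', Rabs_R0; lra).
      apply Harc in Hl; [|lra]. assert (Hza : z - 2 * PI = - a) by lra.
      rewrite Hza in Ez'. rewrite Ez', Rabs_R0 in H2. lra. }
assert (Hsig : exists u, u * u = 1 /\ u * T (c + a) = M /\ u * T (c + - a) = M).
{ assert (H1 := Hedge a (or_introl eq_refl)). assert (H2 := Hedge (- a) (or_intror eq_refl)).
  unfold Rabs in H1, H2. destruct (Rcase_abs (T (c + a))), (Rcase_abs (T (c + - a)));
    [exists (-1)|exfalso; nra|exfalso; nra|exists 1]; repeat split; lra. }
destruct Hsig as (u & Hu & Hua & Hua').
assert (Hu1 : u = 1 \/ u = -1).
{ assert (Hf : (u - 1) * (u + 1) = 0) by (ring_simplify; lra).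
  destruct (Rmult_integral _ _ Hf); [left|right]; lra. }
set (P := fun x => u * T (x + c)).
assert (EP : forall x, P x = u * T (c + x)) by (intros x; unfold P; now rewrite Rplus_comm).
assert (PP : TP (S m) P).
{ apply TP_ext with (fun x => u * T (x + c) + 0 * T (x + c)); [intros; unfold P; ring|].
  apply TP_lin; now apply (TP_shift _ c). }
assert (CP := TP_continuity _ P PP).
assert (HPb : forall t, - a <= t <= a -> Rabs (P t) <= M).
{ intros t Ht. rewrite EP, Rabs_mult.
  replace (Rabs u) with 1.
  - rewrite Rmult_1_l. apply Harc; lra.
  - destruct Hu1 as [-> | ->]; [now rewrite Rabs_R1|rewrite Rabs_left; lra]. }
destruct (alternation P a M CP (conj Ha HaPI) (proj1 HM) (eq_trans (EP _) Hua') (2 * S m))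
  as [(x & y & Halt)|(k & x & y & Hk & Halt & Hstop)].
- assert (Heven := alternates_even m P a M x y PP (conj Ha HaPI) HPb Halt).
  (* The sine coefficient of cos n(t + c) is - sin nc. It changes sign under reflection, so evenness
     forces it to vanish. *)
  assert (L1 := TPlead_shift m c 1 0 T HT).
  assert (L2 := TPlead_reflect _ _ _ _ L1).
  assert (L3 := TPlead_lin m 1 (-1) _ _ _ _ _ _ L1 L2).
  destruct (TPlead_zero _ _ _ _ L3) as [_ H0].
  + intros t. specialize (Heven t). unfold P in Heven.
    destruct Hu1 as [E|E]; rewrite E in Heven; lra.
  + lra.
- exfalso.
  (* Both ends carry the value [M]. For odd [k] the awaited value would be [M] and would be taken at
     [a], so the construction stops only at an even [k], at most 2n - 2; then [sprod y k] has order
     at most n - 1. *)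
  assert (Hkeven : exists j, k = (2 * j)%nat).
  { destruct (Nat.Even_or_Odd k) as [[j Hj]|[j Hj]]; [now exists j|exfalso].
    apply (Hstop a).
    - split; [|lra]. destruct Halt as [H1 _]. destruct (H1 k (le_n k)). lra.
    - rewrite Hj, Nat.add_1_r, pow_1_odd, EP, Hua. ring. }
  destruct Hkeven as [j Hj].
  assert (Hsk : (-1) ^ k = 1) by (rewrite Hj; apply pow_1_even).
  set (G := sprod y k).
  assert (PG : TP m G).
  { apply (TP_le j); [lia|]. apply hform_TP. rewrite <- Hj. apply sprod_hform. }
  assert (Hpos : forall t, - a <= t <= a -> Rabs (P t) = M -> 0 < P t * G t).
  { intros t Ht HtM. destruct (Rle_lt_dec t (x k)) as [Htx|Htx].
    - destruct Halt as (_ & _ & H3). specialize (H3 t ltac:(lra) HtM).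
      rewrite Hsk, Rmult_1_l in H3. exact H3.
    - assert (Pt : P t = (-1) ^ k * M) by (apply abs_extremal; [lra|exact HtM|apply Hstop; lra]).
      rewrite Pt, Hsk, Rmult_1_l. apply Rmult_lt_0_compat; [lra|].
      apply (alternates_pos_after P a M (conj Ha HaPI) k x y t Halt). lra. }
  destruct (kolmogorov_improve P G a M CP (TP_continuity _ G PG) Ha (proj1 HM)
    (sprod_bound y k) HPb Hpos) as (eta & M' & HM' & Himp).
  set (T1 := fun t => 1 * T t + (- (u * eta)) * G (t + - c)).
  assert (HT1 : mono m T1).
  { assert (HG := TPlead_low m _ (TP_shift m (- c) G PG)).
    assert (H := TPlead_lin m 1 (- (u * eta)) _ _ _ _ _ _ HT HG).
    revert H. apply TPlead_coef; ring. }
  assert (Hlow := mono_lower_bound m T1 M' HT1 (proj1 HM')).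
  assert (Hmeas : L <= meas T1 M').
  { unfold meas. rewrite <- (lebesgue_outer_window _ (c - PI)) by
      exact (lev_periodic _ T1 M' (mono_TP m T1 HT1)).
    replace L with (c + a - (c - a)) by (unfold a; field).
    apply lebesgue_outer_ge_itv; [lra|auto|]. intros t Ht. split; [|lra].
    unfold lev, T1. specialize (Himp (t + - c) ltac:(lra)).
    replace (1 * T t + - (u * eta) * G (t + - c)) with (u * (P (t + - c) - eta * G (t + - c))).
    - rewrite Rabs_mult. replace (Rabs u) with 1; [lra|].
      destruct Hu1 as [-> | ->]; [now rewrite Rabs_R1|rewrite Rabs_left; lra].
    - unfold P. replace (t + - c + c) with t by ring.
      transitivity (u * u * T t - u * eta * G (t + - c)); [ring|]. rewrite Hu. ring. }
  assert (Hb := mes_T_bounds (lev T1 M')). fold (meas T1 M') in Hb.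
  assert (sin (L / 4) ^ (2 * S m) <= sin (meas T1 M' / 4) ^ (2 * S m)).
  { apply pow_incr. split; [apply sin_ge_0; lra|]. apply sin_incr_1; lra. }
  lra.
Qed.

Lemma pow_lt_compat_base x y k : 0 <= x < y -> (0 < k)%nat -> x ^ k < y ^ k.
Proof.
intros Hxy Hk. induction Hk as [|k Hk IH]; [simpl; lra|].
simpl. apply Rmult_le_0_lt_compat; try lra. now apply pow_le.
Qed.

(** For nonzero q this is q^k T_k((cos t - p)/q) with the Chebyshev polynomial T_k. The recurrence
    avoids the division and shows the leading part cos kt. For p = cos^2(alpha/2) and q =
    sin^2(alpha/2) the argument maps [cos alpha, 1] onto [-1, 1], which gives the level q^k on the
    arc. *)
Fixpoint arc_cheb (p q : R) (k : nat) (t : R) : R :=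
  match k with
  | O => 1
  | S O => cos t - p
  | S (S j as i) => 2 * (cos t - p) * arc_cheb p q i t - q * q * arc_cheb p q j t
  end.

Lemma arc_cheb_SS p q k t : arc_cheb p q (S (S k)) t =
  2 * (cos t - p) * arc_cheb p q (S k) t - q * q * arc_cheb p q k t.
Proof. reflexivity. Qed.

Lemma arc_cheb_mono p q k : TP k (arc_cheb p q k) /\ mono k (arc_cheb p q (S k)).
Proof.
induction k as [|k [IH0 (g & Hg & E)]].
- split; [apply TP_const|]. exists (fun _ => - p). split; [apply TP_const|].
  intros t. simpl. rewrite !Rmult_1_l. ring.
- split; [apply TP_S; exists 1, 0, g; now split|].
  assert (IH1 : TP (S k) (arc_cheb p q (S k))) by (apply TP_S; exists 1, 0, g; now split).
  exists (fun t => 1 * (1 * (1 * cos (INR k * t) + 0 * sin (INR k * t)) +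
                 1 * ((2 * cos t + 0 * sin t) * g t)) +
            1 * ((- 2 * p) * arc_cheb p q (S k) t + (- (q * q)) * arc_cheb p q k t)).
  split.
  + apply TP_lin; apply TP_lin.
    * apply TP_harm. lia.
    * now apply TP_mul_cs.
    * exact IH1.
    * now apply TP_lift.
  + intros t. rewrite arc_cheb_SS, E.
    rewrite (INR_S_mult (S k)), cos_plus.
    replace (INR k * t) with (INR (S k) * t - t) by (rewrite S_INR; ring).
    rewrite cos_minus. ring.
Qed.

Lemma arc_cheb_cos p q phi t k : cos t - p = q * cos phi ->
  arc_cheb p q k t = q ^ k * cos (INR k * phi) /\
  arc_cheb p q (S k) t = q ^ S k * cos (INR (S k) * phi).
Proof.
intros E. induction k as [|k [IH0 IH1]].
- simpl. rewrite Rmult_0_l, cos_0, !Rmult_1_l, Rmult_1_r, E. split; reflexivity.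
- split; [exact IH1|]. rewrite arc_cheb_SS, IH0, IH1, E, (INR_S_mult (S k)), cos_plus.
  replace (INR k * phi) with (INR (S k) * phi - phi) by (rewrite S_INR; ring).
  rewrite cos_minus. simpl pow. ring.
Qed.

Lemma arc_cheb_bound alpha k t : 0 < alpha < PI -> cos alpha <= cos t ->
  Rabs (arc_cheb (cos (alpha / 2) * cos (alpha / 2)) (sin (alpha / 2) * sin (alpha / 2)) k t)
  <= sin (alpha / 2) ^ (2 * k).
Proof.
intros Ha Hc.
set (p := cos (alpha / 2) * cos (alpha / 2)). set (q := sin (alpha / 2) * sin (alpha / 2)).
assert (Hs : 0 < sin (alpha / 2)) by (apply sin_gt_0; lra).
assert (Hq : 0 < q) by now apply Rmult_lt_0_compat.
assert (Epq : p + q = 1) by apply cos_sin_sq.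
assert (Ec : cos alpha = p - q).
{ replace alpha with (alpha / 2 + alpha / 2) at 1 by field. apply cos_plus. }
assert (Hx : -1 <= (cos t - p) / q <= 1).
{ split; apply Rmult_le_reg_r with q; try exact Hq;
    unfold Rdiv; rewrite Rmult_assoc, Rinv_l, Rmult_1_r by lra.
  - lra.
  - generalize (COS_bound t). lra. }
assert (E : cos t - p = q * cos (acos ((cos t - p) / q))).
{ rewrite cos_acos by exact Hx. field. lra. }
destruct (arc_cheb_cos p q _ t k E) as [-> _].
rewrite pow_mult. replace (sin (alpha / 2) ^ 2) with q by (unfold q; ring).
rewrite Rabs_mult, Rabs_pos_eq by (apply pow_le; lra).
rewrite <- (Rmult_1_r (q ^ k)) at 2. apply Rmult_le_compat_l; [apply pow_le; lra|].
apply Rabs_le, COS_bound.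
Qed.

(** * Arcs as closed periodic sets *)

Lemma periodic_Z Q x (z : Z) : periodic_set Q -> (Q (x + 2 * PI * IZR z) <-> Q x).
Proof.
intros HQ.
assert (W : forall N y, Q (y + 2 * PI * INR N) <-> Q y).
{ induction N as [|N IH]; intros y.
  - simpl. now rewrite Rmult_0_r, Rplus_0_r.
  - rewrite <- (IH y), S_INR.
    replace (y + 2 * PI * (INR N + 1)) with (y + 2 * PI * INR N + 2 * PI) by ring.
    symmetry. apply HQ. }
destruct (Z_le_gt_dec 0 z) as [Hz|Hz].
- rewrite <- (Z2Nat.id z Hz), <- INR_IZR_INZ. apply W.
- rewrite <- (W (Z.to_nat (- z)) (x + 2 * PI * IZR z)).
  rewrite INR_IZR_INZ, Z2Nat.id, opp_IZR by lia.
  now replace (x + 2 * PI * IZR z + 2 * PI * - IZR z) with x by ring.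
Qed.

Lemma reduce_period x : exists z : Z, - PI <= x - 2 * PI * IZR z <= PI.
Proof.
assert (HP := PI_RGT_0).
destruct (euclidian_division (x + PI) (2 * PI)) as (z & r & E & Hr & Hr'); [lra|].
rewrite Rabs_pos_eq in Hr' by lra. exists z. lra.
Qed.

Lemma segment_of_arc n alpha (k : Z) Q : periodic_set Q -> 0 < alpha < PI ->
  (forall x, - PI <= x <= PI -> (Q (IZR k * PI / INR n + x) <-> - alpha <= x <= alpha)) ->
  is_segment_I n alpha k Q.
Proof.
intros HQ Ha Harc x. set (c := IZR k * PI / INR n) in *. split.
- intros Qx. destruct (reduce_period (x - c)) as (z & Hz). exists z. fold c.
  assert (H : Q (c + (x - c - 2 * PI * IZR z))).
  { apply (periodic_Z Q _ z HQ).
    replace (c + (x - c - 2 * PI * IZR z) + 2 * PI * IZR z) with x by ring. exact Qx. }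
  apply Harc in H; [lra|exact Hz].
- intros (z & Hz). fold c in Hz.
  replace x with (c + (x - c - 2 * PI * IZR z) + 2 * PI * IZR z) by ring.
  apply (periodic_Z Q _ z HQ). apply Harc; lra.
Qed.

Lemma segment_cos n alpha (k : Z) Q x : 0 < alpha < PI -> is_segment_I n alpha k Q -> Q x ->
  cos alpha <= cos (x - IZR k * PI / INR n).
Proof.
intros Ha Hseg Qx. apply Hseg in Qx. destruct Qx as (z & Hz).
set (c := IZR k * PI / INR n) in *.
assert (E : cos (x - c) = cos (x - c - 2 * PI * IZR z)).
{ destruct (Z_le_gt_dec 0 z) as [Hz0|Hz0].
  - rewrite <- (cos_period (x - c - 2 * PI * IZR z) (Z.to_nat z)).
    rewrite INR_IZR_INZ, Z2Nat.id by lia. f_equal. ring.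
  - rewrite <- (cos_period (x - c) (Z.to_nat (- z))).
    rewrite INR_IZR_INZ, Z2Nat.id, opp_IZR by lia. f_equal. ring. }
rewrite E. destruct (Rle_lt_dec 0 (x - c - 2 * PI * IZR z)).
- apply cos_decr_1; lra.
- rewrite <- (cos_neg (x - c - 2 * PI * IZR z)). apply cos_decr_1; lra.
Qed.

(** The segment with k = 0, described by the cosine so that closedness and periodicity are
    immediate. It attains the infimum over all sets. *)
Lemma arc_compact alpha : compact_T (fun x => cos alpha <= cos x).
Proof.
split.
- intros x Hx. destruct (closed_set_le (fun x => - cos x) (- cos alpha)) with (x := x) as [d Hd].
  + intros y. reg.
  + unfold complementary in *. lra.
  + exists d. intros y Hy. specialize (Hd y Hy). unfold complementary in *. lra.
- intros x. replace (2 * PI) with (2 * INR 1 * PI) by (simpl; ring). now rewrite cos_period.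
Qed.

Lemma arc_cos_iff alpha x : 0 < alpha < PI -> - PI <= x <= PI ->
  (cos alpha <= cos x <-> - alpha <= x <= alpha).
Proof.
intros Ha Hx. assert (W : forall y, 0 <= y <= PI -> (cos alpha <= cos y <-> y <= alpha)).
{ intros y Hy. split; [intros H; apply cos_decr_0; lra|intros H; apply cos_decr_1; lra]. }
destruct (Rle_lt_dec 0 x).
- rewrite W by lra. lra.
- rewrite <- (cos_neg x), W by lra. lra.
Qed.

Lemma arc_mes alpha : 0 < alpha < PI -> mes_T (fun x => cos alpha <= cos x) = 2 * alpha.
Proof.
intros Ha. rewrite (mes_T_centered _ 0 (proj2 (arc_compact alpha))).
- rewrite <- (lebesgue_outer_ext (fun x => - alpha <= x <= alpha)).
  + rewrite lebesgue_outer_itv by lra. ring.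
  + auto.
  + intros x. rewrite Rplus_0_l. split.
    * intros Hx. split; [lra|]. apply arc_cos_iff; lra.
    * intros [Hx Hc]. apply arc_cos_iff in Hc; lra.
- rewrite Rplus_0_l, cos_PI. generalize (cos_decreasing_1 alpha PI). rewrite cos_PI. lra.
Qed.

Lemma arc_segment n alpha : 0 < alpha < PI ->
  is_segment_I n alpha 0 (fun x => cos alpha <= cos x).
Proof.
intros Ha. apply segment_of_arc; [apply arc_compact|exact Ha|].
intros x Hx. replace (IZR 0 * PI / INR n + x) with x by (unfold Rdiv; ring).
now apply arc_cos_iff.
Qed.

(** * From the deviation on Q to level sets *)

Section Deviation.
Variables (m : nat) (Q : R -> Prop) (alpha : R).
Hypothesis Ha : 0 < alpha < PI.
Hypothesis HQ : compact_T Q.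
Hypothesis HQm : mes_T Q = 2 * alpha.
Let s := sin (alpha / 2) ^ (2 * S m).

Let devT a b t := cos (INR (S m) * t) - trig_poly m a b t.

Lemma devT_mono a b : mono m (devT a b).
Proof.
exists (fun t => (-1) * trig_poly m a b t + 0 * trig_poly m a b t). split.
- apply TP_lin; now exists a, b.
- intros t. unfold devT. ring.
Qed.

Lemma mono_devT T : mono m T -> exists a b, forall t, T t = devT a b t.
Proof.
intros (g & Hg & E).
assert (Hg' : TP m (fun t => (-1) * g t + 0 * g t)) by now apply TP_lin.
destruct Hg' as (a & b & E'). exists a, b. intros t. unfold devT. rewrite E, <- E'. ring.
Qed.

Lemma positive_mes_nonempty : exists t, Q t.
Proof.
apply NNPP. intros Hn. assert (H : mes_T Q <= 0 - 0); [|lra].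
apply lebesgue_outer_le_itv; [lra|]. intros x [Hx _]. exfalso. apply Hn. now exists x.
Qed.

Lemma dev_is_lub a b :
  is_lub (fun y => exists t, Q t /\ y = Rabs (devT a b t)) (dev (S m) Q a b).
Proof.
unfold dev. replace (S m - 1)%nat with m by lia. apply Rsup_is_lub.
- destruct positive_mes_nonempty as [t Ht]. now exists (Rabs (devT a b t)), t.
- destruct (TP_bounded _ _ (mono_TP m _ (devT_mono a b))) as [C HC].
  exists C. intros y (t & _ & ->). apply HC.
Qed.

Lemma dev_lower a b : s <= dev (S m) Q a b.
Proof.
assert (HP := PI_RGT_0). destruct (dev_is_lub a b) as [Hub _].
set (M := dev (S m) Q a b) in *.
assert (HM : 0 <= M).
{ destruct positive_mes_nonempty as [t Ht].
  apply Rle_trans with (Rabs (devT a b t)); [apply Rabs_pos|]. apply Hub. now exists t. }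
(* The bound for level sets requires a positive level, whereas [M] is only known to be nonnegative
   here. *)
apply le_epsilon. intros e He.
assert (Hm : 2 * alpha <= meas (devT a b) (M + e)).
{ rewrite <- HQm. apply mes_T_mono. intros x Qx. unfold lev.
  apply Rle_trans with M; [|lra]. apply Hub. now exists x. }
assert (Hb := mes_T_bounds (lev (devT a b) (M + e))). fold (meas (devT a b) (M + e)) in Hb.
eapply Rle_trans; [|apply (mono_lower_bound m (devT a b)); [apply devT_mono|lra]].
apply pow_incr. split; [apply sin_ge_0; lra|apply sin_incr_1; lra].
Qed.

Lemma U_Q_lower : s <= U_Q (S m) Q.
Proof.
apply Rinf_greatest.
- now exists (dev (S m) Q (fun _ => 0) (fun _ => 0)), (fun _ => 0), (fun _ => 0).
- intros y (a & b & ->). apply dev_lower.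
Qed.

Lemma U_Q_le T B : mono m T -> (forall t, Q t -> Rabs (T t) <= B) -> U_Q (S m) Q <= B.
Proof.
intros HT HB. destruct (mono_devT T HT) as (a & b & E).
apply Rle_trans with (dev (S m) Q a b).
- apply Rinf_lower with s; [|now exists a, b]. intros y (a' & b' & ->). apply dev_lower.
- apply dev_is_lub. intros y (t & Ht & ->). rewrite <- E. now apply HB.
Qed.

Lemma U_Q_segment k : is_segment_I (S m) alpha k Q -> U_Q (S m) Q = s.
Proof.
intros Hseg. apply Rle_antisym; [|apply U_Q_lower].
assert (Hn : 0 < INR (S m)) by (apply lt_0_INR; lia).
set (c := IZR k * PI / INR (S m)).
assert (Hs : sin (INR (S m) * c) = 0).
{ replace (INR (S m) * c) with (IZR k * PI) by (unfold c; field; lra).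
  apply sin_eq_0_1. now exists k. }
set (p := cos (alpha / 2) * cos (alpha / 2)). set (q := sin (alpha / 2) * sin (alpha / 2)).
(* Centring the extremal polynomial at [c] multiplies its leading coefficient by [u], which is 1 or
   -1 since sin nc = 0; multiplying by [u] restores it. *)
set (u := cos (INR (S m) * c)).
assert (Hu : u * u = 1).
{ generalize (cos_sin_sq (INR (S m) * c)). rewrite Hs. fold u. lra. }
assert (HC := TPlead_shift m (- c) 1 0 _ (proj2 (arc_cheb_mono p q m))).
assert (HC' := TPlead_lin m u 0 _ _ _ _ _ _ HC HC).
apply (U_Q_le (fun t => u * arc_cheb p q (S m) (t + - c) + 0 * arc_cheb p q (S m) (t + - c))).
- revert HC'. rewrite Ropp_mult_distr_r_reverse, cos_neg, sin_neg, Hs. fold u.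
  apply TPlead_coef; lra.
- intros t Qt. replace (u * arc_cheb p q (S m) (t + - c) + 0 * arc_cheb p q (S m) (t + - c))
    with (u * arc_cheb p q (S m) (t - c)) by (unfold Rminus; ring).
  rewrite Rabs_mult. replace (Rabs u) with 1.
  + rewrite Rmult_1_l. apply (arc_cheb_bound alpha); [exact Ha|].
    now apply (segment_cos (S m) alpha k Q).
  + assert (Hf : (u - 1) * (u + 1) = 0) by (ring_simplify; lra).
    destruct (Rmult_integral _ _ Hf).
    * replace u with 1 by lra. now rewrite Rabs_R1.
    * rewrite Rabs_left; lra.
Qed.

(** Nearly optimal polynomials are bounded on [Q], a set of positive measure, and hence uniformly on
    the circle; a limit of a subsequence attains the infimum. *)
Lemma best_approximation B : B <= 1 -> U_Q (S m) Q = B ->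
  exists T, mono m T /\ forall t, Q t -> Rabs (T t) <= B.
Proof.
intros HB1 HU. assert (HP := PI_RGT_0).
assert (approx : forall j : nat, exists T, mono m T /\
   forall t, Q t -> Rabs (T t) <= B + / INR (S j)).
{ intros j. assert (Hj : 0 < / INR (S j)) by (apply Rinv_0_lt_compat, lt_0_INR; lia).
  apply NNPP. intros Hn.
  assert (H : B + / INR (S j) <= U_Q (S m) Q); [|lra].
  apply Rinf_greatest.
  - now exists (dev (S m) Q (fun _ => 0) (fun _ => 0)), (fun _ => 0), (fun _ => 0).
  - intros y (a & b & ->). apply Rnot_lt_le. intros Hlt. apply Hn.
    exists (devT a b). split; [apply devT_mono|]. intros t Qt.
    apply Rle_trans with (dev (S m) Q a b); [|lra]. apply dev_is_lub. now exists t. }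
set (F := fun j => proj1_sig (constructive_indefinite_description _ (approx j))).
assert (HF : forall j, mono m (F j) /\ forall t, Q t -> Rabs (F j t) <= B + / INR (S j)).
{ intros j. exact (proj2_sig (constructive_indefinite_description _ (approx j))). }
destruct (mono_bound_measure m (2 * alpha)) as (C & HC); [lra|].
destruct (mono_compact m F C) as (phi & T & Hphi & HT & Hunif); [apply HF| |].
{ intros j. apply (HC _ (fun x => Q x /\ 0 <= x < 2 * PI) (proj1 (HF j))).
  - intros t [_ Ht]. lra.
  - change (2 * alpha <= mes_T Q). lra.
  - intros t [Qt _]. eapply Rle_trans; [now apply (proj2 (HF j))|].
    assert (/ INR (S j) <= 1); [|lra].
    rewrite <- Rinv_1. apply Rinv_le_contravar; [lra|]. change 1 with (INR 1). apply le_INR. lia. }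
exists T. split; [exact HT|]. intros t Qt. apply le_epsilon. intros e He.
destruct (Hunif (e / 2)) as (N & HN); [lra|].
destruct (archimed_cor1 (e / 2)) as (N' & HN' & HN0'); [lra|].
set (j := Nat.max N N').
specialize (HN j ltac:(unfold j; lia) t). destruct (HF (phi j)) as [_ Hb]. specialize (Hb t Qt).
assert (/ INR (S (phi j)) <= / INR N').
{ apply Rinv_le_contravar; [now apply lt_0_INR|]. apply le_INR.
  generalize (extraction_ge phi j Hphi). unfold j. lia. }
replace (T t) with (F (phi j) t + - (F (phi j) t - T t)) by ring.
eapply Rle_trans; [apply Rabs_triang|]. rewrite Rabs_Ropp. lra.
Qed.

Lemma U_Q_extremal : U_Q (S m) Q = s -> exists k, is_segment_I (S m) alpha k Q.
Proof.
intros HU. assert (HP := PI_RGT_0).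
assert (Hn : 0 < INR (S m)) by (apply lt_0_INR; lia).
assert (Hs0 : 0 < sin (alpha / 2)) by (apply sin_gt_0; lra).
assert (Hs1 : sin (alpha / 2) < 1).
{ rewrite <- sin_PI2. apply sin_increasing_1; lra. }
assert (Hs : 0 < s < 1).
{ split; [now apply pow_lt|]. unfold s. rewrite <- (pow1 (2 * S m)). apply pow_lt_compat_base;
  [lra|lia]. }
destruct (best_approximation s ltac:(lra) HU) as (T & HT & HTQ).
assert (Hb := mes_T_bounds (lev T s)). fold (meas T s) in Hb.
assert (Hge : 2 * alpha <= meas T s) by (rewrite <- HQm; now apply mes_T_mono).
(* The level set contains [Q]; if its measure were larger, the sharp bound would put the level above
   [s]. *)
assert (EL : meas T s = 2 * alpha).
{ apply Rle_antisym; [|exact Hge]. apply Rnot_lt_le. intros Hlt.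
  assert (Hlow := mono_lower_bound m T s HT (proj1 Hs)).
  assert (Hsin : sin (alpha / 2) < sin (meas T s / 4)) by (apply sin_increasing_1; lra).
  assert (sin (alpha / 2) ^ (2 * S m) < sin (meas T s / 4) ^ (2 * S m)); [|unfold s in *; lra].
  apply pow_lt_compat_base; [lra|lia]. }
destruct (extremal_center m T s HT Hs) as (c & Hc & Harc).
- lra.
- rewrite EL. unfold s. do 2 f_equal. field.
- rewrite EL in Harc. replace (2 * alpha / 2) with alpha in Harc by field.
  destruct (sin_eq_0_0 _ Hc) as [k Hk]. exists k.
  assert (Ec : c = IZR k * PI / INR (S m)) by (rewrite <- Hk; field; lra).
  apply segment_of_arc; [apply HQ|exact Ha|]. rewrite <- Ec.
  assert (HQlev : forall x, - PI <= x <= PI -> Q (c + x) -> - alpha <= x <= alpha).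
  { intros x Hx Qx. apply Harc; [exact Hx|]. now apply HTQ. }
  intros x Hx. split; [now apply HQlev|]. revert x Hx.
  (* [Q] lies in the arc and has its measure; being closed, it cannot miss a point. *)
  assert (Hfull : forall x, - alpha <= x <= alpha -> Q (c + x)); [|intros; now apply Hfull].
  apply (closed_full_arc (fun x => Q (c + x))); [apply closed_set_shift, HQ|lra|].
  rewrite <- HQm, (mes_T_centered Q c (proj2 HQ)).
  + apply lebesgue_outer_ext; [auto|]. intros x. split; intros [H1 H2]; split; auto; lra.
  + intros H. apply HQlev in H; lra.
Qed.
End Deviation.

Theorem theorem8 (n : nat) (alpha : R) :
  (1 <= n)%nat -> 0 < alpha < PI ->
  (forall Q : R -> Prop, compact_T Q -> mes_T Q = 2 * alpha ->
     U_Q n Q >= sin (alpha / 2) ^ (2 * n) /\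
     (U_Q n Q = sin (alpha / 2) ^ (2 * n) <->
        exists k : Z, is_segment_I n alpha k Q)) /\
  U_mes n (2 * alpha) = sin (alpha / 2) ^ (2 * n).
Proof.
intros Hn Ha. destruct n as [|m]; [lia|]. split.
- intros Q HQ HQm. split; [apply Rle_ge; now apply U_Q_lower|]. split.
  + now apply U_Q_extremal.
  + intros [k Hk]. now apply (U_Q_segment m Q alpha Ha HQm k).
- set (Q0 := fun x => cos alpha <= cos x).
  assert (HU0 : U_Q (S m) Q0 = sin (alpha / 2) ^ (2 * S m)).
  { apply (U_Q_segment m Q0 alpha Ha (arc_mes alpha Ha) 0 (arc_segment (S m) alpha Ha)). }
  assert (Hlow : forall u, (exists Q, compact_T Q /\ mes_T Q = 2 * alpha /\ u = U_Q (S m) Q) ->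
     sin (alpha / 2) ^ (2 * S m) <= u).
  { intros u (Q & HQ & HQm & ->). now apply U_Q_lower. }
  assert (Hin : exists Q, compact_T Q /\ mes_T Q = 2 * alpha /\
     sin (alpha / 2) ^ (2 * S m) = U_Q (S m) Q).
  { exists Q0. split; [apply arc_compact|]. split; [now apply arc_mes|now symmetry]. }
  apply Rle_antisym.
  + now apply (Rinf_lower _ (sin (alpha / 2) ^ (2 * S m))).
  + apply Rinf_greatest; [|exact Hlow]. eexists. exact Hin.
Qed.
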